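(* Let $\mathfrak g$ be a complex simple Lie algebra. 1°. Suppose that the highest root $\theta$ is a fundamental weight, and let $\tilde\alpha$ be the unique simple root such that $(\theta,\tilde\alpha)\ne0$. Then (i) $(\mathrm{ad}\,e_{\mathcal K})^4(e_{-\theta+\tilde\alpha})\ne0$ and (ii) $(\mathrm{ad}\,e_{\mathcal K})^5=0$. 2°. If $\theta$ is not a fundamental weight, then $(\mathrm{ad}\,e_{\mathcal K})^3=0$.
   Context: Let $\mathfrak g$ be a complex simple Lie algebra, $\mathfrak t$ a Cartan subalgebra, $\Delta$ the root system, $\Delta^+$ a fixed set of positive roots, $\theta$ the highest root. For $\gamma\in\Delta$, $\mathfrak g_\gamma$ is the root space and $e_\gamma\in\mathfrak g_\gamma$ is a nonzero vector. Let $(\ ,\ )$ be the positive-definite form on the $\mathbb Q$-span of $\Delta$ induced by the Killing form. Kostant cascade $\mathcal K=\{\beta_1,\dots,\beta_m\}\subset\Delta^+$: it is defined recursively. Its first element is $\beta_1=\theta$. The root system $\Delta_\theta=\{\gamma\in\Delta\mid(\gamma,\theta)=0\}$ is decomposed into irreducible components, each with the set of positive roots inherited from $\Delta^+$; the highest roots of these components are added to $\mathcal K$, and the procedure is repeated for each component until it terminates. The roots in $\mathcal K$ are pairwise strongly orthogonal. Put $e_{\mathcal K}=\sum_{\beta\in\mathcal K}e_\beta$, a nilpotent element of $\mathfrak g$. *)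

(* Defs.v *)
From HB Require Import structures.
From mathcomp Require Import all_boot all_order all_algebra.
From mathcomp Require Import complex.
From mathcomp Require Import all_classical reals.

Set Implicit Arguments.
Unset Strict Implicit.
Unset Printing Implicit Defensive.

Import GRing.Theory.

Local Open Scope classical_set_scope.
Local Open Scope ring_scope.

HB.mixin Record Vector_isLieAlgebra (K : fieldType) (g : Type)
    of Vector K g := {
  lie : g -> g -> g ;
  lie_linearl : forall y, linear (lie^~ y) ;
  lie_linearr : forall x, linear (lie x) ;
  lie_alt : forall x, lie x x = 0 ;
  lie_jacobi : forall x y z,
    lie x (lie y z) + lie y (lie z x) + lie z (lie x y) = 0
}.

#[short(type="lieAlgType")]
HB.structure Definition LieAlgebra (K : fieldType) :=
  { g of Vector_isLieAlgebra K g & Vector K g }.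

Section LieTheory.
Context {K : fieldType} {g : lieAlgType K}.
Implicit Types (x y z : g) (U V t : {vspace g}).

Definition simple_lie : Prop :=
  (exists x y, lie x y != 0) /\
  (forall U, (forall x y, y \in U -> lie x y \in U) -> U = 0%VS \/ U = fullv).

HB.instance Definition _ x :=
  GRing.isSemilinear.Build K g g *:%R (lie x)
    (GRing.semilinear_linear (lie_linearr x)).

Definition ad x : 'End(g) := linfun (lie x).

Lemma adE x y : ad x y = lie x y.
Proof. by rewrite lfunE. Qed.

Definition lfun_trace (f : 'End(g)) : K :=
  \tr (passmx.mxof (vbasis (@fullv K g)) (vbasis (@fullv K g)) f).

Definition killing x y : K := lfun_trace (ad x \o ad y)%VF.

Definition lie_prod U V : {vspace g} :=
  <<[seq lie x y | x <- vbasis U, y <- vbasis V]>>%VS.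

Definition nilpotent_sub U : Prop := exists n, iter n (lie_prod U) U = 0%VS.

Definition cartan_subalgebra t : Prop :=
  [/\ forall x y, x \in t -> y \in t -> lie x y \in t,
      nilpotent_sub t
    & forall x, (forall y, y \in t -> lie x y \in t) -> x \in t].

End LieTheory.

Arguments simple_lie {K} g.

Section RootSystem.
Context {K : fieldType} {g : lieAlgType K}.
Variable t : {vspace g}.

Definition dual := 'Hom(subvs_of t, K^o).

Implicit Types (alpha beta gamma delta lambda mu : dual).
Implicit Types (P C A B Phi : set dual).

Definition in_root_space gamma (x : g) : Prop :=
  forall h : subvs_of t, lie (vsval h) x = (gamma h : K) *: x.

Definition lie_roots : set dual :=
  [set gamma | gamma != 0 /\ exists2 x, x != 0 & in_root_space gamma x].

Definition killing_dual (h : subvs_of t) : dual :=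
  linfun (fun h' : subvs_of t => (killing (vsval h) (vsval h') : K^o)).

Definition killing_map : 'Hom(subvs_of t, dual) := linfun killing_dual.

(* When the Killing form is nondegenerate on t, [killing_map^-1 lambda] is the
   element t_lambda of t such that lambda(h) = killing(t_lambda, h). *)
Definition kform lambda mu : K :=
  killing (vsval ((killing_map^-1)%VF lambda)) (vsval ((killing_map^-1)%VF mu)).

Definition positive_roots P : Prop :=
  [/\ P `<=` lie_roots,
      forall gamma, lie_roots gamma -> P gamma \/ P (- gamma),
      forall gamma, ~ (P gamma /\ P (- gamma))
    & forall alpha beta,
        P alpha -> P beta -> lie_roots (alpha + beta) -> P (alpha + beta)].

Definition simple_root P alpha : Prop :=
  P alpha /\ ~ (exists beta gamma, [/\ P beta, P gamma & alpha = beta + gamma]).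

Definition irreducible_roots C : Prop :=
  C !=set0 /\
  forall A B, A `|` B = C ->
    (forall alpha beta, A alpha -> B beta -> kform alpha beta = 0) ->
    A = set0 \/ B = set0.

Definition irreducible_component Phi C : Prop :=
  [/\ C `<=` Phi, irreducible_roots C
    & forall gamma delta, C gamma -> (Phi `\` C) delta -> kform gamma delta = 0].

Definition highest_root P C beta : Prop :=
  C beta /\
  forall gamma, C gamma ->
    exists2 s : seq dual, (forall alpha, alpha \in s -> (C `&` P) alpha)
                        & beta - gamma = \sum_(alpha <- s) alpha.

Inductive cascade_subsystem P : set dual -> Prop :=
| cascade_start : cascade_subsystem P lie_roots
| cascade_step C beta C' :
    cascade_subsystem P C -> highest_root P C beta ->
    irreducible_component [set gamma | C gamma /\ kform gamma beta = 0] C' ->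
    cascade_subsystem P C'.

Definition kostant_cascade P : set dual :=
  [set beta | exists2 C, cascade_subsystem P C & highest_root P C beta].

Definition cartan_pairing lambda alpha : K :=
  2%:R * kform lambda alpha / kform alpha alpha.

Definition fundamental_weight P lambda : Prop :=
  exists2 alpha, simple_root P alpha &
    forall beta, simple_root P beta ->
      cartan_pairing lambda beta = (beta == alpha)%:R.

Definition root_vectors (e : dual -> g) : Prop :=
  forall gamma, lie_roots gamma -> e gamma != 0 /\ in_root_space gamma (e gamma).

(* The cascade is a set of roots, hence finite when g is simple, so this
   finitely supported sum is the sum over the whole cascade. *)
Definition e_cascade P (e : dual -> g) : g :=
  \sum_(beta \in kostant_cascade P) e beta.

End RootSystem.

Arguments lie_roots {K g} t.

(* Main.v *)
From HB Require Import structures.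
Require Import Defs.
From mathcomp Require Import all_boot all_order all_algebra.
From mathcomp Require Import complex.
From mathcomp Require Import all_classical reals.
From mathcomp Require Import ring lra zify.

(** Let [h] be the sum of the coroots of the roots in the cascade. As the cascade
    is strongly orthogonal, [e_K], [h] and the sum [f_K] of suitable opposite root
    vectors form an [sl2]-triple, [ad e_K] raises the eigenvalues of [ad h] by [2],
    and [h] acts on the root space of [a] by the integer
    [deg a = \sum_(b in K) (a, b^vee)]. Everything thus reduces to bounds for [deg].

    Bessel's inequality for the orthogonal set [K] reads
    [\sum_K (a, b^vee) (b, a^vee) <= 4], and [(a, b^vee)] never exceeds the product
    [(a, b^vee) (b, a^vee)]; so [deg a <= 4] for every root, whence
    [(ad e_K)^5 = 0] in all cases.

    If [theta] is not a fundamental weight, then [deg a <= 2], whence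
    [(ad e_K)^3 = 0] ([thdeg_le2]). Let [g] be a root with [(g, theta^vee) = 1] and
    [deg g >= 3], and let [w g] be its image under the product of the reflections in
    [S = K \ theta]. Then [(g, w g) <= 0], so that [g + w g - theta] is zero or a
    root orthogonal to [theta]. Two distinct simple roots not orthogonal to [theta]
    have coefficient [1] in [theta] and an odd coefficient in this vector, which is
    impossible; if there is only one such simple root [a], with
    [(theta, a^vee) >= 2], then Bessel's inequality is an equality and the
    reflection of [theta] in [g] exhibits a sum of two elements of [S], or twice an
    element of [S], as a root ([core_fundamental]). Roots orthogonal to [theta] are differences of two roots
    [g] as above.

    If [theta] is a fundamental weight and [al] is the simple root not orthogonal to
    it, the reflections in the cascade multiply to the longest element of the Weyl
    group ([cascade_refl_neg]), so those in [S] exchange the lowest root [al] and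
    the highest root [theta - al] of the roots [g] above. This computes [2 al] as
    a combination of [theta] and [S], gives [deg (al - theta) = -4]
    ([fund_lowest]), and a lowest weight vector of weight [-4] is not killed by
    [(ad e_K)^4] ([ad_E4_neq0]).

    The structure theory underneath is obtained from one identity
    ([string_trace]): on a sum of weight spaces stable under [ad x] and [ad y], the
    trace of [ad [x, y]] vanishes. Applied to strings of weights it gives Cartan's
    criterion ([killing_neq0]), the dimension one of root spaces
    ([root_space_dim]), the integrality of Cartan numbers and the stability of the
    roots under reflections ([root_segment]). The record [root_data] collects what
    is used afterwards. *)

Set Implicit Arguments.
Unset Strict Implicit.
Unset Printing Implicit Defensive.

Import Order.TTheory GRing.Theory Num.Theory.
Local Open Scope ring_scope.

(** * Traces and Fitting decompositions *)

Lemma linfun_linear (K : fieldType) (U V : vectType K) (f : U -> V) :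
  linear f -> linfun f =1 f.
Proof.
move=> fP; pose L := GRing.isLinear.Build _ _ _ _ _ fP.
pose LL : {linear U -> V} := HB.pack f L.
exact: (lfunE LL).
Qed.

Section LfunLinear.
Variables (K : fieldType) (U V : vectType K) (f : 'Hom(U, V)).

Lemma lfZ a x : f (a *: x) = a *: f x. Proof. exact: linearZZ. Qed.
Lemma lfD x y : f (x + y) = f x + f y. Proof. exact: linearD. Qed.
Lemma lfN x : f (- x) = - f x. Proof. exact: linearN. Qed.
Lemma lfB x y : f (x - y) = f x - f y. Proof. exact: linearB. Qed.
Lemma lf0 : f 0 = 0. Proof. exact: linear0. Qed.

End LfunLinear.

Section Trace.
Variables (K : fieldType) (V : vectType K).
Implicit Types (f g p : 'End(V)) (U W : {vspace V}).

(** The trace on any vector type; [killing] is built on its instance at a Lie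
    algebra. *)
Definition trf f : K :=
  \tr (passmx.mxof (vbasis {:V}) (vbasis {:V}) f).

Lemma trfE f : trf f = \sum_i coord (vbasis {:V}) i (f (vbasis {:V})`_i).
Proof.
by apply: eq_bigr => i _; rewrite !mxE /= passmx.vecof_delta.
Qed.

Lemma trfD f g : trf (f + g) = trf f + trf g.
Proof.
by rewrite !trfE -big_split; apply: eq_bigr => i _; rewrite lfunE linearD.
Qed.

Lemma trfZ a f : trf (a *: f) = a * trf f.
Proof.
by rewrite !trfE mulr_sumr; apply: eq_bigr => i _; rewrite lfunE linearZ.
Qed.

Lemma trf0 : trf 0 = 0.
Proof. by rewrite -[0](scale0r (0 : 'End(V))) trfZ mul0r. Qed.

Lemma trfN f : trf (- f) = - trf f.
Proof. by rewrite -scaleN1r trfZ mulN1r. Qed.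

Lemma trf_sum I (r : seq I) (P : pred I) (F : I -> 'End(V)) :
  trf (\sum_(i <- r | P i) F i) = \sum_(i <- r | P i) trf (F i).
Proof. exact: (big_morph _ trfD trf0). Qed.

Lemma trf_comp f g : trf (f \o g)%VF = trf (g \o f)%VF.
Proof.
pose e := vbasisP {:V}.
by rewrite /trf !(passmx.mxof_comp _ _ e) mxtrace_mulC.
Qed.

Lemma trf_rank1 f (phi : V -> K) v : scalar phi ->
  (forall z, f z = phi z *: v) -> trf f = phi v.
Proof.
move=> phiP fE; rewrite trfE.
pose ph := GRing.isLinear.Build _ _ _ _ phi phiP.
pose phL : {scalar V} := HB.pack phi ph.
have -> : phi v = \sum_i coord (vbasis {:V}) i v * phi (vbasis {:V})`_i.
  rewrite {1}[v](coord_vbasis (memvf v)) -[phi]/(phL : V -> K) linear_sum.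
  by apply: eq_bigr => i _; rewrite linearZ.
by apply: eq_bigr => i _; rewrite fE linearZ /= mulrC.
Qed.

(** An idempotent is the sum of the rank-one maps attached to a basis of its
    image, each of trace [1]. *)
Lemma trf_idem p : (forall x, p (p x) = p x) -> trf p = (\dim (limg p))%:R.
Proof.
move=> pp; set U := limg p.
have pU z : p z \in U by rewrite memv_img ?memvf.
have pid u : u \in U -> p u = u by case/memv_imgP=> z _ ->.
have -> : p = \sum_(i < \dim U)
    linfun (fun z => (coord (vbasis U) i (p z)) *: (vbasis U)`_i).
  apply/lfunP => z; rewrite sum_lfunE {1}(coord_vbasis (pU z)).
  apply: eq_bigr => i _.
  by rewrite linfun_linear // => a x y; rewrite linearP /= linearP /= scalerDl scalerA.
rewrite trf_sum (eq_bigr (fun=> 1)) ?sumr_const ?card_ord // => i _.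
have phS : scalar (fun z => coord (vbasis U) i (p z)).
  by move=> a x y; rewrite linearP /= linearP.
rewrite (@trf_rank1 _ (fun z => coord (vbasis U) i (p z)) (vbasis U)`_i phS).
  rewrite pid ?(vbasis_mem (mem_nth _ _)) ?size_tuple //.
  by rewrite coord_free ?eqxx // (basis_free (vbasisP _)).
move=> z; rewrite linfun_linear // => a x y.
by rewrite linearP /= linearP /= scalerDl scalerA.
Qed.

(** Replacing [f] by its restriction to the image of [f], then of [f^2], and so
    on, leaves the trace unchanged. *)
Lemma trf_nilp f n : (forall x, iter n f x = 0) -> trf f = 0.
Proof.
move=> fn.
have step U : (f @: U <= U)%VS ->
    trf (f \o projv U)%VF = trf (f \o projv (f @: U))%VF.
  move=> sU.
  have -> : (f \o projv U = projv (f @: U) \o (f \o projv U))%VF.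
    by apply/lfunP=> x; rewrite !comp_lfunE (projv_id (memv_img f (memv_proj U x))).
  rewrite [LHS]trf_comp -comp_lfunA; congr (trf (f \o _)%VF).
  apply/lfunP=> x; rewrite comp_lfunE projv_id //.
  by apply: (subvP sU); apply: memv_proj.
have tr_it k : trf f = trf (f \o projv (iter k (lfun_img f) fullv))%VF.
  elim: k => [|k IH].
    by congr trf; apply/lfunP=> x; rewrite comp_lfunE projv_id ?memvf.
  rewrite IH step //= .
  by elim: k {IH} => [|k IH]; [apply: subvf | apply: limgS].
have im k x : x \in iter k (lfun_img f) fullv -> exists y, x = iter k f y.
  elim: k x => [|k IH] x; first by exists x.
  by case/memv_imgP=> y /IH [z ->] ->; exists z.
rewrite (tr_it n) (_ : (_ \o _)%VF = 0) ?trf0 //.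
apply/lfunP=> x; rewrite comp_lfunE lfunE /=.
have [y ->] := im _ _ (memv_proj (iter n (lfun_img f) fullv) x).
by rewrite fn linear0.
Qed.

Lemma iter_lfunD f n x y : iter n f (x + y) = iter n f x + iter n f y.
Proof. by elim: n => //= n ->; rewrite linearD. Qed.

Lemma iter_lfun0 f n : iter n f 0 = 0.
Proof. by elim: n => //= n ->; rewrite linear0. Qed.

Lemma iter_lfunB f n x y : iter n f (x - y) = iter n f x - iter n f y.
Proof. by elim: n => //= n ->; rewrite linearB. Qed.

Lemma iter_eq0_leq f m n x : (m <= n)%N -> iter m f x = 0 -> iter n f x = 0.
Proof. by move=> /subnK <- fx; rewrite iterD fx iter_lfun0. Qed.

Lemma iter_stable f g n x : (forall y, f (g y) = g (f y)) ->
  iter n f (g x) = g (iter n f x).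
Proof. by move=> fg; elim: n => //= n ->. Qed.

(** Iterating [f |-> [f, k]], the operator whose nilpotency on [k] replaces
    commutation of [f] and [k] when the acting Lie algebra is nilpotent. *)
Definition commf f g : 'End(V) := ((f \o g) - (g \o f))%VF.

Lemma commfE f g x : commf f g x = f (g x) - g (f x).
Proof. by rewrite /commf add_lfunE opp_lfunE !comp_lfunE. Qed.

(** [q] projects onto the stable image of [f] along its stable kernel. Both are
    preserved by every [k] with [ad_f^N k = 0], by induction on [N] from
    [f k = k f + [f, k]], and this makes [q] commute with [k]. *)
Lemma fitting f : exists q : 'End(V),
  [/\ forall x, q (q x) = q x,
      exists n, forall x, iter n f (x - q x) = 0,
      forall m x, iter m f (q x) = 0 -> q x = 0
    & forall N k, iter N (commf f) k = 0 -> forall x, k (q x) = q (k x)].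
Proof.
pose F n := iter n (comp_lfun f) \1%VF.
have FE n x : F n x = iter n f x.
  by elim: n x => [|n IH] x; rewrite /F /= ?id_lfunE // comp_lfunE IH.
(* the images of the powers of [f] are stationary from [n0] on *)
have [n0 n0P] : exists n, forall m, (\dim (limg (F n)) <= \dim (limg (F m)))%N.
  pose P d := `[< exists n, \dim (limg (F n)) = d >].
  have exP : exists d, P d by exists (\dim (limg (F 0%N))); apply/asboolP; exists 0%N.
  case: (ex_minnP exP) => d /asboolP[n <-] dm.
  by exists n => m; apply: dm; apply/asboolP; exists m.
pose I := limg (F n0); pose N := lker (F n0).
have IP x : reflect (exists y, x = iter n0 f y) (x \in I).
  apply: (iffP memv_imgP) => [[y _ ->]|[y ->]]; exists y; rewrite ?memvf // ?FE //.
have NP x : (x \in N) = (iter n0 f x == 0) by rewrite memv_ker FE.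
have fI x : x \in I -> f x \in I.
  by case/IP=> y ->; apply/IP; exists (f y); rewrite -iterSr.
have fIm m x : x \in I -> iter m f x \in I.
  by move=> xI; elim: m => //= m; apply: fI.
have img m : (F m @: I)%VS = I.
  apply/eqP; rewrite eqEdim; apply/andP; split.
    by apply/subvP=> _ /memv_imgP[y /fIm yI ->]; rewrite FE.
  apply: leq_trans (n0P (m + n0)%N) _.
  apply/dimvS/subvP=> _ /memv_imgP[y _ ->].
  by rewrite FE iterD -FE memv_img // -FE memv_img ?memvf.
have inj m x : x \in I -> iter m f x = 0 -> x = 0.
  move=> xI fx; apply/eqP; rewrite -memv0.
  have /eqP := limg_ker_dim (F m) I.
  rewrite img -[X in _ == X]add0n eqn_add2r dimv_eq0 => /eqP <-.
  by rewrite memv_cap xI memv_ker FE fx eqxx.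
have surj m x : x \in I -> exists2 y, y \in I & x = iter m f y.
  by rewrite -{1}(img m) => /memv_imgP[y yI ->]; exists y; rewrite // FE.
have dIN : (I :&: N = 0)%VS.
  apply/eqP; rewrite -subv0; apply/subvP=> x.
  by rewrite memv_cap NP memv0 => /andP[xI /eqP /(inj _ _ xI) ->].
have fullIN : (I + N = fullv)%VS.
  apply/eqP; rewrite eqEsubv subvf; apply/subvP=> x _ /=.
  have [y yI e] := surj n0 (iter n0 f x) (introT (IP _) (ex_intro _ x erefl)).
  rewrite -[x](subrK y) addrC memv_add // NP iter_lfunB e subrr //.
pose q := daddv_pi I N.
have qI x : q x \in I by apply: memv_pi.
have qN x : x - q x \in N.
  have := daddv_pi_add dIN (_ : x \in (I + N)%VS).
  rewrite fullIN => /(_ (memvf _)) e; rewrite -{1}e addrC addKr; exact: memv_pi.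
exists q; split.
- by move=> x; apply: daddv_pi_proj.
- by exists n0 => x; apply/eqP; rewrite -NP.
- by move=> m x; apply: inj.
have kI n k : iter n (commf f) k = 0 -> forall x, x \in I -> k x \in I.
  elim: n k => [|n IH] k; first by move=> /= -> x _; rewrite lfunE /= mem0v.
  rewrite iterSr => /IH kI x xI.
  have [y yI ->] := surj n0 _ xI.
  suff [i iI ->] : exists2 i, i \in I & k (iter n0 f y) = iter n0 f (k y) + i.
    by apply: rpredD => //; apply/IP; exists (k y).
  elim: (n0) => [|m [i iI e]]; first by exists 0; rewrite ?mem0v ?addr0.
  exists (f i - commf f k (iter m f y)).
    by rewrite rpredB ?fI // kI // fIm.
  by rewrite -[LHS](subKr (f (k (iter m f y)))) -commfE e linearD addrA.
have kN n k : iter n (commf f) k = 0 ->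
    forall m x, iter m f x = 0 -> exists j, iter j f (k x) = 0.
  elim: n k => [|n IH] k; first by move=> /= -> m x _; exists 0%N; rewrite /= lfunE.
  rewrite iterSr => /IH kN; elim=> [|m IHm] x.
    by move=> /= ->; exists 0%N; rewrite /= linear0.
  move=> fx; have [a fa] : exists j, iter j f (k (f x)) = 0.
    by apply: IHm; rewrite -iterSr.
  have [b fb] := kN _ _ fx.
  exists (maxn a b).+1; rewrite iterSr.
  rewrite -[f (k x)](subrK (k (f x))) -commfE iter_lfunD.
  by rewrite (iter_eq0_leq _ fb) ?leq_maxr // (iter_eq0_leq _ fa) ?leq_maxl ?addr0.
have q0 x m : iter m f x = 0 -> q x = 0.
  move=> fx; apply: (inj (maxn m n0)) => //.
  rewrite -[q x](subKr x) iter_lfunB (iter_eq0_leq _ fx) ?leq_maxl // sub0r.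
  apply/eqP; rewrite oppr_eq0; apply/eqP; apply: (@iter_eq0_leq _ n0).
    by rewrite leq_maxr.
  by apply/eqP; rewrite -NP.
move=> n k kn x.
rewrite -{2}[x](subrK (q x)) linearD linearD /=.
have /eqP xN : iter n0 f (x - q x) == 0 by rewrite -NP.
have [j /q0 ->] := kN _ _ kn _ _ xN.
by rewrite add0r [RHS](daddv_pi_id dIN) // (kI _ _ kn).
Qed.

End Trace.

Lemma eigenvector_exists (K : closedFieldType) (V : vectType K) (f : 'End(V))
    (U : {vspace V}) : U != 0%VS -> (forall x, x \in U -> f x \in U) ->
  exists a x, [/\ x \in U, x != 0 & f x = a *: x].
Proof.
move=> U0 fU; pose S := subvs_of U.
have lin : linear (fun u : S => vsproj U (f (vsval u)) : S).
  by move=> a x y; rewrite !linearP.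
pose g : 'End(S) := linfun (fun u : S => vsproj U (f (vsval u)) : S).
pose e := vbasis {:S}.
pose M := passmx.mxof e e g.
have : size (char_poly M) != 1%N by rewrite size_char_poly dimvf /dim /= eqSS dimv_eq0.
case/closed_rootP=> a; rewrite -eigenvalue_root_char /eigenvalue => ea.
have : passmx.leigenspace g a != 0%VS.
  by rewrite (passmx.leigenspaceE (vbasisP _)) passmx.vsof_eq0 // (vbasisP _).
rewrite -vpick0; set u := vpick _ => u0.
have := memv_pick (passmx.leigenspace g a); rewrite -/u memv_ker.
rewrite add_lfunE opp_lfunE scale_lfunE id_lfunE subr_eq0 => /eqP gu.
exists a, (vsval u); split; first exact: subvsP.
  by apply: contraNneq u0 => u0; apply/eqP/val_inj.
move/(congr1 vsval): gu; rewrite linfun_linear //= vsprojK // fU //; exact: subvsP.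
Qed.

(** * Joint generalised eigenspaces of a nilpotent family *)

Section WeightSplit.
Variables (K : fieldType) (V : vectType K) (I : Type) (T : I -> 'End(V)).
Implicit Types (f k p q : 'End(V)).

Definition commuting p := forall i x, T i (p x) = p (T i x).

Definition idempotent_lfun p := forall x, p (p x) = p x.

Definition shift f (a : K) : 'End(V) := f - a *: \1%VF.

Lemma shiftE f a x : shift f a x = f x - a *: x.
Proof. by rewrite /shift add_lfunE opp_lfunE scale_lfunE id_lfunE. Qed.

Lemma commf_shift f a k : commf (shift f a) k = commf f k.
Proof.
apply/lfunP=> x; rewrite !commfE !shiftE lfB lfZ.
by rewrite opprB addrA subrK.
Qed.

Definition single_weight p := forall i, exists a n,
  forall x, iter n (shift (T i) a) (p x) = 0.

Lemma iter_comm_shift f a p n x : (forall y, f (p y) = p (f y)) ->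
  iter n (shift f a) (p x) = p (iter n (shift f a) x).
Proof.
by move=> fp; apply: iter_stable => y; rewrite !shiftE lfB lfZ fp.
Qed.

Hypothesis T_nilp : forall i j, exists N, iter N (commf (T i)) (T j) = 0.

(** The Fitting projection of [(T i - a) p0] cuts [p0] into the part where
    [T i - a] is nilpotent and a part where it is invertible; [T_nilp] makes the
    cut compatible with the whole family. *)
Lemma fitting_split p0 i a : idempotent_lfun p0 -> commuting p0 ->
  exists q, [/\ idempotent_lfun q, commuting q,
    forall x, p0 (q x) = q x, forall x, q (p0 x) = q x
    & (exists n, forall x, iter n (shift (T i) a) (p0 x - q x) = 0) /\
      (forall x, T i x = a *: x -> q x = 0)].
Proof.
move=> pp pT; pose D := shift (T i) a.
have Dp x : D (p0 x) = p0 (D x).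
  by rewrite /D !shiftE pT lfB lfZ.
pose f := (D \o p0)%VF.
have fE x : f x = D (p0 x) by rewrite comp_lfunE.
have [q [qq [n qn] q0 qC]] := fitting f.
have Cp k : (forall x, k (p0 x) = p0 (k x)) -> forall n : nat,
    (forall x, iter n (commf D) k (p0 x) = p0 (iter n (commf D) k x)) /\
    iter n (commf f) (k \o p0)%VF = (iter n (commf D) k \o p0)%VF.
  move=> kp; elim=> [|m [IH1 IH2]] //; split.
    by move=> x; rewrite iterS !commfE lfB IH1 !Dp IH1.
  rewrite iterS IH2; apply/lfunP=> x.
  by rewrite !(comp_lfunE, commfE, iterS, fE) -IH1 !pp -Dp !pp.
have qT : commuting q.
  move=> j x; have [N TN] := T_nilp i j.
  apply: (qC N.+1); rewrite iterSr.
  have -> : commf f (T j) = (commf D (T j) \o p0)%VF.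
    by apply/lfunP=> y; rewrite !(commfE, comp_lfunE, fE) pT.
  have cp y : commf D (T j) (p0 y) = p0 (commf D (T j) y).
    by rewrite !commfE lfB pT !Dp pT.
  rewrite (Cp _ cp N).2 -iterSr iterS.
  have -> : iter N (commf D) (T j) = 0.
    rewrite -TN; elim: (N) => //= m ->; exact: commf_shift.
  by apply/lfunP=> y; rewrite comp_lfunE commfE !zero_lfunE lf0 subrr.
have qf x : f (q x) = q (f x).
  apply: (qC 1); apply/lfunP=> y; by rewrite /= commfE subrr zero_lfunE.
have pq x : p0 (q x) = q (p0 x).
  by apply: (qC 1); apply/lfunP=> y; rewrite /= commfE !fE pp -Dp pp subrr zero_lfunE.
have qp x : q (p0 x) = q x.
  apply/eqP; rewrite eq_sym -subr_eq0 -lfB; apply/eqP/(q0 1%N).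
  by rewrite /= qf fE lfB /= pp subrr lf0 lf0.
exists q; split=> //; first by move=> x; rewrite pq.
split; last first.
  move=> x xi; apply: (q0 1%N); rewrite /= qf fE Dp /D shiftE xi subrr.
  by rewrite lf0 lf0.
exists n => x.
have e m y : iter m D (p0 y) = iter m f (p0 y).
  by elim: m => //= m ->; elim: m => [|m IH] /=; rewrite !fE ?pp // -Dp pp.
by rewrite -(qp x) -pq -lfB e lfB pq; apply: qn.
Qed.


Lemma limg_idemP p x : idempotent_lfun p -> (x \in limg p) = (p x == x).
Proof.
move=> pp; apply/memv_imgP/eqP => [[y _ ->]|<-]; first by rewrite pp.
by exists x; rewrite ?memvf.
Qed.

(** The joint generalised eigenspaces, presented by the projections onto them
    rather than as subspaces: traces over them and their stability then become
    identities between endomorphisms of the whole space. *)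
Record weight_projections p0 (ps : seq 'End(V)) : Prop := WeightProjections {
  wp_idem : forall p, p \in ps -> idempotent_lfun p;
  wp_neq0 : forall p, p \in ps -> p != 0;
  wp_comm : forall p, p \in ps -> commuting p;
  wp_single : forall p, p \in ps -> single_weight p;
  wp_uniq : uniq ps;
  wp_orth : forall p p', p \in ps -> p' \in ps -> p != p' ->
     forall x, p (p' x) = 0;
  wp_subl : forall p, p \in ps -> forall x, p0 (p x) = p x;
  wp_subr : forall p, p \in ps -> forall x, p (p0 x) = p x;
  wp_sum : forall x, \sum_(p <- ps) p x = p0 x
}.

Lemma weight_projections_cat p0 p1 p2 ps1 ps2 :
  idempotent_lfun p0 -> idempotent_lfun p2 ->
  (forall x, p0 (p2 x) = p2 x) -> (forall x, p2 (p0 x) = p2 x) ->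
  p1 = p0 - p2 ->
  weight_projections p1 ps1 -> weight_projections p2 ps2 ->
  weight_projections p0 (ps1 ++ ps2).
Proof.
move=> p00 p22 p02 p20 p1E w1 w2.
have p1x x : p1 x = p0 x - p2 x by rewrite p1E add_lfunE opp_lfunE.
have p12 x : p1 (p2 x) = 0 by rewrite p1x p02 p22 subrr.
have p21 x : p2 (p1 x) = 0 by rewrite p1x lfB p20 p22 subrr.
have p01 x : p0 (p1 x) = p1 x by rewrite p1x lfB p00 p02.
have p10 x : p1 (p0 x) = p1 x by rewrite !p1x p00 p20.
have o12 p p' : p \in ps1 -> p' \in ps2 -> forall x, p (p' x) = 0.
  by move=> h h' x; rewrite -(wp_subr w1 h) -(wp_subl w2 h') p12 lf0.
have o21 p p' : p \in ps2 -> p' \in ps1 -> forall x, p (p' x) = 0.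
  by move=> h h' x; rewrite -(wp_subr w2 h) -(wp_subl w1 h') p21 lf0.
split=> [p|p|p|p||p p'|p|p|x]; rewrite ?mem_cat.
- by case/orP=> h; [apply: (wp_idem w1) | apply: (wp_idem w2)].
- by case/orP=> h; [apply: (wp_neq0 w1) | apply: (wp_neq0 w2)].
- by case/orP=> h; [apply: (wp_comm w1) | apply: (wp_comm w2)].
- by case/orP=> h; [apply: (wp_single w1) | apply: (wp_single w2)].
- rewrite cat_uniq (wp_uniq w1) (wp_uniq w2) andbT /=.
  apply/hasPn=> p h; apply/negP=> h'; have /eqP[] := wp_neq0 w2 h.
  by apply/lfunP=> x; rewrite -(wp_idem w2 h) (o12 _ _ h' h) zero_lfunE.
- case/orP=> h /orP[] h'; [exact: (wp_orth w1) | move=> _; exact: o12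
    | move=> _; exact: o21 | exact: (wp_orth w2)].
- case/orP=> h x; first by rewrite -(wp_subl w1 h) p01.
  by rewrite -(wp_subl w2 h) p02.
- case/orP=> h x; first by rewrite -(wp_subr w1 h) p10 (wp_subr w1 h).
  by rewrite -(wp_subr w2 h) p20 (wp_subr w2 h).
by rewrite big_cat /= (wp_sum w1) (wp_sum w2) p1x subrK.
Qed.

End WeightSplit.

(** As long as some [T i] has more than one eigenvalue on the image of [p0],
    each of its eigenvalues cuts [p0] into two smaller projections. *)
Lemma weight_split (K : closedFieldType) (V : vectType K) (I : Type)
    (T : I -> 'End(V)) :
  (forall i j, exists N, iter N (commf (T i)) (T j) = 0) ->
  forall p0, idempotent_lfun p0 -> commuting T p0 ->
  exists ps, weight_projections T p0 ps.
Proof.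
move=> T_nilp p0; move: {2}(_.+1) (ltnSn (\dim (limg p0))) => n.
elim: n p0 => // n IH p0 dn pp pT.
have [p00|pn0] := eqVneq p0 0.
  exists [::]; split=> // x; rewrite big_nil p00 zero_lfunE //.
have [sw|] := pselect (single_weight T p0).
  exists [:: p0]; split=> //; try by move=> p /[1!inE] /eqP ->.
    by move=> p p' /[!inE] /eqP -> /eqP ->; rewrite eqxx.
  by move=> x; rewrite big_seq1.
move/existsNP=> [i isw].
have U0 : limg p0 != 0%VS.
  apply: contra_neq pn0 => U0; apply/lfunP=> x; rewrite zero_lfunE.
  by apply/eqP; rewrite -memv0 -U0 memv_img ?memvf.
have [x xU|a [x0 [x0U xn0 xi]]] := @eigenvector_exists _ _ (T i) _ U0.
  by move: xU; rewrite !limg_idemP // => /eqP {2}<-; rewrite pT.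
have [q [qq qT pq qp [[m qm] qi]]] := fitting_split T_nilp i a pp pT.
pose p1 := p0 - q.
have p1x x : p1 x = p0 x - q x by rewrite add_lfunE opp_lfunE.
have p11 : idempotent_lfun p1.
  by move=> x; rewrite !p1x !lfB pp pq qp qq subrr subr0.
have p1T : commuting T p1 by move=> j x; rewrite !p1x lfB pT qT.
have sub r : idempotent_lfun r -> (forall x, p0 (r x) = r x) ->
    (exists2 x, x \in limg p0 & x \notin limg r) ->
    (\dim (limg r) < n)%N.
  move=> rr pr [y y0 yr]; rewrite ltnS in dn; apply: leq_trans dn; rewrite ltn_neqAle.
  have s : (limg r <= limg p0)%VS.
    by apply/subvP=> z; rewrite !limg_idemP // => /eqP <-; rewrite pr.
  rewrite dimvS // andbT; apply: contra yr => /eqP e.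
  by have /eqP -> : limg r == limg p0 by rewrite eqEdim s e /=.
have [||//|ps2 w2] := IH q.
  by apply: sub => //; exists x0; rewrite // limg_idemP // qi // eq_sym.
- exact: qq.
have [||//|ps1 w1] := IH p1.
- apply: sub => // [x|]; first by rewrite p1x lfB pp pq.
  apply: contrapT => no; apply: isw; exists a, m => x.
  rewrite -[RHS](qm x); congr iter; rewrite -p1x; apply/esym/eqP.
  have -> : p1 x = p1 (p0 x) by rewrite !p1x pp qp.
  rewrite -limg_idemP //; apply: contrapT => /negP pn; apply: no.
  by exists (p0 x); rewrite // limg_idemP // pp.
- exact: p11.
exists (ps1 ++ ps2); exact: (weight_projections_cat pp qq pq qp erefl w1 w2).
Qed.

(** * The weight decomposition of a Lie algebra under a nilpotent subalgebra *)

Section LieBasics.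
Variables (K : fieldType) (g : lieAlgType K).
Implicit Types x y z : g.

Lemma lieDr x y z : lie x (y + z) = lie x y + lie x z.
Proof. by rewrite -!adE lfD. Qed.

Lemma lieZr a x y : lie x (a *: y) = a *: lie x y.
Proof. by rewrite -!adE lfZ. Qed.

Lemma lieNr x y : lie x (- y) = - lie x y.
Proof. by rewrite -!adE lfN. Qed.

Lemma lieBr x y z : lie x (y - z) = lie x y - lie x z.
Proof. by rewrite -!adE lfB. Qed.

Lemma lie0r x : lie x 0 = 0.
Proof. by rewrite -adE lf0. Qed.

Lemma lie_sumr I (r : seq I) (P : pred I) (F : I -> g) x :
  lie x (\sum_(i <- r | P i) F i) = \sum_(i <- r | P i) lie x (F i).
Proof. exact: (big_morph _ (lieDr x) (lie0r x)). Qed.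

Lemma lieDl x y z : lie (x + y) z = lie x z + lie y z.
Proof. by have := lie_linearl z 1 x y; rewrite !scale1r. Qed.

Lemma lieC x y : lie x y = - lie y x.
Proof.
apply/eqP; rewrite -addr_eq0; have := lie_alt (x + y).
by rewrite lieDr !lieDl !lie_alt add0r addr0 addrC => ->.
Qed.

Lemma lieZl a x y : lie (a *: x) y = a *: lie x y.
Proof. by rewrite lieC lieZr -scalerN -lieC. Qed.

Lemma lieNl x y : lie (- x) y = - lie x y.
Proof. by rewrite lieC lieNr -lieC. Qed.

Lemma lieBl x y z : lie (x - y) z = lie x z - lie y z.
Proof. by rewrite lieDl lieNl. Qed.

Lemma lie0l x : lie 0 x = 0.
Proof. by rewrite lieC lie0r oppr0. Qed.

Lemma lie_suml I (r : seq I) (P : pred I) (F : I -> g) x :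
  lie (\sum_(i <- r | P i) F i) x = \sum_(i <- r | P i) lie (F i) x.
Proof.
by rewrite lieC lie_sumr -sumrN; apply: eq_bigr => i _; rewrite [RHS]lieC.
Qed.

Lemma lie_der x y z : lie x (lie y z) = lie (lie x y) z + lie y (lie x z).
Proof.
have := lie_jacobi x y z; rewrite (lieC z (lie x y)) (lieC z x) lieNr.
by move/eqP; rewrite subr_eq0 subr_eq => /eqP ->.
Qed.

Lemma ad_lie x y : ad (lie x y) = commf (ad x) (ad y).
Proof. by apply/lfunP=> z; rewrite commfE !adE lie_der addrK. Qed.

Lemma killing_tr x y : killing x y = trf (ad x \o ad y)%VF.
Proof. by []. Qed.

Lemma adD x y : ad (x + y) = ad x + ad y.
Proof. by apply/lfunP=> z; rewrite add_lfunE !adE lieDl. Qed.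

Lemma adZ a x : ad (a *: x) = a *: ad x.
Proof. by apply/lfunP=> z; rewrite scale_lfunE !adE lieZl. Qed.

Lemma killingDr x y z : killing x (y + z) = killing x y + killing x z.
Proof. by rewrite !killing_tr adD comp_lfunDr trfD. Qed.

Lemma killingZr a x y : killing x (a *: y) = a * killing x y.
Proof. by rewrite !killing_tr adZ -comp_lfunZr trfZ. Qed.

Lemma killingC x y : killing x y = killing y x.
Proof. by rewrite !killing_tr trf_comp. Qed.

Lemma killingDl x y z : killing (x + y) z = killing x z + killing y z.
Proof. by rewrite !(killingC _ z) killingDr. Qed.

Lemma killingZl a x y : killing (a *: x) y = a * killing x y.
Proof. by rewrite !(killingC _ y) killingZr. Qed.

Lemma killing0r x : killing x 0 = 0.
Proof. by rewrite -[0](scale0r (0 : g)) killingZr mul0r. Qed.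

Lemma killing_sumr I (r : seq I) (P : pred I) (F : I -> g) x :
  killing x (\sum_(i <- r | P i) F i) = \sum_(i <- r | P i) killing x (F i).
Proof. exact: (big_morph _ (killingDr x) (killing0r x)). Qed.

(** Invariance of the Killing form, from the cyclicity of the trace. *)
Lemma killing_inv x y z : killing (lie x y) z = killing x (lie y z).
Proof.
rewrite !killing_tr !ad_lie.
have cE (f h k : 'End(g)) : (commf f h \o k = (f \o h \o k) - (h \o f \o k))%VF.
  by apply/lfunP=> u; rewrite comp_lfunE commfE add_lfunE opp_lfunE !comp_lfunE.
have cE' (f h k : 'End(g)) : (k \o commf f h = (k \o (f \o h)) - (k \o (h \o f)))%VF.
  apply/lfunP=> u; rewrite comp_lfunE commfE add_lfunE opp_lfunE !comp_lfunE.
  by rewrite lfB.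
rewrite cE cE' !trfD !trfN -!comp_lfunA; congr (_ - _).
by rewrite trf_comp -comp_lfunA.
Qed.

Lemma mem_lie_prod (U W : {vspace g}) x y :
  x \in U -> y \in W -> lie x y \in lie_prod U W.
Proof.
move=> xU yW; rewrite (coord_vbasis xU) (coord_vbasis yW) lie_suml.
apply: rpred_sum => i _; rewrite lie_sumr; apply: rpred_sum => j _.
rewrite lieZl lieZr !rpredZ // memv_span //.
by apply: allpairs_f; rewrite mem_nth ?size_tuple.
Qed.

Lemma lie_prod_sub (U W X : {vspace g}) :
  (forall x y, x \in U -> y \in W -> lie x y \in X) -> (lie_prod U W <= X)%VS.
Proof.
move=> h; apply/span_subvP=> _ /allpairsP[[x y] /= [xU yW ->]].
by apply: h; apply: vbasis_mem.
Qed.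

Lemma nilpotent_ad (t : {vspace g}) : nilpotent_sub t ->
  exists N, forall h k, h \in t -> k \in t -> iter N (lie h) k = 0.
Proof.
case=> N tN; exists N => h k ht kt; apply/eqP.
rewrite -memv0 -tN; elim: (N) => //= n IH; exact: mem_lie_prod.
Qed.

End LieBasics.

(** A commutator is traceless on every subspace stable under both factors. *)
Lemma trf_commf (K : fieldType) (V : vectType K) (f g p : 'End(V)) :
  (forall x, p (f (p x)) = f (p x)) -> (forall x, p (g (p x)) = g (p x)) ->
  trf (commf f g \o p)%VF = 0.
Proof.
move=> pf pg.
have -> : (commf f g \o p = (f \o (p \o (g \o p))) - (g \o (p \o (f \o p))))%VF.
  by apply/lfunP=> x; rewrite add_lfunE opp_lfunE !comp_lfunE commfE pf pg.
by rewrite trfD trfN !comp_lfunA -(comp_lfunA (f \o p)%VF) trf_comp comp_lfunA subrr.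
Qed.

Lemma iter_comp_idem (K : fieldType) (V : vectType K) (D p : 'End(V)) n x :
  idempotent_lfun p -> (forall x, D (p x) = p (D x)) ->
  iter n.+1 (D \o p)%VF x = iter n.+1 D (p x).
Proof.
move=> pp Dp; elim: n x => [|n IH] x; first by rewrite /= comp_lfunE.
by rewrite iterSr IH comp_lfunE -Dp pp [RHS]iterSr.
Qed.

Lemma iter_shift_eq0 (K : fieldType) (V : vectType K) (f : 'End(V)) a b m n x :
  a != b -> iter m (shift f a) x = 0 -> iter n (shift f b) x = 0 -> x = 0.
Proof.
move=> ab; have comm y : shift f a (shift f b y) = shift f b (shift f a y).
  rewrite !shiftE !lfB !lfZ !scalerBr !scalerA (mulrC b a) !opprB !addrA.
  by rewrite [LHS]addrAC [RHS]addrAC; congr (_ + _); rewrite addrAC.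
elim: m x => // m IH x; rewrite iterSr => /IH h fx.
have : shift f a x = 0.
  apply: h; rewrite (@iter_stable _ _ (shift f b) (shift f a)) ?fx ?lf0 //.
move/eqP; rewrite shiftE subr_eq0 => /eqP fxa.
have e k : iter k (shift f b) x = (a - b) ^+ k *: x.
  elim: k => [|k IHk]; first by rewrite scale1r.
  by rewrite iterS IHk lfZ shiftE fxa -scalerBl scalerA -exprSr.
move/eqP: fx; rewrite e scaler_eq0 expf_eq0 subr_eq0 (negPf ab) andbF /=.
by move/eqP.
Qed.

Section WeightDecomposition.
Variables (K : numClosedFieldType) (g : lieAlgType K) (t : {vspace g}).
Implicit Types (l m : dual t) (h : subvs_of t) (x y : g).

Record weight_decomposition (Lam : seq (dual t)) (pi : dual t -> 'End(g)) : Prop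
  := WeightDecomposition {
  wd_uniq : uniq Lam;
  wd_idem : forall l, idempotent_lfun (pi l);
  wd_orth : forall l m, l != m -> forall x, pi l (pi m x) = 0;
  wd_notin : forall l, l \notin Lam -> pi l = 0;
  wd_in : forall l, l \in Lam -> pi l != 0;
  wd_sum : forall x, \sum_(l <- Lam) pi l x = x;
  wd_comm : forall l h x, lie (vsval h) (pi l x) = pi l (lie (vsval h) x);
  wd_nil : forall l h, exists n, forall x,
    iter n (shift (ad (vsval h)) (l h)) (pi l x) = 0
}.

(** On a piece with a single weight, the weight is the trace divided by the
    dimension; hence it is a linear form, and pieces can be grouped by weight. *)
Lemma weight_decomposition_exists : nilpotent_sub t ->
  exists Lam pi, weight_decomposition Lam pi.
Proof.
move=> /nilpotent_ad[N tN]; pose T h := ad (vsval h).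
have T_nilp i j : exists N, iter N (commf (T i)) (T j) = 0.
  exists N; have -> : 0 = ad (0 : g) by apply/lfunP=> x; rewrite adE lie0l lfunE.
  rewrite -(tN _ _ (subvsP i) (subvsP j)).
  by elim: (N) => //= n ->; rewrite ad_lie.
have [||ps w] := weight_split T_nilp (p0 := \1%VF).
- by move=> x; rewrite !id_lfunE.
- by move=> i x; rewrite !id_lfunE.
pose wt p : dual t := linfun (fun h => trf (T h \o p)%VF / trf p : K^o).
have wtE p h : wt p h = trf (T h \o p)%VF / trf p.
  rewrite linfun_linear // => a x y; rewrite /T linearP adD adZ.
  by rewrite comp_lfunDl -comp_lfunZl trfD trfZ mulrDl -mulrA.
have tr0 p : p \in ps -> trf p != 0.
  move=> pp; rewrite (trf_idem (wp_idem w pp)) pnatr_eq0 dimv_eq0.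
  apply: contra (wp_neq0 w pp) => /eqP U0; apply/eqP/lfunP=> x.
  by apply/eqP; rewrite zero_lfunE -memv0 -U0 memv_img ?memvf.
have wtn p h : p \in ps -> exists n, forall x, iter n (shift (T h) (wt p h)) (p x) = 0.
  move=> pp; have [a [n an]] := wp_single w pp h.
  suff -> : wt p h = a by exists n.
  have : trf (shift (T h) a \o p)%VF = 0.
    apply: (@trf_nilp _ _ _ n.+1) => x.
    rewrite iter_comp_idem; first by rewrite iterS an lf0.
      exact: (wp_idem w pp).
    by move=> y; rewrite !shiftE lfB lfZ (wp_comm w pp).
  rewrite /shift comp_lfunDl trfD comp_lfunNl trfN -comp_lfunZl trfZ comp_lfun1l.
  by move/eqP; rewrite subr_eq0 wtE => /eqP ->; rewrite mulfK ?tr0.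
pose pi l := \sum_(p <- ps | wt p == l) p.
have piE l x : pi l x = \sum_(p <- ps | wt p == l) p x by rewrite sum_lfunE.
have ppi p x l : p \in ps -> p (pi l x) = if wt p == l then p x else 0.
  move=> pp; rewrite piE linear_sum /=.
  rewrite (big_rem p pp) /= big1_seq; last first.
    move=> q /andP[_]; rewrite mem_rem_uniq ?(wp_uniq w) // => /andP[/= qp qs].
    by apply: (wp_orth w pp qs); rewrite eq_sym.
  by case: eqP => _; rewrite ?addr0 ?(wp_idem w pp).
exists (undup (map wt ps)), pi; split.
- exact: undup_uniq.
- move=> l x; rewrite [LHS]piE [RHS]piE; rewrite big_seq_cond [RHS]big_seq_cond.
  by apply: eq_bigr => p /andP[pp /eqP e]; rewrite ppi // e eqxx.
- move=> l m lm x; rewrite piE big_seq_cond big1 // => p /andP[pp /eqP e].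
  by rewrite ppi // e (negPf lm).
- move=> l; rewrite mem_undup => ln; rewrite /pi big_seq_cond big1 // => p.
  by case/andP=> pp /eqP e; case/negP: ln; rewrite -e map_f.
- move=> l; rewrite mem_undup => /mapP[p pp ->]; apply: contraNneq (wp_neq0 w pp).
  move=> e; apply/eqP/lfunP=> x; have := ppi p x (wt p) pp.
  by rewrite e eqxx zero_lfunE lf0 => <-.
- move=> x; rewrite -[RHS](id_lfunE x) -(wp_sum w).
  under eq_bigr do rewrite piE.
  rewrite (exchange_big_dep xpredT) //=; rewrite big_seq [RHS]big_seq.
  apply: eq_bigr => p pp; rewrite big_mkcond (bigD1_seq (wt p)) /= ?undup_uniq //.
    by rewrite eqxx big1 ?addr0 // => l; rewrite eq_sym => /negPf ->.
  by rewrite mem_undup map_f.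
- move=> l h x; rewrite !piE lie_sumr big_seq_cond [RHS]big_seq_cond.
  apply: eq_bigr => p /andP[pp _]; have := wp_comm w pp h x.
  by rewrite /T !adE.
move=> l h.
suff [n nP] : exists n, forall p, p \in ps -> wt p = l ->
    forall x, iter n (shift (T h) (l h)) (p x) = 0.
  exists n => x; rewrite piE big_seq_cond.
  elim/big_rec: _ => [|p y /andP[pp /eqP e] IH]; first exact: iter_lfun0.
  by rewrite iter_lfunD IH nP // addr0.
elim: (ps) wtn => [|p s IH] wtn; first by exists 0%N.
have [p' h' pp'|n nP] := IH; first by apply: wtn; rewrite inE pp' orbT.
have [k kP] := wtn p h (mem_head _ _).
exists (maxn n k) => q /[!inE] /predU1P[->|qs] e x.
  by apply: (iter_eq0_leq (leq_maxr _ _)); rewrite -e.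
by apply: (iter_eq0_leq (leq_maxl _ _)); apply: nP.
Qed.

End WeightDecomposition.

(** * Weight spaces of a Cartan subalgebra *)

Section CartanWeights.
Variables (K : numClosedFieldType) (g : lieAlgType K) (t : {vspace g}).
Variables (Lam : seq (dual t)) (pi : dual t -> 'End(g)).
Hypothesis W : weight_decomposition Lam pi.
Implicit Types (l m a : dual t) (h : subvs_of t) (x y : g).

Definition in_wt l x : Prop := pi l x = x.

Lemma in_wt_pi l x : in_wt l (pi l x).
Proof. exact: (wd_idem W). Qed.

Lemma in_wtZ l c x : in_wt l x -> in_wt l (c *: x).
Proof. by rewrite /in_wt lfZ => ->. Qed.

Lemma in_wt_neq l m x : in_wt l x -> l != m -> pi m x = 0.
Proof. by move=> <-; rewrite eq_sym => /(wd_orth W) ->. Qed.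

Lemma in_wt_notin l x : l \notin Lam -> in_wt l x -> x = 0.
Proof. by move=> /(wd_notin W) e <-; rewrite e zero_lfunE. Qed.

Lemma in_wt_nil l h x : in_wt l x ->
  exists n, iter n (shift (ad (vsval h)) (l h)) x = 0.
Proof. by move=> <-; case: (wd_nil W l h) => n e; exists n; rewrite e. Qed.

(** Two distinct weights differ at some [h], where their generalised
    eigenspaces meet in zero. *)
Lemma in_wt_gen l x :
  (forall h, exists n, iter n (shift (ad (vsval h)) (l h)) x = 0) -> in_wt l x.
Proof.
move=> xn; rewrite /in_wt -[RHS](wd_sum W).
have z m : m != l -> pi m x = 0.
  move=> ml; have [h hP] : exists h, m h <> l h.
    by apply/existsNP => e; case/eqP: ml; apply/lfunP.
  have [n1 e1] := xn h; have [n2 e2] := in_wt_nil h (in_wt_pi m x).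
  apply: (iter_shift_eq0 (a := m h) (b := l h) _ e2 (n := n1)).
    exact/eqP.
  rewrite iter_comm_shift ?e1 ?lf0 // => y; rewrite !adE; exact: (wd_comm W).
have [lL|lL] := boolP (l \in Lam).
  rewrite (bigD1_seq l) ?(wd_uniq W) //= big1 ?addr0 //.
rewrite (wd_notin W lL) zero_lfunE big1_seq // => m /andP[_ mL].
by apply: z; apply: contraNneq lL => <-.
Qed.

Lemma in_wt_eig l x : (forall h, lie (vsval h) x = l h *: x) -> in_wt l x.
Proof.
by move=> xl; apply: in_wt_gen => h; exists 1%N; rewrite /= shiftE adE xl subrr.
Qed.

Lemma in_wt_stable l h x : in_wt l x -> in_wt l (lie (vsval h) x).
Proof. by rewrite /in_wt -(wd_comm W) => ->. Qed.

(** By the Leibniz rule [D - (a + b)] acts on [[u, v]] as [D - a] on [u] plus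
    [D - b] on [v]. *)
Lemma in_wt_lie l m x y : in_wt l x -> in_wt m y -> in_wt (l + m) (lie x y).
Proof.
move=> xl ym; apply: in_wt_gen => h.
have [n1 e1] := in_wt_nil h xl; have [n2 e2] := in_wt_nil h ym.
set Dx := shift _ _ in e1; set Dy := shift _ _ in e2.
have D u v : shift (ad (vsval h)) ((l + m) h) (lie u v) =
    lie (Dx u) v + lie u (Dy v).
  rewrite /Dx /Dy !shiftE !adE lie_der lieBl lieBr lieZl lieZr add_lfunE.
  by rewrite scalerDl opprD addrACA.
have key N : forall n1 n2 u v, (n1 + n2 <= N)%N ->
    iter n1 Dx u = 0 -> iter n2 Dy v = 0 ->
    iter N (shift (ad (vsval h)) ((l + m) h)) (lie u v) = 0.
  elim: N => [|N IH] [|k1] [|k2] u v //=; try by move=> _ ->; rewrite ?lie0l.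
  - by move=> _ -> _; rewrite lie0l -iterS iter_lfun0.
  - by move=> _ -> _; rewrite lie0l -iterS iter_lfun0.
  - by move=> _ _ ->; rewrite lie0r -iterS iter_lfun0.
  rewrite -!iterS => kN e e'; rewrite iterSr D iter_lfunD.
  rewrite (IH k1 k2.+1) -?iterSr // ?(IH k1.+1 k2) -?iterSr ?addr0 //; lia.
by exists (n1 + n2)%N; apply: key e1 e2.
Qed.

(** * Traces over weight spaces *)

Lemma trf_wd (f : 'End(g)) : trf f = \sum_(l <- Lam) trf (f \o pi l)%VF.
Proof.
rewrite -trf_sum; congr trf; apply/lfunP=> x; rewrite sum_lfunE.
rewrite -{1}(wd_sum W x) linear_sum; apply: eq_bigr => l _.
by rewrite comp_lfunE.
Qed.

Definition wdim l : nat := \dim (limg (pi l)).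

Lemma trf_pi l : trf (pi l) = (wdim l)%:R.
Proof. exact: trf_idem (wd_idem W l). Qed.

Lemma wdim_gt0 l : l \in Lam -> (0 < wdim l)%N.
Proof.
move=> lL; rewrite lt0n dimv_eq0; apply: contra (wd_in W lL) => /eqP U0.
apply/eqP/lfunP=> x; apply/eqP.
by rewrite zero_lfunE -memv0 -U0 memv_img ?memvf.
Qed.

Lemma shift_pi_nil l h : exists n, forall x,
  iter n (shift (ad (vsval h)) (l h) \o pi l)%VF x = 0.
Proof.
have [n nP] := wd_nil W l h; exists n.+1 => x.
rewrite iter_comp_idem; first by rewrite iterS nP lf0.
  exact: (wd_idem W).
by move=> y; rewrite !shiftE !adE lfB lfZ (wd_comm W).
Qed.

Lemma trf_ad_pi l h : trf (ad (vsval h) \o pi l)%VF = l h * trf (pi l).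
Proof.
have [n nP] := shift_pi_nil l h; have := trf_nilp nP.
rewrite /shift comp_lfunDl trfD comp_lfunNl trfN -comp_lfunZl trfZ comp_lfun1l.
by move/eqP; rewrite subr_eq0 => /eqP ->.
Qed.

Lemma trf_ad2_pi l h :
  trf (ad (vsval h) \o ad (vsval h) \o pi l)%VF = (l h) ^+ 2 * trf (pi l).
Proof.
have [n nP] := shift_pi_nil l h.
set f := (_ \o _)%VF in nP.
have : trf (f \o f)%VF = 0.
  apply: (@trf_nilp _ _ _ n) => x.
  have -> : iter n (f \o f)%VF x = iter n f (iter n f x).
    elim: (n) x => [|k IH] x //; rewrite iterSr IH comp_lfunE.
    rewrite -!iterD -!iterSr; congr (iter _ f x); lia.
  by rewrite nP.
have -> : (f \o f = (ad (vsval h) \o ad (vsval h) \o pi l)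
     - (l h *+ 2) *: (ad (vsval h) \o pi l) + (l h) ^+ 2 *: pi l)%VF.
  apply/lfunP=> x; rewrite !add_lfunE opp_lfunE !scale_lfunE /f !comp_lfunE.
  set z := pi l x; have pz : pi l z = z by apply: (wd_idem W).
  rewrite !shiftE !adE lfB lfZ -(wd_comm W) pz lieBr lieZr scalerBr scalerA opprB.
  rewrite expr2 mulr2n scalerDl opprD [RHS]addrAC !addrA.
  by congr (_ + _); rewrite addrAC.
rewrite !trfD trfN !trfZ trf_ad_pi => /eqP; rewrite -addrA addr_eq0 => /eqP ->.
by rewrite expr2 mulr2n; ring.
Qed.

Lemma killing_h h : killing (vsval h) (vsval h) = \sum_(l <- Lam) (l h) ^+ 2 * trf (pi l).
Proof.
by rewrite killing_tr trf_wd; apply: eq_bigr => l _; rewrite trf_ad2_pi.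
Qed.

(** Polarisation of [killing_h]: it spares a simultaneous triangularisation of
    [ad h] and [ad h']. *)
Lemma killing_hh h h' :
  killing (vsval h) (vsval h') = \sum_(l <- Lam) l h * l h' * trf (pi l).
Proof.
have : killing (vsval (h + h')) (vsval (h + h')) = \sum_(l <- Lam) (l (h + h')) ^+ 2 * trf (pi l).
  exact: killing_h.
rewrite linearD /= killingDl !killingDr (killingC (vsval h') (vsval h)) !killing_h.
under eq_bigr => l _ do rewrite lfD sqrrD !mulrDl.
rewrite !big_split /= => e.
set S := RHS; set k := killing _ _ in e *.
have : k *+ 2 = S *+ 2.
  apply: (addrI (\sum_(l <- Lam) l h ^+ 2 * trf (pi l))).
  apply: (addIr (\sum_(l <- Lam) l h' ^+ 2 * trf (pi l))).
  by rewrite [S *+ 2]mulr2n -e; ring.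
by move=> /eqP; rewrite -subr_eq0 -mulrnBl mulrn_eq0 /= subr_eq0 => /eqP.
Qed.

Lemma killing_orth l m x y : in_wt l x -> in_wt m y -> l + m != 0 ->
  killing x y = 0.
Proof.
move=> xl ym lm; rewrite killing_tr trf_wd big1 // => n _.
have -> : (ad x \o ad y \o pi n = ad x \o ad y \o pi n \o pi n)%VF.
  by apply/lfunP=> z; rewrite !comp_lfunE (wd_idem W).
rewrite trf_comp (_ : (_ \o _)%VF = 0) ?trf0 //.
apply/lfunP=> z; rewrite zero_lfunE !comp_lfunE !adE.
have zn := in_wt_pi n z.
apply: (in_wt_neq (in_wt_lie xl (in_wt_lie ym zn))).
by rewrite addrA -subr_eq0 addrK.
Qed.

Lemma sum_pi_id (s : seq (dual t)) m x : uniq s -> in_wt m x ->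
  m \in s \/ m \notin Lam -> \sum_(l <- s) pi l x = x.
Proof.
move=> us xm [ms|mL]; last first.
  by rewrite (in_wt_notin mL xm) big1 // => l _; rewrite lf0.
rewrite (bigD1_seq m) //= xm big1 ?addr0 // => l lm.
by apply: in_wt_neq xm _; rewrite eq_sym.
Qed.

(** The trace identity behind all string arguments: on a sum of weight spaces
    stable under [ad x] and [ad y], the operator [ad [x, y]] is a commutator. *)
Lemma string_trace a x y h (s : seq (dual t)) :
  in_wt a x -> in_wt (- a) y -> vsval h = lie x y -> uniq s ->
  (forall l, l \in s -> l + a \in s \/ l + a \notin Lam) ->
  (forall l, l \in s -> l - a \in s \/ l - a \notin Lam) ->
  \sum_(l <- s) l h * trf (pi l) = 0.
Proof.
move=> xa ya hE us sx sy.
pose p := \sum_(l <- s) pi l.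
have pE z : p z = \sum_(l <- s) pi l z by rewrite sum_lfunE.
have st b u : in_wt b u -> (forall l, l \in s -> l + b \in s \/ l + b \notin Lam) ->
    forall z, p (ad u (p z)) = ad u (p z).
  move=> ub sb z; rewrite [p z]pE adE lie_sumr pE.
  under eq_bigr => l _ do rewrite linear_sum.
  rewrite exchange_big [LHS]big_seq [RHS]big_seq; apply: eq_bigr => l ls /=.
  apply: (sum_pi_id (m := b + l)) => //; last by rewrite addrC; apply: sb.
  exact: in_wt_lie ub (in_wt_pi _ _).
have := trf_commf (st _ _ xa sx) (st _ _ ya sy).
rewrite -ad_lie -hE => tr0; rewrite -[RHS]tr0 (_ : (_ \o _)%VF = \sum_(l <- s) (ad (vsval h) \o pi l)%VF).
  by rewrite trf_sum; apply: eq_bigr => l _; rewrite trf_ad_pi.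
apply/lfunP=> z; rewrite comp_lfunE pE linear_sum sum_lfunE.
by apply: eq_bigr => l _; rewrite comp_lfunE.
Qed.

(** * A Cartan subalgebra is the weight space of weight zero *)

Hypothesis ht : cartan_subalgebra t.

Lemma t_in_wt0 x : x \in t -> in_wt 0 x.
Proof.
have [_ /nilpotent_ad[N tN] _] := ht => xt; apply: in_wt_gen => h; exists N.
rewrite zero_lfunE -[RHS](tN _ _ (subvsP h) xt).
by elim: (N) => //= n ->; rewrite shiftE adE scale0r subr0.
Qed.

(** Engel's theorem for the action of [t] on [X / t]. Let [t_k] be the last term
    of the lower central series that does not send [X] into [t], and [u] in [t_k]
    a witness of this; the vectors of [X] sent into [t] by [u] form a smaller
    [t]-stable space, still larger than [t] since [ad u] is nilpotent. *)
Lemma engel_normalizer n (X : {vspace g}) : (\dim X < n)%N -> (t <= X)%VS -> X != t ->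
  (forall (h : g) x, h \in t -> x \in X -> lie h x \in X) ->
  (forall x, x \in X -> in_wt 0 x) ->
  exists2 x, x \notin t & forall h : g, h \in t -> lie h x \in t.
Proof.
have [tt [N tN] _] := ht.
pose tk k := iter k (lie_prod t) t.
have tkS k (h : g) x : h \in t -> x \in tk k -> lie h x \in tk k.+1.
  by move=> h1 h2; apply: mem_lie_prod.
have tkt k : (tk k <= t)%VS.
  elim: k => [|k IH]; first exact: subvv.
  by apply: lie_prod_sub => x y xt /(subvP IH); apply: tt.
elim: n X => // n IH X dX tX Xt sX X0.
have [x xX xt] : exists2 x, x \in X & x \notin t.
  apply: contrapT => no; case/negP: Xt; rewrite eqEsubv tX andbT.
  by apply/subvP=> x xX; apply: contrapT => /negP xt; apply: no; exists x.
pose Q k := `[< forall (h : g) x, h \in tk k -> x \in X -> lie h x \in t >].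
have exQ : exists k, Q k.
  exists N; apply/asboolP=> h y; rewrite /tk tN memv0 => /eqP -> _.
  by rewrite lie0l mem0v.
case: (ex_minnP exQ) => -[|k] /asboolP kQ kmin.
  by exists x => // h h1; apply: kQ.
have [u uk [y yX uy]] : exists2 u, u \in tk k & exists2 y, y \in X & lie u y \notin t.
  apply: contrapT => no; suff /kmin : Q k by rewrite ltnn.
  apply/asboolP=> h z h1 zX; apply: contrapT => /negP no'.
  by apply: no; exists h => //; exists z.
have ut := subvP (tkt k) _ uk.
pose Y := (X :&: (ad u @^-1: t))%VS.
have YP z : (z \in Y) = (z \in X) && (lie u z \in t).
  by rewrite memv_cap -memv_preim adE.
apply: (IH Y).
- rewrite ltnS in dX; apply: leq_trans dX; rewrite ltn_neqAle.
  have s : (Y <= X)%VS by apply: capvSl.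
  rewrite dimvS // andbT; apply: contra uy => /eqP e.
  have /eqP eY : Y == X by rewrite eqEdim s e /=.
  by move: yX; rewrite -eY YP => /andP[].
- by apply/subvP=> z zt; rewrite YP (subvP tX) // tt.
- have [m mP] : exists m : nat, iter m (lie u) x \in t.
    have [m mP] := in_wt_nil (vsproj t u) (X0 _ xX); exists m.
    suff -> : iter m (lie u) x = 0 by rewrite mem0v.
    rewrite -mP; elim: (m) => //= j ->.
    by rewrite shiftE adE zero_lfunE scale0r subr0 vsprojK.
  elim: m x xX xt mP => [|m IHm] z zX zt; first by rewrite /= (negPf zt).
  rewrite iterSr; have [uz _|uz] := boolP (lie u z \in t).
    by apply: contra zt => /eqP <-; rewrite YP zX uz.
  by apply: IHm => //; apply: sX.
- move=> h z h1; rewrite !YP => /andP[zX uz]; rewrite sX //=.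
  rewrite lie_der rpredD //; last exact: tt.
  by apply: kQ => //; rewrite lieC rpredN; apply: tkS.
- by move=> z; rewrite YP => /andP[zX _]; apply: X0.
Qed.

Lemma in_wt0_t x : in_wt 0 x -> x \in t.
Proof.
have [_ _ tn] := ht.
have G0P z : (z \in limg (pi 0%R)) = (pi 0 z == z) by apply: limg_idemP (wd_idem W 0).
have s : (t <= limg (pi 0%R))%VS.
  by apply/subvP=> z /t_in_wt0; rewrite G0P => ->.
have [e|ne] := eqVneq (limg (pi 0%R)) t; first by rewrite /in_wt => x0; rewrite -[_ \in t](congr1 (fun V : {vspace g} => x \in V) e) G0P x0.
have [||z zt zn] := engel_normalizer (ltnSn _) s ne.
- move=> h z h1; rewrite !G0P => /eqP zw.
  have := in_wt_stable (vsproj t h) zw; rewrite vsprojK // => /eqP //.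
- by move=> z; rewrite G0P => /eqP.
case/negP: zt; apply: tn => h h1; rewrite lieC rpredN; exact: zn.
Qed.

End CartanWeights.

(** * Nondegeneracy of the Killing form *)

Section KillingNondegenerate.
Variables (K : numClosedFieldType) (g : lieAlgType K) (t : {vspace g}).
Variables (Lam : seq (dual t)) (pi : dual t -> 'End(g)).
Hypothesis W : weight_decomposition Lam pi.
Hypothesis ht : cartan_subalgebra t.
Hypothesis hg : simple_lie g.
Implicit Types (l m a : dual t) (h : subvs_of t) (x y : g).

Local Notation inw := (in_wt pi).

(** Averaging [l + k a] over the [a]-string of [l] against the trace identity
    expresses [l] on [[g_a, g_-a]] as a rational multiple of [a]. *)
Lemma weight_ratio a x y h l : inw a x -> inw (- a) y ->
  vsval h = lie x y -> l \in Lam ->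
  exists2 r, r \is Num.real & l h = r * a h.
Proof.
move=> xa ya hE lL.
pose s := [seq m <- Lam | `[< exists k : int, m = l + a *~ k >]].
have sP m : m \in s -> exists k : int, m = l + a *~ k.
  by rewrite mem_filter => /andP[/asboolP].
have sI m (k : int) : m = l + a *~ k -> m \in s \/ m \notin Lam.
  move=> e; have [mL|] := boolP (m \in Lam); last by right.
  by left; rewrite mem_filter mL andbT; apply/asboolP; exists k.
have us : uniq s by rewrite filter_uniq ?(wd_uniq W).
have [k kP] : exists k : dual t -> int, forall m, m \in s -> m = l + a *~ k m.
  have /choice[k kP] : forall m, exists z : int, m \in s -> m = l + a *~ z.
    move=> m; have [/sP[z e]|_] := boolP (m \in s); last by exists 0.
    by exists z.
  by exists k.
have tr := string_trace W xa ya hE us _ _.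
have {tr} := tr _ _.
have h1 m : m \in s -> m + a \in s \/ m + a \notin Lam.
  by case/sP=> z ->; apply: (sI _ (z + 1)); rewrite mulrzDr addrA.
have h2 m : m \in s -> m - a \in s \/ m - a \notin Lam.
  by case/sP=> z ->; apply: (sI _ (z - 1)); rewrite mulrzBr addrA.
move/(_ h1 h2).
pose D := \sum_(m <- s) trf (pi m).
pose E := \sum_(m <- s) (k m)%:~R * trf (pi m).
have -> : \sum_(m <- s) m h * trf (pi m) = l h * D + a h * E.
  rewrite /D /E !mulr_sumr -big_split /= big_seq [RHS]big_seq.
  apply: eq_bigr => m ms; rewrite {1}(kP m ms) add_lfunE.
  have -> : (a *~ k m) h = a h * (k m)%:~R.
    by rewrite -scaler_int scale_lfunE /= mulrC.
  by rewrite mulrDl mulrA.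
have ls : l \in s by rewrite mem_filter lL andbT; apply/asboolP; exists 0; rewrite mulr0z addr0.
have D0 : D != 0.
  rewrite /D (eq_bigr (fun m => (wdim pi m)%:R)); last by move=> m _; rewrite (trf_pi W).
  rewrite -natr_sum pnatr_eq0 (big_rem l ls) /= -lt0n addn_gt0.
  by rewrite (wdim_gt0 W lL).
move/eqP; rewrite addr_eq0 => /eqP e; exists (- E / D).
  rewrite rpred_div ?rpredN //; apply: rpred_sum => m _.
    by rewrite (trf_pi W) rpredM // ?realz ?realn.
  by rewrite (trf_pi W) realn.
by apply: (mulIf D0); rewrite e mulrAC mulfVK // mulNr mulrC.
Qed.

Lemma simple_derived : lie_prod (fullv : {vspace g}) fullv = fullv.
Proof.
have [[x [y xy]] hs] := hg.
case: (hs (lie_prod fullv fullv)) => // [u v _|e].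
  by apply: mem_lie_prod; apply: memvf.
by case/negP: xy; rewrite -memv0 -e mem_lie_prod ?memvf.
Qed.

(** Cartan's criterion: were the Killing form zero, all weights would vanish
    on [t], whence [g = t] would be nilpotent. *)
Lemma killing_neq0 : exists x y, killing x y != 0.
Proof.
apply: contrapT => no.
have k0 x y : killing x y = 0.
  by apply/eqP; apply: contrapT => /negP ne; apply: no; exists x, y.
have cA a x y h l : inw a x -> inw (- a) y -> vsval h = lie x y ->
    l \in Lam -> l h = 0.
  move=> xa ya hE lL.
  suff ah0 : a h = 0.
    by have [r _ ->] := weight_ratio xa ya hE lL; rewrite ah0 mulr0.
  have [aL|aL] := boolP (a \in Lam); last first.
    have h0 : h = 0 by apply: val_inj; rewrite /= hE (in_wt_notin W aL xa) lie0l.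
    by rewrite h0 lf0.
  apply/eqP; apply: contrapT => /negP ah.
  have := killing_h W h; rewrite k0 => /esym/eqP.
  have -> : \sum_(m <- Lam) m h ^+ 2 * trf (pi m) =
      a h ^+ 2 * \sum_(m <- Lam) (m h / a h) ^+ 2 * trf (pi m).
    rewrite mulr_sumr; apply: eq_bigr => m _.
    by rewrite mulrA -exprMn mulrCA divff // mulr1.
  rewrite mulf_eq0 expf_eq0 (negPf ah) andbF /= big_seq psumr_eq0; last first.
    move=> m mL; rewrite (trf_pi W) mulr_ge0 ?ler0n //.
    have [r rr ->] := weight_ratio xa ya hE mL.
    by rewrite mulfK // real_exprn_even_ge0.
  move/allP/(_ _ aL)/implyP/(_ aL); rewrite divff // expr1n mul1r (trf_pi W) pnatr_eq0.
  by rewrite eqn0Ngt (wdim_gt0 W aL).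
have L0 l h : l \in Lam -> l h = 0.
  move=> lL.
  pose phi x := l (vsproj t (pi 0 x)).
  have phiD x y : phi (x + y) = phi x + phi y by rewrite /phi lfD linearD lfD.
  have phi0 : phi 0 = 0 by rewrite /phi lf0 linear0 lf0.
  have phiS I r (F : I -> g) : phi (\sum_(i <- r) F i) = \sum_(i <- r) phi (F i).
    exact: (big_morph _ phiD phi0).
  have phiZ c x : phi (c *: x) = c * phi x by rewrite /phi lfZ linearZ lfZ.
  have phiL u v : phi (lie u v) = 0.
    rewrite -(wd_sum W u) -(wd_sum W v) lie_suml phiS big1 // => a _.
    rewrite lie_sumr phiS big1 // => b _.
    have w := in_wt_lie W (in_wt_pi W a u) (in_wt_pi W b v).
    have [ab|ab] := eqVneq (a + b) 0; last first.
      by rewrite /phi (in_wt_neq W w ab) linear0 lf0.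
    have bE : b = - a by apply/eqP; rewrite -addr_eq0 addrC ab.
    rewrite /phi; rewrite ab in w; rewrite w.
    apply: (@cA a (pi a u) (pi b v)) => //.
    - exact: (in_wt_pi W).
    - by rewrite -bE; apply: (in_wt_pi W).
    by rewrite vsprojK //; apply: (in_wt0_t W ht).
  have phiE x : (linfun (phi : g -> K^o)) x = phi x.
    by rewrite linfun_linear // => c u v; rewrite phiD phiZ.
  have : (lie_prod (fullv : {vspace g}) fullv <= lker (linfun (phi : g -> K^o)))%VS.
    by apply: lie_prod_sub => u v _ _; rewrite memv_ker phiE phiL.
  rewrite simple_derived => /subvP/(_ _ (memvf (vsval h))).
  rewrite memv_ker phiE => /eqP.
  by rewrite /phi (t_in_wt0 W ht (subvsP h)) vsvalK.
have [[x [y xy]] hs] := hg.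
have tf : t = fullv.
  apply/eqP; rewrite eqEsubv subvf; apply/subvP=> z _.
  apply: (in_wt0_t W ht); rewrite -(wd_sum W z).
  rewrite /in_wt linear_sum big_seq [RHS]big_seq; apply: eq_bigr => l lL.
  have -> : l = 0 by apply/lfunP=> h; rewrite zero_lfunE L0.
  exact: (wd_idem W).
have [_ [N tN] _] := ht.
have : iter N (lie_prod fullv) fullv = (fullv : {vspace g}).
  by elim: (N) => //= n ->; exact: simple_derived.
rewrite -tf tN => t0; have := memvf x; rewrite -tf -t0 memv0 => /eqP x0.
by case/negP: xy; rewrite x0 lie0l.
Qed.

Lemma killing_nondeg x : (forall y, killing x y = 0) -> x = 0.
Proof.
pose kl x : 'Hom(g, K^o) := linfun (fun y => killing x y : K^o).
have klE u v : kl u v = killing u v.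
  by rewrite linfun_linear // => c w z; rewrite killingDr killingZr.
pose k : 'Hom(g, 'Hom(g, K^o)) := linfun kl.
have kE u v : k u v = killing u v.
  rewrite /k linfun_linear ?klE // => c w z; apply/lfunP=> s.
  by rewrite add_lfunE scale_lfunE !klE killingDl killingZl.
have UP u : reflect (forall v, killing u v = 0) (u \in lker k).
  rewrite memv_ker; apply: (iffP eqP) => [e v|e]; first by rewrite -kE e zero_lfunE.
  by apply/lfunP=> v; rewrite zero_lfunE kE.
have [_ hs] := hg.
case: (hs (lker k)) => [u v /UP v0|e|e].
- by apply/UP=> w; rewrite lieC -scaleN1r killingZl killing_inv v0 mulr0.
- by move/UP; rewrite e memv0 => /eqP.
have [u [v /negP[]]] := killing_neq0.
by have /UP -> : u \in lker k by rewrite e memvf.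
Qed.

End KillingNondegenerate.

(** * Root spaces *)

Section RootSpaces.
Variables (K : numClosedFieldType) (g : lieAlgType K) (t : {vspace g}).
Variables (Lam : seq (dual t)) (pi : dual t -> 'End(g)).
Hypothesis W : weight_decomposition Lam pi.
Hypothesis ht : cartan_subalgebra t.
Hypothesis hg : simple_lie g.
Implicit Types (l m a b : dual t) (h : subvs_of t) (x y : g).

Local Notation inw := (in_wt pi).

Lemma killing_t_nondeg h :
  (forall h', killing (vsval h) (vsval h') = 0) -> h = 0.
Proof.
move=> h0; apply: val_inj; apply: (killing_nondeg W ht hg) => x.
have hw := t_in_wt0 W ht (subvsP h).
rewrite -(wd_sum W x) killing_sumr big1 // => l _.
have [->|l0] := eqVneq l 0; last first.
  by apply: (killing_orth W hw (in_wt_pi W l x)); rewrite add0r.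
have p0 := in_wt0_t W ht (in_wt_pi W 0 x).
by rewrite -(vsprojK p0) h0.
Qed.

(** The trace identity on one weight space shows that all weights vanish on
    [[t, t]], which is therefore orthogonal to [t]. *)
Lemma t_abelian h h' : lie (vsval h) (vsval h') = 0.
Proof.
have [tt _ _] := ht.
pose k := vsproj t (lie (vsval h) (vsval h')).
have kE : vsval k = lie (vsval h) (vsval h') by rewrite vsprojK // tt // subvsP.
suff : k = 0 by rewrite -kE => ->.
apply: killing_t_nondeg => h2; rewrite (killing_hh W) big_seq big1 // => l lL.
suff -> : l k = 0 by rewrite !mul0r.
have hw (u : subvs_of t) : inw 0 (vsval u) by apply: (t_in_wt0 W ht (subvsP u)).
have hw' (u : subvs_of t) : inw (- 0) (vsval u) by rewrite oppr0.
have := string_trace W (hw h) (hw' h') kE (s := [:: l]) isT.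
rewrite big_seq1 => /(_ _ _)/eqP; rewrite mulf_eq0 (trf_pi W) pnatr_eq0.
rewrite [_ == 0%N]eqn0Ngt (wdim_gt0 W lL) orbF => e; apply/eqP/e.
  by move=> m; rewrite addr0; left.
by move=> m; rewrite subr0; left.
Qed.

(** The element of [t] representing the linear form [l]. *)
Definition tdual l : subvs_of t := ((killing_map t)^-1)%VF l.

Lemma killing_mapE h h' : killing_map t h h' = killing (vsval h) (vsval h').
Proof.
have kdE (u v : subvs_of t) : killing_dual u v = killing (vsval u) (vsval v) :> K.
  by rewrite linfun_linear // => c x y; rewrite linearP killingDr killingZr.
rewrite /killing_map linfun_linear ?kdE // => c x y; apply/lfunP=> z.
by rewrite add_lfunE scale_lfunE !kdE linearP killingDl killingZl.
Qed.

Lemma killing_mapK l : killing_map t (tdual l) = l.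
Proof.
apply: limg_lfunVK; suff -> : limg (killing_map t) = fullv by apply: memvf.
apply/eqP; rewrite eqEdim subvf /= limg_dim_eq.
  by rewrite !dimvf /dim /= /dim /= muln1.
apply/eqP; rewrite -subv0; apply/subvP=> h; rewrite memv_cap memv_ker memv0.
case/andP=> _ /eqP h0; apply/eqP/killing_t_nondeg => h'.
by rewrite -killing_mapE h0 zero_lfunE.
Qed.

Lemma killing_tdual l h : killing (vsval (tdual l)) (vsval h) = l h.
Proof. by rewrite -killing_mapE killing_mapK. Qed.

Lemma kformE l m : kform l m = l (tdual m).
Proof. by rewrite -killing_tdual. Qed.

Lemma kformC l m : kform l m = kform m l.
Proof. by rewrite /kform killingC. Qed.

Lemma kformDl l m n : kform (l + m) n = kform l n + kform m n.
Proof. by rewrite !kformE add_lfunE. Qed.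

Lemma tdual_inj l : tdual l = 0 -> l = 0.
Proof. by rewrite -{2}(killing_mapK l) => ->; rewrite lf0. Qed.

Lemma kform_sum l m :
  kform l m = \sum_(b <- Lam) kform l b * kform m b * trf (pi b).
Proof.
rewrite -[LHS]/(killing (vsval (tdual l)) (vsval (tdual m))) (killing_hh W).
by apply: eq_bigr => b _; rewrite !(kformC _ b) !kformE.
Qed.

(** * Root spaces are lines *)

Lemma joint_eigenvector n (X : {vspace g}) : (\dim X < n)%N -> X != 0%VS ->
  (forall h x, x \in X -> lie (vsval h) x \in X) ->
  exists2 x, x != 0 & x \in X /\ forall h, exists c, lie (vsval h) x = c *: x.
Proof.
elim: n X => // n IH X dX X0 sX.
have [sc|] := pselect (forall h, exists c, forall x, x \in X -> lie (vsval h) x = c *: x).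
  exists (vpick X); first by rewrite vpick0.
  split; first exact: memv_pick.
  by move=> h; have [c cP] := sc h; exists c; rewrite cP // memv_pick.
move/existsNP=> [h hn].
have [x xX|c [x [xX x0 xc]]] := @eigenvector_exists _ _ (ad (vsval h)) _ X0.
  by rewrite adE sX.
pose Y := (X :&: lker (shift (ad (vsval h)) c))%VS.
have YP z : (z \in Y) = (z \in X) && (lie (vsval h) z == c *: z).
  by rewrite memv_cap memv_ker shiftE adE subr_eq0.
have [|||y y0 [yY yc]] := IH Y.
- rewrite ltnS in dX; apply: leq_trans dX; rewrite ltn_neqAle.
  have s : (Y <= X)%VS by apply: capvSl.
  rewrite dimvS // andbT; apply/negP => /eqP e; apply: hn.
  have /eqP eY : Y == X by rewrite eqEdim s e /=.
  by exists c => z; rewrite -eY YP => /andP[_ /eqP].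
- apply: contraNneq x0 => Y0; rewrite -memv0 -Y0 YP xX -adE xc eqxx //.
- move=> k z; rewrite !YP => /andP[zX /eqP zc]; rewrite sX //=.
  by rewrite lie_der t_abelian lie0l add0r zc lieZr.
by exists y => //; split=> //; move: yY; rewrite YP => /andP[].
Qed.

Lemma root_eigenvector l : l \in Lam ->
  exists2 x, x != 0 & forall h, lie (vsval h) x = l h *: x.
Proof.
move=> lL.
have GP z : (z \in limg (pi l)) = (pi l z == z) by apply: limg_idemP (wd_idem W l).
have [||x x0 [xX xc]] := joint_eigenvector (ltnSn (\dim (limg (pi l)))).
- by rewrite -dimv_eq0 -lt0n (wdim_gt0 W lL).
- by move=> h z; rewrite !GP => /eqP zl; apply/eqP/(in_wt_stable W).
exists x => // h; have [c hc] := xc h; rewrite hc; congr (_ *: _).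
apply/eqP; apply: contrapT => /negP ne; case/negP: x0.
rewrite GP in xX; have [n en] := in_wt_nil W h (eqP xX).
apply/eqP; apply: (iter_shift_eq0 ne (m := 1) _ en).
by rewrite /= shiftE adE hc subrr.
Qed.

(** The weight spaces of [l] and [m] are orthogonal unless [l + m = 0], so the
    one of [- l] must pair with that of [l]. *)
Lemma killing_partner l x : inw l x -> x != 0 ->
  exists2 y, inw (- l) y & killing x y = 1.
Proof.
move=> xl x0.
have [y xy] : exists y, killing x y != 0.
  apply: contrapT => no; case/negP: x0; apply/eqP.
  apply: (killing_nondeg W ht hg) => y; apply/eqP; apply: contrapT => /negP ne.
  by apply: no; exists y.
have e : killing x y = killing x (pi (- l) y).
  rewrite -{1}(wd_sum W y) killing_sumr.
  have z m : m != - l -> killing x (pi m y) = 0.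
    move=> ml; apply: (killing_orth W xl (in_wt_pi W m y)).
    by rewrite addrC addr_eq0.
  have [lL|lL] := boolP (- l \in Lam).
    by rewrite (bigD1_seq (- l)) ?(wd_uniq W) //= big1 ?addr0.
  rewrite (wd_notin W lL) zero_lfunE killing0r big1_seq // => m /andP[_ mL].
  by apply: z; apply: contraNneq lL => <-.
exists ((killing x y)^-1 *: pi (- l) y); first exact: in_wtZ (in_wt_pi W _ _).
by rewrite killingZr -e mulVf.
Qed.

Lemma root_opp l : l \in Lam -> - l \in Lam.
Proof.
move=> lL; have [x x0 xl] := root_eigenvector lL.
have [y yl xy] := killing_partner (in_wt_eig W xl) x0.
apply: contrapT => /negP nL; have := in_wt_notin W nL yl => y0.
by move/eqP: xy; rewrite y0 killing0r eq_sym oner_eq0.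
Qed.

Lemma lie_partner l x y : inw l x -> (forall h, lie (vsval h) y = - l h *: y) ->
  lie x y = killing x y *: vsval (tdual l).
Proof.
move=> xl yl.
have yw : inw (- l) y by apply: (in_wt_eig W) => h; rewrite yl opp_lfunE.
have xyt : lie x y \in t.
  by apply: (in_wt0_t W ht); rewrite -(subrr l); apply: (in_wt_lie W).
suff : vsproj t (lie x y) - killing x y *: tdual l = 0.
  by move/eqP; rewrite subr_eq0 => /eqP e; rewrite -(vsprojK xyt) e linearZ.
apply: killing_t_nondeg => h; rewrite linearB /= linearZ /= vsprojK //.
rewrite killingDl -scaleN1r !killingZl killing_tdual killing_inv.
by rewrite lieC yl scaleNr opprK killingZr; ring.
Qed.

(** Otherwise every weight, being a multiple of [l] there, would vanish at the
    element of [t] dual to [l]. *)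
Lemma tdual_root_neq0 l : l \in Lam -> l != 0 -> l (tdual l) != 0.
Proof.
move=> lL l0; have nL := root_opp lL.
have [y y0 yl] := root_eigenvector nL.
have yw := in_wt_eig W yl.
have [x xl xy] := killing_partner yw y0; rewrite opprK in xl.
have e : lie x y = vsval (tdual l).
  rewrite (lie_partner xl) => [|h]; first by rewrite killingC xy scale1r.
  by rewrite yl opp_lfunE.
apply: contraNneq l0 => l0; apply/eqP/tdual_inj/killing_t_nondeg => h.
rewrite killing_tdual -(killing_mapK l) killing_mapE (killing_hh W) big_seq big1 // => m mL.
by have [r _ ->] := weight_ratio W xl yw (esym e) mL; rewrite l0 mulr0 !mul0r.
Qed.

(** Let [f] be an eigenvector of weight [- a] and [e] of weight [a] with
    [(e, f) = 1], so that [[e, f] = t_a]. The space spanned by [f], [t_a] and all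
    [g_{ka}] with [k >= 1] is stable under [e] and [f]; as [t_a] is traceless on
    it, [- 1 + \sum_k k dim g_{ka} = 0]. *)
Lemma root_space_dim a : a \in Lam -> a != 0 ->
  wdim pi a = 1%N /\ forall k : nat, a *+ k.+1 \in Lam -> k = 0%N.
Proof.
move=> aL a0; have nL := root_opp aL; have c0 := tdual_root_neq0 aL a0.
have [f f0 fl] := root_eigenvector nL.
have fl' h : lie (vsval h) f = - a h *: f by rewrite fl opp_lfunE.
have fw := in_wt_eig W fl.
have [e ew fe] := killing_partner fw f0; rewrite opprK in ew.
set ha := tdual a in c0; pose c := a ha.
have ef x : inw a x -> lie x f = killing x f *: vsval ha.
  by move=> xa; apply: (lie_partner xa).
have hw : inw 0 (vsval ha) := t_in_wt0 W ht (subvsP ha).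
pose s := [seq m <- Lam | `[< exists k, m = a *+ k.+1 >]].
have us : uniq s by rewrite filter_uniq ?(wd_uniq W).
have sP m : m \in s -> exists k, m = a *+ k.+1.
  by rewrite mem_filter => /andP[/asboolP].
have sI m (k : nat) : m = a *+ k.+1 -> m \in s \/ m \notin Lam.
  move=> E; have [mL|] := boolP (m \in Lam); last by right.
  by left; rewrite mem_filter mL andbT; apply/asboolP; exists k.
have ak_neq (k : nat) : a *+ k.+1 != 0.
  by rewrite -scaler_nat scaler_eq0 pnatr_eq0 (negPf a0).
(* [phi1] and [phi2] are the coordinates along [f] and [t_a] *)
pose phi1 z := killing e z; pose phi2 z := killing (vsval ha) z / c.
have ph1 : scalar phi1 by move=> d u v; rewrite /phi1 killingDr killingZr.
have ph2 : scalar phi2.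
  by move=> d u v; rewrite /phi2 killingDr killingZr mulrDl mulrA.
pose p1 : 'End(g) := linfun (fun z => phi1 z *: f).
pose p2 : 'End(g) := linfun (fun z => phi2 z *: vsval ha).
have p1E z : p1 z = phi1 z *: f.
  by rewrite linfun_linear // => d u v; rewrite ph1 scalerDl scalerA.
have p2E z : p2 z = phi2 z *: vsval ha.
  by rewrite linfun_linear // => d u v; rewrite ph2 scalerDl scalerA.
pose p := p1 + p2 + \sum_(m <- s) pi m.
have pE z : p z = phi1 z *: f + phi2 z *: vsval ha + \sum_(m <- s) pi m z.
  by rewrite /p !add_lfunE sum_lfunE p1E p2E.
have pik m (x : g) : inw m x -> m \notin s -> \sum_(n <- s) pi n x = 0.
  move=> xm ms; rewrite big1_seq // => n /andP[_ ns].
  by apply: (in_wt_neq W xm); apply: contraNneq ms => ->.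
have pf : p f = f.
  rewrite pE (pik _ _ fw); last first.
    apply/negP=> /sP[k ek]; have := ak_neq k.+1.
    by rewrite mulrS -ek subrr eqxx.
  rewrite /phi1 /phi2 killingC fe scale1r.
  by rewrite (killing_orth W hw fw) ?add0r ?oppr_eq0 // mul0r scale0r !addr0.
have ph : p (vsval ha) = vsval ha.
  rewrite pE (pik _ _ hw); last first.
    by apply/negP=> /sP[k ek]; have := ak_neq k; rewrite -ek eqxx.
  rewrite /phi1 /phi2 killing_tdual divff // scale1r addr0.
  by rewrite (killing_orth W ew hw) ?addr0 // scale0r add0r.
have pk k x : inw (a *+ k.+1) x -> p x = x.
  move=> xk; rewrite pE (sum_pi_id W us xk (sI _ k erefl)) /phi1 /phi2.
  rewrite (killing_orth W ew xk); last by rewrite -mulrS ak_neq.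
  rewrite (killing_orth W hw xk); last by rewrite add0r ak_neq.
  by rewrite mul0r !scale0r !add0r.
have pad u : (p (lie u f) = lie u f) -> (p (lie u (vsval ha)) = lie u (vsval ha)) ->
    (forall k x, inw (a *+ k.+1) x -> p (lie u x) = lie u x) ->
    forall z, p (ad u (p z)) = ad u (p z).
  move=> uf uh uk z; rewrite [p z]pE adE !lieDr lie_sumr !lieZr !lfD !lfZ uf uh.
  congr (_ + _); rewrite linear_sum; apply: eq_big_seq => m /sP[k ek].
  by apply: (uk k); rewrite -ek; apply: (in_wt_pi W).
have pe : forall z, p (ad e (p z)) = ad e (p z).
  apply: pad.
  - by rewrite ef // lfZ ph.
  - by apply: (pk 0%N); rewrite -[a *+ 1]addr0; apply: (in_wt_lie W).
  - by move=> k x xk; apply: (pk k.+1); rewrite mulrS; apply: (in_wt_lie W).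
have pff : forall z, p (ad f (p z)) = ad f (p z).
  apply: pad.
  - by rewrite lie_alt lf0.
  - by rewrite lieC fl' scaleNr opprK lfZ pf.
  - case=> [|k] x xk.
      by rewrite lieC (ef x) // lfN lfZ ph.
    by apply: (pk k); rewrite -[a *+ k.+1](addKr a) -mulrS; apply: (in_wt_lie W).
have := trf_commf pe pff.
have hE : vsval ha = lie e f by rewrite ef // killingC fe scale1r.
rewrite -ad_lie -hE /p !comp_lfunDr !trfD.
have -> : trf (ad (vsval ha) \o p1)%VF = - c.
  rewrite (@trf_rank1 _ _ _ phi1 (- c *: f)) //.
    by rewrite /phi1 killingZr killingC fe mulr1.
  by move=> z; rewrite comp_lfunE p1E adE lieZr fl' .
have -> : trf (ad (vsval ha) \o p2)%VF = 0.
  rewrite (_ : (_ \o _)%VF = 0) ?trf0 //; apply/lfunP=> z.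
  by rewrite comp_lfunE p2E adE lieZr lie_alt scaler0 zero_lfunE.
have -> : (ad (vsval ha) \o \sum_(m <- s) pi m = \sum_(m <- s) (ad (vsval ha) \o pi m))%VF.
  apply/lfunP=> z; rewrite comp_lfunE !sum_lfunE linear_sum.
  by apply: eq_bigr => m _; rewrite comp_lfunE.
rewrite trf_sum.
have [k kP] : exists k : dual t -> nat, forall m, m \in s -> m = a *+ (k m).+1.
  have /choice[k kP] : forall m, exists z : nat, m \in s -> m = a *+ z.+1.
    move=> m; have [/sP[z ek]|_] := boolP (m \in s); last by exists 0%N.
    by exists z.
  by exists k.
have -> : \sum_(m <- s) trf (ad (vsval ha) \o pi m)%VF =
    c * (\sum_(m <- s) (k m).+1 * wdim pi m)%:R.
  rewrite natr_sum mulr_sumr; apply: eq_big_seq => m ms.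
  rewrite (trf_ad_pi W) (trf_pi W) {1}(kP m ms) -scaler_nat scale_lfunE /=.
  by rewrite natrM mulrA [in RHS](mulrC c).
rewrite addr0 -mulrN1 -mulrDr => /eqP; rewrite mulf_eq0 (negPf c0) /=.
rewrite addrC subr_eq0 -[1]/(1%:R) eqr_nat => /eqP S1.
have as_ : a \in s.
  by rewrite mem_filter aL andbT; apply/asboolP; exists 0%N.
have ka : k a = 0%N.
  have /eqP := kP a as_; rewrite mulrS -{1}[a]addr0 (inj_eq (addrI a)) eq_sym.
  by case: (k a) => // n; rewrite (negPf (ak_neq n)).
move: S1; rewrite (big_rem a as_) /= ka mul1n.
have := wdim_gt0 W aL; case: (wdim pi a) => [//|[|//]] _ [].
rewrite add0n => S0; split=> // j jL.
have js : a *+ j.+1 \in s by rewrite mem_filter jL andbT; apply/asboolP; exists j.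
apply/eqP; rewrite eqn0Ngt; apply/negP => j0.
have jr : a *+ j.+1 \in rem a s.
  rewrite mem_rem_uniq // inE js andbT mulrS -subr_eq0 addrAC subrr add0r.
  by case: (j) j0 => // i _; apply: ak_neq.
move/eqP: S0; rewrite (big_rem _ jr) /= addn_eq0 muln_eq0 /= eqn0Ngt.
by rewrite (wdim_gt0 W jL).
Qed.

End RootSpaces.

(** * Root strings and the form on the roots *)

Section RootStrings.
Variables (K : numClosedFieldType) (g : lieAlgType K) (t : {vspace g}).
Variables (Lam : seq (dual t)) (pi : dual t -> 'End(g)).
Hypothesis W : weight_decomposition Lam pi.
Hypothesis ht : cartan_subalgebra t.
Hypothesis hg : simple_lie g.
Implicit Types (l m a b : dual t) (h : subvs_of t) (x y : g).

Local Notation inw := (in_wt pi).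

Lemma in_wt_root_space l x : l \in Lam -> in_root_space l x <-> inw l x.
Proof.
move=> lL; split=> [xl|xl h]; first exact: (in_wt_eig W).
have [l0|l0] := eqVneq l 0.
  rewrite l0 zero_lfunE scale0r; rewrite l0 in xl.
  by rewrite -(vsprojK (in_wt0_t W ht xl)) (t_abelian W ht hg).
have [y y0 yl] := root_eigenvector W ht hg lL.
have [d1 _] := root_space_dim W ht hg lL l0.
have G z : inw l z -> z \in limg (pi l) by move=> <-; rewrite memv_img ?memvf.
have yw := in_wt_eig W yl.
have /eqP e : <[y]>%VS == limg (pi l).
  rewrite eqEdim -memvE G //= dim_vline y0; apply: eq_leq; exact: d1.
have := G _ xl; rewrite -e => /vlineP[c ->].
by rewrite lieZr yl !scalerA mulrC.
Qed.

Lemma lie_rootsE l : lie_roots t l <-> (l != 0) && (l \in Lam).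
Proof.
split=> [[l0 [x x0 xl]]|/andP[l0 lL]].
  rewrite l0; apply: contrapT => /negP lL; case/negP: x0; apply/eqP.
  exact: (in_wt_notin W lL (in_wt_eig W xl)).
split=> //; have [x x0 xl] := root_eigenvector W ht hg lL.
by exists x.
Qed.

Definition coroot a : subvs_of t := (2%:R / a (tdual a)) *: tdual a.

Lemma corootE a b : b (coroot a) = 2%:R * kform b a / kform a a.
Proof.
rewrite /coroot lfZ !(kformE W ht hg) /=.
by rewrite -[LHS]/(2 / a (tdual a) * b (tdual a)) mulrAC.
Qed.

Lemma sl2_partner a x : a \in Lam -> a != 0 -> inw a x -> x != 0 ->
  exists2 y, inw (- a) y & lie x y = vsval (coroot a).
Proof.
move=> aL a0 xa x0; have [y yw xy] := killing_partner W ht hg xa x0.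
exists ((2%:R / a (tdual a)) *: y); first exact: in_wtZ.
have yl := (in_wt_root_space _ (root_opp W ht hg aL)).2 yw.
rewrite lieZr (lie_partner W ht hg xa); first by rewrite xy scale1r linearZ.
by move=> h; rewrite yl opp_lfunE.
Qed.

(** A maximal unbroken segment [c, c + a, ..., c + N a] of a root string is
    stable under the [sl2] of [a], so the trace identity forces
    [c (coroot a) = - N]. *)
Lemma root_segment a b : a \in Lam -> a != 0 -> b \in Lam -> b != 0 ->
  b != a -> b != - a ->
  exists2 z : int, b (coroot a) = z%:~R & b - a *~ z \in Lam.
Proof.
move=> aL a0 bL b0 ba bNa.
have mul_root l (k : int) : l \in Lam -> l = a *~ k -> [\/ l = 0, l = a | l = - a].
  case: k => [[|k]|k] lL e.
  - by constructor 1; rewrite e mulr0z.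
  - constructor 2; have [_ /(_ k)] := root_space_dim W ht hg aL a0.
    by rewrite e in lL * => /(_ lL) ->.
  constructor 3; have [_ /(_ k)] := root_space_dim W ht hg aL a0.
  have := root_opp W ht hg lL; rewrite e NegzE mulrNz opprK => h1 /(_ h1) ->.
  by rewrite mulr1z.
have inj s : s \in [:: a; - a] -> injective (fun j => b - s *+ j).
  move=> sP i j /addrI/oppr_inj/eqP; rewrite -subr_eq0.
  wlog ij : i j / (i <= j)%N => [IH|].
    case/orP: (leq_total i j) => le; first exact: IH.
    by rewrite -oppr_eq0 opprB => /(IH _ _ le).
  rewrite -oppr_eq0 opprB -mulrnBr // -scaler_nat scaler_eq0 pnatr_eq0 subn_eq0.
  have -> : (s == 0) = false.
    by move: sP; rewrite !inE => /orP[] /eqP ->; rewrite ?oppr_eq0 (negPf a0).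
  by rewrite orbF => ji; apply/eqP; rewrite eqn_leq ij.
(* [s] is a direction along the string, in which the string is left at last *)
have esc s : s \in [:: a; - a] -> exists2 r : nat, b - s *+ r.+1 \notin Lam &
    forall j, (j <= r)%N -> b - s *+ j \in Lam.
  move=> sP; have ex : exists j, b - s *+ j \notin Lam.
    apply: contrapT => no.
    have sub : {subset [seq b - s *+ j | j <- iota 0 (size Lam).+1] <= Lam}.
      by move=> _ /mapP[j _ ->]; apply: contrapT => /negP jL; apply: no; exists j.
    have us : uniq [seq b - s *+ j | j <- iota 0 (size Lam).+1].
      by rewrite map_inj_uniq ?iota_uniq //; apply: inj.
    by have := uniq_leq_size us sub; rewrite size_map size_iota ltnn.
  case: (ex_minnP ex) => -[|r] rL rmin; first by rewrite mulr0n subr0 bL in rL.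
  exists r => // j jr; apply: contrapT => /negP /rmin; lia.
have [|r rL rP] := esc a; first exact: mem_head.
have [|q qL qP] := esc (- a); first by rewrite !inE eqxx orbT.
pose c := b - a *+ r; pose N := (r + q)%N.
have cE k : c + a *+ k = b + a *~ (k%:Z - r%:Z).
  by rewrite /c mulrzBr -!pmulrn addrA addrAC.
have cL k : (k <= N)%N -> c + a *+ k \in Lam.
  move=> kN; have [kr|rk] := leqP k r.
    have -> : c + a *+ k = b - a *+ (r - k) by rewrite mulrnBr // opprB addrAC addrA /c.
    by apply: rP; lia.
  have -> : c + a *+ k = b - (- a) *+ (k - r).
    by rewrite mulNrn opprK mulrnBr ?(ltnW rk) // /c addrAC addrA.
  by apply: qP; rewrite /N in kN; lia.
have c1 : c - a \notin Lam by rewrite /c -addrA -opprD -mulrSr.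
have c2 : c + a *+ N.+1 \notin Lam.
  have -> : c + a *+ N.+1 = b - (- a) *+ q.+1.
    by rewrite mulNrn opprK /c /N -addnS mulrnDr addrA subrK.
  exact: qL.
have nz k : (k <= N)%N -> c + a *+ k != 0.
  move=> kN; apply/eqP; rewrite cE => /eqP; rewrite addr_eq0 -mulrNz => /eqP e.
  by case: (mul_root _ _ bL e) => e'; [case/eqP: b0 | case/eqP: ba | case/eqP: bNa].
pose s := [seq c + a *+ k | k <- iota 0 N.+1].
have us : uniq s.
  rewrite map_inj_uniq ?iota_uniq // => i j /addrI e.
  apply: (inj a (mem_head _ _)); by rewrite e.
have [x x0 xe] := root_eigenvector W ht hg aL.
have xa := in_wt_eig W xe.
have [y yw xy] := sl2_partner aL a0 xa x0.
have sIn k : (k <= N)%N -> c + a *+ k \in s.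
  by move=> kN; apply/mapP; exists k; rewrite // mem_iota.
have := string_trace W xa yw (esym xy) us.
have h1 l : l \in s -> l + a \in s \/ l + a \notin Lam.
  case/mapP=> k; rewrite mem_iota /= add0n ltnS => kN ->.
  rewrite -addrA -mulrSr; move: kN; rewrite leq_eqVlt => /orP[/eqP ->|kN].
    by right.
  by left; apply: sIn.
have h2 l : l \in s -> l - a \in s \/ l - a \notin Lam.
  case/mapP=> -[|k] ; rewrite mem_iota /= add0n ltnS => kN ->.
    by right; rewrite mulr0n addr0.
  by left; rewrite mulrSr addrA addrK; apply: sIn; apply: ltnW.
move=> /(_ h1 h2).
have aa : a (coroot a) = 2.
  rewrite corootE mulfK // (kformE W ht hg); exact: (tdual_root_neq0 W ht hg aL a0).
have -> : \sum_(l <- s) l (coroot a) * trf (pi l) =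
    \sum_(0 <= k < N.+1) (c (coroot a) + 2 * k%:R).
  rewrite big_map; apply: eq_big_seq => k; rewrite mem_iota /= add0n ltnS => kN.
  rewrite (trf_pi W) (root_space_dim W ht hg (cL _ kN) (nz _ kN)).1 mulr1.
  by rewrite add_lfunE -scaler_nat scale_lfunE aa /= [_ *: _]mulrC.
have sumE n C : \sum_(0 <= k < n) (C + 2 * k%:R) = n%:R * (C + n%:R - 1) :> K.
  elim: n => [|n IH]; first by rewrite big_geq // mul0r.
  by rewrite big_nat_recr //= IH -[n.+1]addn1 natrD; ring.
rewrite sumE => /eqP; rewrite mulf_eq0 pnatr_eq0 /= => /eqP cN.
have {}cN : c (coroot a) = - N%:R.
  by apply/eqP; rewrite -addr_eq0 -[X in _ == X]cN -[N.+1]addn1 natrD addrA addrK.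
have bE : b = c + a *+ r by rewrite /c subrK.
exists (r%:Z - q%:Z).
  rewrite bE add_lfunE -scaler_nat scale_lfunE cN aa /N natrD intrB.
  by rewrite -[_ *: _]/(r%:R * 2) -!pmulrn; ring.
have -> : b - a *~ (r%:Z - q%:Z) = c + a *+ q.
  by rewrite bE mulrzBr -!pmulrn opprB addrA addrAC addrK addrC addrC.
by apply: cL; rewrite /N leq_addl.
Qed.

Lemma root_reflection a b : a \in Lam -> a != 0 -> b \in Lam -> b != 0 ->
  exists2 z : int, b (coroot a) = z%:~R & b - a *~ z \in Lam.
Proof.
move=> aL a0 bL b0.
have aa : a (coroot a) = 2.
  rewrite corootE mulfK // (kformE W ht hg); exact: (tdual_root_neq0 W ht hg aL a0).
have [->|ba] := eqVneq b a.
  exists 2; first by rewrite aa.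
  by rewrite -[a *~ 2]/(a *+ 2) mulr2n opprD addrA subrr add0r (root_opp W ht hg).
have [->|bNa] := eqVneq b (- a).
  exists (- 2); first by rewrite opp_lfunE aa mulrNz.
  by rewrite mulrNz opprK -[a *~ 2]/(a *+ 2) mulr2n addKr.
exact: root_segment.
Qed.

(** For the coroot [h] of [a] one has [(a, a) = 4 / (h, h)], and [(h, h)] is a sum
    of squares of integers since all weights take integral values at [h]. *)
Lemma kform_norm_gt0 a : a \in Lam -> a != 0 -> 0 < kform a a.
Proof.
move=> aL a0; have c0 := tdual_root_neq0 W ht hg aL a0.
set c := a (tdual a) in c0; have kE : kform a a = c by rewrite (kformE W ht hg).
have e : killing (vsval (coroot a)) (vsval (coroot a)) = 4 / c.
  rewrite /coroot -/c linearZ killingZl killingZr (killing_tdual W ht hg) -/c.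
  by field.
have p : 0 < killing (vsval (coroot a)) (vsval (coroot a)).
  rewrite (killing_h W) (big_rem a aL) /= ltr_wpDr //.
    rewrite big_seq; apply: sumr_ge0 => l /mem_rem lL.
    rewrite mulr_ge0 ?(trf_pi W) ?ler0n //.
    have [->|l0] := eqVneq l 0; first by rewrite zero_lfunE expr0n.
    have [z -> _] := root_reflection aL a0 lL l0.
    by rewrite -rmorphXn ler0z /= sqr_ge0.
  rewrite (trf_pi W) mulr_gt0 ?ltr0n ?(wdim_gt0 W) //.
  by rewrite corootE mulfK ?kE // exprn_gt0.
rewrite kE -[c]invrK invr_gt0 -(pmulr_rgt0 _ (_ : 0 < 4)) ?ltr0n //.
by rewrite -e.
Qed.

Lemma kform_root_int a b : a \in Lam -> a != 0 -> b \in Lam -> b != 0 ->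
  exists2 z : int, 2%:R * kform b a = z%:~R * kform a a & b - a *~ z \in Lam.
Proof.
move=> aL a0 bL b0; have [z e zL] := root_reflection aL a0 bL b0.
exists z => //; rewrite -e corootE divfK //.
by rewrite lt0r_neq0 // kform_norm_gt0.
Qed.

Lemma kform_real a b : a \in Lam -> b \in Lam -> kform a b \is Num.real.
Proof.
move=> aL bL; have [->|a0] := eqVneq a 0.
  by rewrite (kformE W ht hg) zero_lfunE.
have [->|b0] := eqVneq b 0.
  by rewrite kformC (kformE W ht hg) zero_lfunE.
have [z e _] := kform_root_int bL b0 aL a0.
have -> : kform a b = z%:~R * kform b b / 2%:R.
  by rewrite -e mulrAC mulfV ?mul1r // pnatr_eq0.
by rewrite !rpredM ?rpredV ?realn ?realz ?gtr0_real ?kform_norm_gt0.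
Qed.

(** [(v, v)] is the sum over the weights [b] of [dim g_b (v, b)^2], with real
    [(v, b)]. *)
Lemma kform_posdef (s : seq (dual t)) : {subset s <= Lam} ->
  let v := \sum_(a <- s) a in 0 <= kform v v /\ (kform v v = 0 -> v = 0).
Proof.
move=> sL v.
have vr b : b \in Lam -> kform v b \is Num.real.
  move=> bL; rewrite /v (big_morph _ (fun l m => kformDl W ht hg l m b) (_ : _ = 0)).
    by rewrite big_seq; apply: rpred_sum => a /sL aL; apply: kform_real.
  by rewrite (kformE W ht hg) zero_lfunE.
have ge b : b \in Lam -> 0 <= kform v b * kform v b * trf (pi b).
  by move=> bL; rewrite mulr_ge0 ?(trf_pi W) ?ler0n // -expr2 real_exprn_even_ge0 ?vr.
rewrite (kform_sum W ht hg) big_seq; split; first exact: sumr_ge0.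
move=> /eqP; rewrite psumr_eq0 // => /allP k0.
apply: (tdual_inj W ht hg); apply: (killing_t_nondeg W ht hg) => h.
rewrite (killing_hh W) big_seq big1 // => b bL.
have := implyP (k0 b bL) bL; rewrite mulf_eq0 (trf_pi W) pnatr_eq0.
rewrite [_ == 0%N]eqn0Ngt (wdim_gt0 W bL) orbF mulf_eq0 orbb kformC => /eqP.
by rewrite (kformE W ht hg) => ->; rewrite !mul0r.
Qed.

End RootStrings.

(** What the rest of the argument uses of the structure of [g]: the roots form
    a finite reduced crystallographic root system for a form that is positive
    definite on the root lattice, and every root vector lies in an [sl2]. *)
Record root_data (K : numClosedFieldType) (g : lieAlgType K) (t : {vspace g})
    (Phi : seq (dual t)) : Prop := RootData {
  rd_mem : forall a, lie_roots t a <-> a \in Phi;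
  rd_neq0 : 0 \notin Phi;
  rd_double : forall a, a \in Phi -> a *+ 2 \notin Phi;
  rd_real : forall a b, a \in Phi -> b \in Phi -> kform a b \is Num.real;
  rd_pos : forall a, a \in Phi -> 0 < kform a a;
  rd_int : forall a b, a \in Phi -> b \in Phi ->
    exists2 z : int, 2%:R * kform b a = z%:~R * kform a a & b - a *~ z \in Phi;
  rd_posdef : forall s : seq (dual t), {subset s <= Phi} ->
    let v := \sum_(a <- s) a in 0 <= kform v v /\ (kform v v = 0 -> v = 0);
  rd_kformD : forall a b c : dual t, kform (a + b) c = kform a c + kform b c;
  rd_sl2 : forall a x, a \in Phi -> x != 0 -> in_root_space a x ->
    exists h y, [/\ in_root_space (- a) y, lie x y = vsval h
      & forall b : dual t, b h = 2%:R * kform b a / kform a a];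
  rd_lie0 : forall a b (x y : g), a \in Phi -> b \in Phi ->
    in_root_space a x -> in_root_space b y ->
    a + b != 0 -> a + b \notin Phi -> lie x y = 0;
  rd_eig : forall (h : subvs_of t) (x : g) c, x != 0 -> lie (vsval h) x = c *: x ->
    exists2 a, a \in 0 :: Phi & c = a h;
  rd_sum : forall x : g, exists F : dual t -> g,
    x = \sum_(a <- 0 :: Phi) F a /\ forall a, a \in 0 :: Phi -> in_root_space a (F a)
}.

Lemma root_data_exists (K : numClosedFieldType) (g : lieAlgType K)
    (t : {vspace g}) : simple_lie g -> cartan_subalgebra t ->
  exists Phi, @root_data K g t Phi.
Proof.
move=> hg ht; have [_ tn _] := ht.
have [Lam [pi W]] := weight_decomposition_exists tn.
have RS := in_wt_root_space W ht hg.
pose Phi := [seq a <- Lam | a != 0].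
have PP a : (a \in Phi) = (a != 0) && (a \in Lam) by rewrite mem_filter.
have L0 x : in_root_space (0 : dual t) x <-> in_wt pi 0 x.
  split=> [|x0 h]; first exact: (in_wt_eig W).
  by rewrite -(vsprojK (in_wt0_t W ht x0)) (t_abelian W ht hg) zero_lfunE scale0r.
exists Phi; split.
- by move=> a; rewrite PP; apply: (lie_rootsE W ht hg).
- by rewrite PP eqxx.
- move=> a; rewrite PP => /andP[a0 aL]; rewrite PP; apply/negP=> /andP[_ a2].
  by have [_ /(_ 1%N a2)] := root_space_dim W ht hg aL a0.
- move=> a b; rewrite !PP => /andP[_ aL] /andP[_ bL].
  exact: (kform_real W ht hg).
- by move=> a; rewrite PP => /andP[a0 aL]; apply: (kform_norm_gt0 W ht hg).
- move=> a b; rewrite !PP => /andP[a0 aL] /andP[b0 bL].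
  have [z e zL] := kform_root_int W ht hg aL a0 bL b0; exists z => //.
  rewrite PP zL andbT; apply: contraNneq b0 => e0.
  have bE : b = a *~ z by apply/eqP; rewrite -subr_eq0 e0.
  have p := kform_norm_gt0 W ht hg aL a0.
  move: e; rewrite bE -scaler_int !(kformE W ht hg) scale_lfunE -(kformE W ht hg).
  rewrite -[_ *: _]/(z%:~R * kform a a) => /eqP; rewrite -subr_eq0 mulrA -mulrBl.
  rewrite mulf_eq0 (gt_eqF p) orbF mulrDl !mul1r addrK intr_eq0 => /eqP z0.
  by rewrite z0 mulr0z scale0r.
- by move=> s sP; apply: (kform_posdef W ht hg) => a /sP; rewrite PP => /andP[].
- by move=> a b c; rewrite (kformDl W ht hg).
- move=> a x; rewrite PP => /andP[a0 aL] x0 /(RS _ _ aL) xa.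
  have [y yw xy] := sl2_partner W ht hg aL a0 xa x0.
  exists (coroot a), y; split=> //; last exact: (corootE W ht hg).
  by apply/(RS _ _ (root_opp W ht hg aL)).
- move=> a b x y; rewrite !PP => /andP[a0 aL] /andP[b0 bL].
  move=> /(RS _ _ aL) xa /(RS _ _ bL) yb ab; rewrite ab /= => abL.
  exact: (in_wt_notin W abL (in_wt_lie W xa yb)).
- move=> h x c x0 xc.
  have [l lL xl] : exists2 l, l \in Lam & pi l x != 0.
    apply: contrapT => no; case/negP: x0; rewrite -(wd_sum W x) big_seq big1 // => l lL.
    by apply/eqP; apply: contrapT => /negP xl; apply: no; exists l.
  exists l; first by rewrite inE PP lL andbT orbN.
  apply/eqP; rewrite -subr_eq0; apply: contraNT xl => ne.
  have e : (c - l h) *: pi l x = 0.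
    rewrite scalerBl -lfZ -xc -(wd_comm W).
    by rewrite ((RS l _ lL).2 (in_wt_pi W l x)) subrr.
  by move/eqP: e; rewrite scaler_eq0 (negPf ne).
move=> x; exists (fun l => pi l x); split.
  rewrite big_cons; rewrite -{1}(wd_sum W x).
  have -> : \sum_(l <- Phi) pi l x = \sum_(l <- Lam | l != 0) pi l x.
    by rewrite big_filter.
  have [l0|l0] := boolP (0 \in Lam); first by rewrite (bigD1_seq 0) ?(wd_uniq W).
  rewrite (wd_notin W l0) zero_lfunE add0r big_seq [RHS]big_seq_cond.
  by apply: eq_bigl => l; case: eqP => [->|]; rewrite ?andbT // (negPf l0).
move=> a; rewrite inE PP => /predU1P[->|/andP[a0 aL]].
  exact/L0/(in_wt_pi W).
exact/(RS _ _ aL)/(in_wt_pi W).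
Qed.

(** * Root systems *)

Lemma count_lt (T : eqType) (p r : pred T) (s : seq T) x :
  (forall y, p y -> r y) -> x \in s -> r x -> ~~ p x ->
  (count p s < count r s)%N.
Proof.
move=> pr; elim: s => // y s IH /[!inE] /predU1P[<-|xs] rx px /=.
  by rewrite rx (negPf px) add0n add1n ltnS; apply: sub_count.
rewrite -addnS leq_add ?IH //; by have := pr y; case: (p y); case: (r y) => // ->.
Qed.

Section RootSystem.
Variables (F : realFieldType) (V : zmodType) (q : V -> V -> F) (Phi : seq V).

(** Positivity is asked on sums of roots alone: the form is then positive
    definite on the root lattice, which is all that is compared below. *)
Record root_system : Prop := RootSystem {
  rs_sym : forall a b, q a b = q b a;
  rs_add : forall a b c, q (a + b) c = q a c + q b c;
  rs_neq0 : 0 \notin Phi;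
  rs_double : forall a, a \in Phi -> a *+ 2 \notin Phi;
  rs_pos : forall a, a \in Phi -> 0 < q a a;
  rs_int : forall a b, a \in Phi -> b \in Phi ->
    exists2 z : int, 2 * q b a = z%:~R * q a a & b - a *~ z \in Phi;
  rs_posdef : forall s : seq V, {subset s <= Phi} ->
    let v := \sum_(a <- s) a in 0 <= q v v /\ (q v v = 0 -> v = 0)
}.

Hypothesis D : root_system.
Implicit Types (a b c v : V) (s S : seq V).

Let qC := rs_sym D.
Let qDl := rs_add D.

Lemma q0l a : q 0 a = 0.
Proof. by apply: (addrI (q 0 a)); rewrite -qDl !addr0. Qed.
Lemma qDr a b c : q a (b + c) = q a b + q a c.
Proof. by rewrite qC qDl !(qC a). Qed.
Lemma qNl a b : q (- a) b = - q a b.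
Proof. by apply/eqP; rewrite -addr_eq0 -qDl addNr q0l. Qed.
Lemma qNr a b : q a (- b) = - q a b.
Proof. by rewrite qC qNl qC. Qed.
Lemma qBl a b c : q (a - b) c = q a c - q b c.
Proof. by rewrite qDl qNl. Qed.
Lemma qBr a b c : q a (b - c) = q a b - q a c.
Proof. by rewrite qDr qNr. Qed.
Lemma q_suml I (r : seq I) (p : pred I) (f : I -> V) a :
  q (\sum_(i <- r | p i) f i) a = \sum_(i <- r | p i) q (f i) a.
Proof. exact: (big_morph _ (fun b c => qDl b c a) (q0l a)). Qed.
Lemma q_sumr I (r : seq I) (p : pred I) (f : I -> V) a :
  q a (\sum_(i <- r | p i) f i) = \sum_(i <- r | p i) q a (f i).
Proof. by rewrite qC q_suml; apply: eq_bigr => i _; apply: qC. Qed.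
Lemma qMnl a n b : q (a *+ n) b = n%:R * q a b.
Proof.
elim: n => [|n IH]; first by rewrite mulr0n q0l mul0r.
by rewrite mulrS qDl IH mulrS mulrDl mul1r.
Qed.
Lemma qMzl a (z : int) b : q (a *~ z) b = z%:~R * q a b.
Proof.
case: z => n; first exact: qMnl.
by rewrite NegzE !mulrNz qNl mulNr -!pmulrn qMnl.
Qed.
Lemma qMzr a (z : int) b : q b (a *~ z) = z%:~R * q b a.
Proof. by rewrite qC qMzl qC. Qed.

(** The Cartan integer [2 (b, a) / (a, a)]. *)
Definition cz b a : int :=
  xget 0 [set z : int | 2 * q b a = z%:~R * q a a]%classic.

Lemma czE b a : a \in Phi -> b \in Phi -> 2 * q b a = (cz b a)%:~R * q a a.
Proof.
move=> aP bP; have [z e _] := rs_int D aP bP.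
by rewrite /cz; case: xgetP => [w _ //|/(_ z)[]].
Qed.

Lemma cz_unique b a (z : int) : a \in Phi -> b \in Phi ->
  2 * q b a = z%:~R * q a a -> cz b a = z.
Proof.
move=> aP bP; rewrite czE // => /(mulIf _) e.
by apply/eqP; rewrite -(eqr_int F) e // gt_eqF ?(rs_pos D).
Qed.

Lemma cz_refl b a : a \in Phi -> b \in Phi -> b - a *~ cz b a \in Phi.
Proof.
by move=> aP bP; have [z e zP] := rs_int D aP bP; rewrite (cz_unique aP bP e).
Qed.

Lemma czxx a : a \in Phi -> cz a a = 2.
Proof. by move=> aP; apply: cz_unique. Qed.

Lemma root_neg a : a \in Phi -> - a \in Phi.
Proof.
move=> aP; have := cz_refl aP aP.
by rewrite czxx // -[a *~ 2]/(a *+ 2) mulr2n opprD addrA subrr add0r.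
Qed.

Lemma cz_gt0 b a : a \in Phi -> b \in Phi -> (0 < cz b a) = (0 < q b a).
Proof.
move=> aP bP; have p := rs_pos D aP; have e := czE aP bP.
by rewrite -(ltr0z F) -(pmulr_lgt0 _ p) -e pmulr_rgt0.
Qed.

Lemma cz_eq0 b a : a \in Phi -> b \in Phi -> (cz b a == 0) = (q b a == 0).
Proof.
move=> aP bP; have p := rs_pos D aP; have e := czE aP bP.
apply/eqP/eqP => h; rewrite h in e; first by rewrite mulr0z mul0r in e; lra.
by move/esym/eqP: e; rewrite mulr0 mulf_eq0 (gt_eqF p) orbF intr_eq0 => /eqP.
Qed.

Lemma cz_lt0 b a : a \in Phi -> b \in Phi -> (cz b a < 0) = (q b a < 0).
Proof.
by move=> aP bP; rewrite !ltNge !le_eqVlt eq_sym cz_eq0 // eq_sym cz_gt0.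
Qed.

Lemma czN b a : a \in Phi -> b \in Phi -> cz (- b) a = - cz b a.
Proof.
move=> aP bP; apply: cz_unique; rewrite ?root_neg //.
by rewrite qNl mulrN czE // mulrNz mulNr.
Qed.

Lemma czD b c a : a \in Phi -> b \in Phi -> c \in Phi -> b + c \in Phi ->
  cz (b + c) a = cz b a + cz c a.
Proof.
move=> aP bP cP bcP; apply: cz_unique => //.
by rewrite qDl mulrDr !czE // intrD mulrDl.
Qed.

Lemma czB b c a : a \in Phi -> b \in Phi -> c \in Phi -> b - c \in Phi ->
  cz (b - c) a = cz b a - cz c a.
Proof. by move=> aP bP cP bcP; rewrite czD ?root_neg // czN. Qed.

Lemma cz_sum s b a : a \in Phi -> b \in Phi -> {subset s <= Phi} ->
  b = \sum_(x <- s) x -> cz b a = \sum_(x <- s) cz x a.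
Proof.
move=> aP bP sP e; apply: cz_unique => //.
rewrite e q_suml mulr_sumr rmorph_sum mulr_suml.
by apply: eq_big_seq => x /sP xP; rewrite czE.
Qed.

(** The root lattice, on which the form is positive definite. *)
Definition in_lattice v := exists2 s, {subset s <= Phi} & v = \sum_(a <- s) a.

Lemma lattice_root a : a \in Phi -> in_lattice a.
Proof. by exists [:: a]; rewrite ?big_seq1 // => x /[!inE] /eqP ->. Qed.
Lemma lattice_sum s : {subset s <= Phi} -> in_lattice (\sum_(x <- s) x).
Proof. by exists s. Qed.
Lemma latticeD u v : in_lattice u -> in_lattice v -> in_lattice (u + v).
Proof.
move=> [s sP ->] [s' sP' ->]; exists (s ++ s'); last by rewrite big_cat.
by move=> x; rewrite mem_cat => /orP[/sP|/sP'].
Qed.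
Lemma latticeN u : in_lattice u -> in_lattice (- u).
Proof.
move=> [s sP ->]; exists (map -%R s); last by rewrite big_map sumrN.
by move=> _ /mapP[x /sP xP ->]; apply: root_neg.
Qed.
Lemma latticeB u v : in_lattice u -> in_lattice v -> in_lattice (u - v).
Proof. by move=> uL vL; apply: latticeD => //; apply: latticeN. Qed.
Lemma latticeMz u (z : int) : in_lattice u -> in_lattice (u *~ z).
Proof.
move=> uL; have n (n : nat) : in_lattice (u *+ n).
  elim: n => [|n IH]; first by exists [::]; rewrite ?big_nil ?mulr0n.
  by rewrite mulrS; apply: latticeD.
case: z => m; first exact: n.
by rewrite NegzE mulrNz; apply: latticeN; apply: n.
Qed.
Lemma lattice_bigMz s (z : V -> int) : {subset s <= Phi} ->
  in_lattice (\sum_(x <- s) x *~ z x).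
Proof.
elim: s => [|x s IH] sP; first by rewrite big_nil; exists [::]; rewrite ?big_nil.
rewrite big_cons; apply: latticeD; last first.
  by apply: IH => y ys; apply: sP; rewrite inE ys orbT.
by apply/latticeMz/lattice_root/sP; rewrite mem_head.
Qed.
Lemma lattice_ge0 v : in_lattice v -> 0 <= q v v.
Proof. by case=> s sP ->; case: (rs_posdef D sP). Qed.
Lemma lattice_eq0 v : in_lattice v -> q v v <= 0 -> v = 0.
Proof.
move=> vL v0; have v1 := lattice_ge0 vL; case: vL v0 v1 => s sP -> v0 v1.
by case: (rs_posdef D sP) => _; apply; apply: le_anti; rewrite v0 v1.
Qed.

Lemma root_sub a b : a \in Phi -> b \in Phi -> 0 < q a b -> a != b -> a - b \in Phi.
Proof.
move=> aP bP ab ne.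
have n0 : 0 < cz a b by rewrite cz_gt0.
have m0 : 0 < cz b a by rewrite cz_gt0 // qC.
have [n1|n1] := eqVneq (cz a b) 1; first by rewrite -[b]mulr1z -n1 cz_refl.
have [m1|m1] := eqVneq (cz b a) 1.
  by rewrite -opprB root_neg // -[a]mulr1z -m1 cz_refl.
have n2 : 2 <= cz a b by lia.
have m2 : 2 <= cz b a by lia.
case/eqP: ne; apply/eqP; rewrite -subr_eq0; apply/eqP/lattice_eq0.
  by apply: latticeB; apply: lattice_root.
have e1 := czE bP aP; have e2 := czE aP bP.
have pa := rs_pos D aP; have pb := rs_pos D bP.
have h1 : 2 * q b b <= 2 * q a b by rewrite e1 ler_pM2r // -[2]/(2%:~R) ler_int.
have h2 : 2 * q a a <= 2 * q b a by rewrite e2 ler_pM2r // -[2]/(2%:~R) ler_int.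
rewrite qBl !qBr; rewrite (qC b a) in h2 *; lra.
Qed.

Lemma root_add a b : a \in Phi -> b \in Phi -> q a b < 0 -> a != - b -> a + b \in Phi.
Proof.
move=> aP bP ab ne; rewrite -[b]opprK root_sub ?root_neg // qNr oppr_gt0 //.
Qed.

(** * Orthogonal sets of roots *)

Definition orthogonal_seq S :=
  uniq S /\ forall a b, a \in S -> b \in S -> a != b -> q a b = 0.

Lemma orthogonal_seq_cons a S : orthogonal_seq (a :: S) -> orthogonal_seq S.
Proof.
case=> /andP[_ uS] o; split=> // b c bS cS.
by apply: o; rewrite inE ?bS ?cS orbT.
Qed.

Lemma orthogonal_seq_head a S : orthogonal_seq (a :: S) ->
  forall b, b \in S -> q a b = 0.
Proof.
case=> /andP[aS _] o b bS; apply: o; rewrite ?mem_head ?inE ?bS ?orbT //.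
by apply: contraNneq aS => ->.
Qed.

(** The product of the (commuting) reflections in an orthogonal set. *)
Definition refl S v := v - \sum_(b <- S) b *~ cz v b.

(** Subsets of roots closed under the root strings of their members; the
    systems met by the cascade are of this kind. *)
Definition subsystem (C : V -> Prop) :=
  (forall a, C a -> a \in Phi) /\
  (forall a b (k : int), C a -> C b -> b + a *~ k \in Phi -> C (b + a *~ k)).

Lemma subsystem_roots : subsystem (fun a => a \in Phi).
Proof. by []. Qed.

Lemma subsystem_neg (C : V -> Prop) a : subsystem C -> C a -> C (- a).
Proof.
move=> [CP Cs] aC; have aP := CP _ aC.
have e : - a = a + a *~ (- 2).
  by rewrite mulrNz -[a *~ 2]/(a *+ 2) mulr2n opprD addrA subrr add0r.
by rewrite e; apply: Cs => //; rewrite -e root_neg.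
Qed.

Lemma refl_in_subsystem (C : V -> Prop) S a : subsystem C ->
  {subset S <= Phi} -> orthogonal_seq S -> C a ->
  (forall b, b \in S -> C b \/ q a b = 0) ->
  C (refl S a).
Proof.
move=> [CP Cs]; elim: S a => [|b S IH] a SP oS aC sC.
  by rewrite /refl big_nil subr0.
have bP : b \in Phi by apply: SP; rewrite mem_head.
have SP' : {subset S <= Phi} by move=> x xS; apply: SP; rewrite inE xS orbT.
have a'C : C (a - b *~ cz a b).
  rewrite -mulrNz; case: (sC b (mem_head _ _)) => [bC|ab].
    by apply: Cs => //; rewrite mulrNz cz_refl // CP.
  have /eqP -> : cz a b == 0 by rewrite cz_eq0 ?ab // CP.
  by rewrite oppr0 mulr0z addr0.
have a'q c : c \in S -> q (a - b *~ cz a b) c = q a c.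
  by move=> cS; rewrite qBl qMzl (orthogonal_seq_head oS cS) mulr0 subr0.
have -> : refl (b :: S) a = refl S (a - b *~ cz a b).
  rewrite /refl big_cons opprD addrA; congr (_ - _).
  apply: eq_big_seq => c cS; congr (_ *~ _); apply/esym/cz_unique; [exact: SP'|exact: CP|].
  by rewrite a'q //; apply: czE; [apply: SP'|apply: CP].
apply: IH => // [|c cS]; first exact: orthogonal_seq_cons oS.
rewrite a'q //; apply: sC; by rewrite inE cS orbT.
Qed.

Lemma refl_root S a : {subset S <= Phi} -> orthogonal_seq S -> a \in Phi ->
  refl S a \in Phi.
Proof.
move=> SP oS aP; apply: (refl_in_subsystem subsystem_roots) => // b bS.
by left; apply: SP.
Qed.

Lemma q_refl_out S v c : (forall b, b \in S -> q b c = 0) ->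
  q (refl S v) c = q v c.
Proof.
move=> o; rewrite /refl qBl q_suml big_seq big1 ?subr0 // => b bS.
by rewrite qMzl o // mulr0.
Qed.

Lemma q_refl_in S v c : {subset S <= Phi} -> orthogonal_seq S -> v \in Phi ->
  c \in S -> q (refl S v) c = - q v c.
Proof.
move=> SP [uS o] vP cS; rewrite /refl qBl q_suml (bigD1_seq c) //= big_seq_cond big1.
  by rewrite addr0 qMzl -(czE (SP _ cS) vP); ring.
by move=> b /andP[bS bc]; rewrite qMzl o // mulr0.
Qed.

(** Bessel's inequality, with its case of equality: the vector whose norm is
    computed is twice the component of [a] orthogonal to [S]. *)
Lemma bessel S a : {subset S <= Phi} -> orthogonal_seq S -> a \in Phi ->
  \sum_(b <- S) cz a b * cz b a <= 4 /\
  (\sum_(b <- S) cz a b * cz b a = 4 -> a *+ 2 = \sum_(b <- S) b *~ cz a b).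
Proof.
move=> SP oS aP; pose v := a *+ 2 - \sum_(b <- S) b *~ cz a b.
have vL : in_lattice v.
  by apply: latticeB (lattice_bigMz _ SP); rewrite mulr2n;
     apply: latticeD; apply: lattice_root.
have vE : q v v = (4 - \sum_(b <- S) cz a b * cz b a)%:~R * q a a.
  have vb b : b \in S -> q v b = 0.
    move=> bS; rewrite /v qBl qMnl q_suml (bigD1_seq b) ?oS.1 //= big_seq_cond big1.
      by rewrite addr0 qMzl -(czE (SP _ bS) aP) subrr.
    by move=> c /andP[cS cb]; rewrite qMzl oS.2 // mulr0.
  rewrite {2}/v qBr q_sumr [X in _ - X]big_seq [X in _ - X]big1; last first.
    by move=> b bS; rewrite qMzr vb // mulr0.
  rewrite subr0 mulr2n qDr /v qBl qMnl q_suml intrB mulrBl.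
  have -> : (\sum_(b <- S) cz a b * cz b a)%:~R * q a a =
      2 * \sum_(b <- S) q (b *~ cz a b) a.
    rewrite rmorph_sum mulr_suml mulr_sumr; apply: eq_big_seq => b bS.
    by rewrite /= intrM qMzl -mulrA -(czE aP (SP _ bS)); ring.
  by ring.
have pa := rs_pos D aP; have := lattice_ge0 vL.
rewrite vE pmulr_lge0 // ler0z subr_ge0 => le4; split=> // e4.
apply/eqP; rewrite -subr_eq0; apply/eqP/lattice_eq0 => //.
by rewrite -/v vE e4 subrr mul0r.
Qed.

(** The two Cartan integers of a pair of roots have the same sign. *)
Lemma cz_le_mul a b : a \in Phi -> b \in Phi -> cz a b <= cz a b * cz b a.
Proof.
move=> aP bP; have p1 := cz_gt0 bP aP; have p2 := cz_gt0 aP bP.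
have e1 := cz_eq0 bP aP; rewrite (qC b a) in p2; have n1 := cz_lt0 bP aP.
have n2 := cz_lt0 aP bP; rewrite (qC b a) in n2.
have [h|h|h] := ltgtP (q a b) 0.
- rewrite h in n1 n2; nia.
- rewrite h in p1 p2; nia.
by rewrite h eqxx in e1; rewrite (eqP e1) mul0r.
Qed.

Lemma bessel_sum_le4 S a : {subset S <= Phi} -> orthogonal_seq S -> a \in Phi ->
  \sum_(b <- S) cz a b <= 4.
Proof.
move=> SP oS aP; apply: le_trans (bessel SP oS aP).1.
rewrite big_seq [leRHS]big_seq; apply: ler_sum => b bS.
by apply: cz_le_mul => //; apply: SP.
Qed.

(** * Irreducibility *)

Definition q_irreducible (C : V -> Prop) := forall A B : V -> Prop,
  (forall a, C a <-> A a \/ B a) -> (forall a b, A a -> B b -> q a b = 0) ->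
  (forall a, ~ A a) \/ (forall a, ~ B a).

(** In an irreducible system two orthogonal roots have a common neighbour: the
    roots orthogonal to [b] and to all neighbours of [b] are orthogonal to the
    other ones, because a neighbour [c] of both [b] and [x] gives a second
    neighbour of [b] by reflecting [x]. *)
Lemma common_neighbour (C : V -> Prop) b e : subsystem C -> q_irreducible C ->
  C b -> C e -> q e b = 0 -> exists c, [/\ C c, q c b != 0 & q c e != 0].
Proof.
move=> [CP Cs] irr bC eC eb.
pose A d := C d /\ (q d b = 0 /\ forall c, C c -> q c b != 0 -> q d c = 0).
pose B d := C d /\ ~ (q d b = 0 /\ forall c, C c -> q c b != 0 -> q d c = 0).
have [d||nA|nB] := irr A B.
- by split=> [dC|[[]|[]]] //; case: (pselect (q d b = 0 /\ forall c, C c -> q c b != 0 -> q d c = 0)); [left|right].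
- move=> d x [dC [db dn]] [xC xn].
  have [xb|xb] := eqVneq (q x b) 0; last exact: dn.
  have [c [cC cb xc]] : exists c, [/\ C c, q c b != 0 & q x c != 0].
    apply: contrapT => no; apply: xn; split=> // c cC cb; apply/eqP.
    by apply: contrapT => /negP xc; apply: no; exists c.
  have nP : x - c *~ cz x c \in Phi by apply: cz_refl; apply: CP.
  have nC : C (x - c *~ cz x c).
    by rewrite -mulrNz; apply: Cs => //; rewrite mulrNz.
  have := dn _ nC _; rewrite qBl xb sub0r qMzl oppr_eq0 mulf_neq0 //.
    by move=> /(_ isT); rewrite qBr qMzr (dn c) // mulr0 subr0.
  by rewrite intr_eq0 cz_eq0 // CP.
- apply: contrapT => no; apply: (nA e); split=> //; split=> // c cC cb.
  by apply/eqP; apply: contrapT => /negP ec; apply: no; exists c; rewrite (qC c e).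
case: (nB b); split=> // -[bb _].
by have := rs_pos D (CP _ bC); rewrite bb ltxx.
Qed.

(** * Positive roots *)

Section Positive.
Variable P : V -> Prop.

Record positive_system : Prop := PositiveSystem {
  ps_root : forall a, P a -> a \in Phi;
  ps_total : forall a, a \in Phi -> P a \/ P (- a);
  ps_asym : forall a, ~ (P a /\ P (- a));
  ps_closed : forall a b, P a -> P b -> a + b \in Phi -> P (a + b)
}.

Hypothesis DP : positive_system.

Definition pos_list s := forall x, x \in s -> P x.

Definition nonneg v := exists2 s, pos_list s & v = \sum_(x <- s) x.

Lemma pos_list_sub s : pos_list s -> {subset s <= Phi}.
Proof. by move=> sP x /sP /(ps_root DP). Qed.

Lemma pos_list_cat s1 s2 : pos_list s1 -> pos_list s2 -> pos_list (s1 ++ s2).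
Proof. by move=> h1 h2 x; rewrite mem_cat => /orP[/h1|/h2]. Qed.

Lemma pos_list_cons a s : P a -> pos_list s -> pos_list (a :: s).
Proof. by move=> h1 h2 x /[!inE] /predU1P[->|/h2]. Qed.

Lemma pos_neq0 a : P a -> a != 0.
Proof.
by move=> /(ps_root DP) aP; apply: contraNneq (rs_neq0 D) => <-.
Qed.

(** A nonempty sum of positive roots never vanishes: two summands at an obtuse
    angle may be replaced by their sum. *)
Lemma pos_sum_eq0 s : pos_list s -> \sum_(x <- s) x = 0 -> s = [::].
Proof.
move: {2}(size s) (leqnn (size s)) => n; elim: n s => [|n IH] [|a s] //= sn sP.
rewrite big_cons => e; exfalso.
have aP : P a by apply: sP; rewrite mem_head.
have sP' : pos_list s by move=> x xs; apply: sP; rewrite inE xs orbT.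
have [b bs ab] : exists2 b, b \in s & q a b < 0.
  apply: contrapT => no; have := rs_pos D (ps_root DP aP).
  have : 0 <= q a (\sum_(x <- s) x).
    rewrite q_sumr big_seq; apply: sumr_ge0 => x xs; rewrite leNgt.
    by apply/negP => ax; apply: no; exists x.
  have -> : \sum_(x <- s) x = - a by apply/eqP; rewrite -addr_eq0 addrC e.
  by rewrite qNr oppr_ge0 => h1 h2; have := le_lt_trans h1 h2; rewrite ltxx.
have bP := sP' _ bs.
have abP : P (a + b).
  apply: (ps_closed DP) => //; apply: root_add; rewrite ?(ps_root DP) //.
  apply/eqP=> aE; case: (ps_asym DP (a := b)); split=> //; by rewrite -aE.
have := IH (a + b :: rem b s); rewrite /= size_rem // prednK; last first.
  by case: (s) bs.
move=> /(_ sn); have := e; rewrite (big_rem b bs) /= => e' h.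
suff : (a + b :: rem b s) = [::] by [].
apply: h; last by rewrite big_cons -addrA.
apply: pos_list_cons => // x /mem_rem; exact: sP'.
Qed.

Lemma nonneg0 : nonneg 0.
Proof. by exists [::]; rewrite ?big_nil. Qed.
Lemma nonneg_pos a : P a -> nonneg a.
Proof. by move=> aP; exists [:: a]; rewrite ?big_seq1 //; apply: pos_list_cons. Qed.
Lemma nonnegD u v : nonneg u -> nonneg v -> nonneg (u + v).
Proof.
move=> [s sP ->] [s' sP' ->]; exists (s ++ s'); last by rewrite big_cat.
exact: pos_list_cat.
Qed.
Lemma nonneg_Mn u n : nonneg u -> nonneg (u *+ n).
Proof.
by move=> uP; elim: n => [|n IH]; [apply: nonneg0 | rewrite mulrS; apply: nonnegD].
Qed.
Lemma nonneg_anti u : nonneg u -> nonneg (- u) -> u = 0.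
Proof.
move=> [s sP uE] [s' sP' vE].
have := pos_sum_eq0 (pos_list_cat sP sP').
rewrite big_cat /= -uE -vE subrr => /(_ erefl).
by case: s {sP} uE => //; rewrite big_nil.
Qed.
Lemma nonneg_root a : a \in Phi -> nonneg a -> P a.
Proof.
move=> aP an; case: (ps_total DP aP) => // naP.
have a0 := nonneg_anti an (nonneg_pos naP).
by move: (rs_neq0 D); rewrite -a0 aP.
Qed.

Lemma nonneg_P_false a : P a -> nonneg (- a) -> False.
Proof. by move=> aP /(nonneg_anti (nonneg_pos aP)) e; have := pos_neq0 aP; rewrite e eqxx. Qed.

(** * Simple roots *)

Definition simple a := P a /\ ~ (exists b c, [/\ P b, P c & a = b + c]).

Definition simple_list s := forall x, x \in s -> simple x.

Lemma simple_list_pos s : simple_list s -> pos_list s.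
Proof. by move=> sS x /sS []. Qed.

Lemma simple_list_root s : simple_list s -> {subset s <= Phi}.
Proof. by move/simple_list_pos/pos_list_sub. Qed.

Lemma simple_list_cat s1 s2 : simple_list s1 -> simple_list s2 -> simple_list (s1 ++ s2).
Proof. by move=> h1 h2 x; rewrite mem_cat => /orP[/h1|/h2]. Qed.

(** Induction on the number of roots below [a]. *)
Lemma simple_decomposition a : P a -> exists2 s, simple_list s & a = \sum_(x <- s) x.
Proof.
pose rk a := count (fun d => `[< nonneg (a - d) >]) Phi.
move: {2}(rk a) (leqnn (rk a)) => n; elim: n a => [|n IH] a an aP.
  move: an; rewrite leqNgt -has_count => /hasPn/(_ _ (ps_root DP aP))/asboolP[].
  by rewrite subrr; apply: nonneg0.
have [[b [c [bP cP e]]]|no] := pselect (exists b c, [/\ P b, P c & a = b + c]).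
  have rkl x y : P x -> P y -> a = x + y -> (rk x <= n)%N.
    move=> xP yP ae; rewrite -ltnS; apply: leq_trans an; apply: (@count_lt _ _ _ _ a).
    - move=> d /asboolP xd; apply/asboolP; rewrite ae addrAC.
      by apply: nonnegD => //; apply: nonneg_pos.
    - exact: (ps_root DP).
    - by apply/asboolP; rewrite subrr; apply: nonneg0.
    apply/asboolP; rewrite ae opprD addrA subrr add0r; exact: nonneg_P_false.
  have [s sS bE] := IH b (rkl _ _ bP cP e) bP.
  have [|s' sS' cE] := IH c _ cP; first by apply: (rkl _ _ cP bP); rewrite addrC.
  by exists (s ++ s'); rewrite ?big_cat -?bE -?cE //; apply: simple_list_cat.
by exists [:: a]; rewrite ?big_seq1 // => x /[!inE] /eqP ->.
Qed.

Lemma simple_obtuse a b : simple a -> simple b -> a != b -> q a b <= 0.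
Proof.
move=> [aP an] [bP bn] ab; rewrite leNgt; apply/negP=> abq.
have r := root_sub (ps_root DP aP) (ps_root DP bP) abq ab.
case: (ps_total DP r) => h; first by apply: an; exists (a - b), b; rewrite subrK.
by rewrite opprB in h; apply: bn; exists (b - a), a; rewrite subrK.
Qed.

(** Without common members the two sums meet at an obtuse angle; being equal,
    they vanish. *)
Lemma simple_sum_inj s1 s2 : simple_list s1 -> simple_list s2 ->
  \sum_(x <- s1) x = \sum_(x <- s2) x -> perm_eq s1 s2.
Proof.
move: {2}(size s1) (leqnn (size s1)) => n; elim: n s1 s2 => [|n IH] s1 s2 sn h1 h2 e.
  move: sn e; rewrite leqn0 size_eq0 => /eqP ->; rewrite big_nil => /esym.
  by move/(pos_sum_eq0 (simple_list_pos h2)) ->.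
have [[c c1 c2]|no] := pselect (exists2 c, c \in s1 & c \in s2).
  have p1 := perm_to_rem c1; have p2 := perm_to_rem c2.
  rewrite (permPl p1) (permPr p2) perm_cons; apply: IH.
  - by rewrite size_rem //; case: (size s1) sn.
  - by move=> x /mem_rem; apply: h1.
  - by move=> x /mem_rem; apply: h2.
  by move: e; rewrite (big_rem c c1) (big_rem c c2) /= => /addrI.
have v0 : \sum_(x <- s1) x = 0.
  apply: lattice_eq0; first exact/lattice_sum/simple_list_root.
  rewrite {2}e q_suml big_seq; apply: sumr_le0 => x x1.
  rewrite q_sumr big_seq; apply: sumr_le0 => y y2.
  apply: simple_obtuse; [exact: h1|exact: h2|].
  by apply/eqP=> xy; apply: no; exists x => //; rewrite xy.
have := pos_sum_eq0 (simple_list_pos h1) v0.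
by move=> ->; move: v0; rewrite e => /(pos_sum_eq0 (simple_list_pos h2)) ->.
Qed.

(** The coefficient of the simple root [a] in [v] is a relation, as [v] need not
    be given with a decomposition; [simple_sum_inj] makes it functional. *)
Definition coef a v (z : int) := exists s1 s2,
  [/\ simple_list s1, simple_list s2, v = \sum_(x <- s1) x - \sum_(x <- s2) x
    & z = (count_mem a s1)%:Z - (count_mem a s2)%:Z].

Lemma coef_fun a v z z' : coef a v z -> coef a v z' -> z = z'.
Proof.
move=> [s1 [s2 [h1 h2 -> ->]]] [t1 [t2 [k1 k2 e ->]]].
have /permP/(_ (pred1 a)) : perm_eq (s1 ++ t2) (t1 ++ s2).
  apply: simple_sum_inj; try exact: simple_list_cat.
  rewrite !big_cat /= (_ : \sum_(x <- s1) x = \sum_(x <- t1) x - \sum_(x <- t2) x + \sum_(x <- s2) x).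
    by rewrite addrAC subrK.
  by rewrite -e subrK.
by rewrite !count_cat; lia.
Qed.

Lemma coefD a u v y z : coef a u y -> coef a v z -> coef a (u + v) (y + z).
Proof.
move=> [s1 [s2 [h1 h2 -> ->]]] [t1 [t2 [k1 k2 -> ->]]].
exists (s1 ++ t1), (s2 ++ t2); split; try exact: simple_list_cat.
  by rewrite !big_cat /= opprD addrACA.
by rewrite !count_cat; lia.
Qed.

Lemma coefN a u y : coef a u y -> coef a (- u) (- y).
Proof.
by move=> [s1 [s2 [h1 h2 -> ->]]]; exists s2, s1; rewrite !opprB.
Qed.

Lemma coef0 a : coef a 0 0.
Proof. by exists [::], [::]; split; rewrite // !big_nil subrr. Qed.

Lemma coefMz a u (n : int) : coef a u 0 -> coef a (u *~ n) 0.
Proof.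
move=> u0; have n1 (k : nat) : coef a (u *+ k) 0.
  elim: k => [|k IH]; first by rewrite mulr0n; apply: coef0.
  by rewrite mulrS -[0](addr0 0); apply: coefD.
case: n => k; first exact: n1.
by rewrite NegzE mulrNz -[0]oppr0; apply: coefN; apply: n1.
Qed.

Lemma coef_list a s : simple_list s -> coef a (\sum_(x <- s) x) (count_mem a s)%:Z.
Proof. by exists s, [::]; rewrite big_nil !subr0. Qed.

End Positive.
End RootSystem.

(** * The highest root and the roots not orthogonal to it *)

Lemma count_mem_sum (T : eqType) (a : T) (s : seq T) :
  (count_mem a s)%:Z = \sum_(x <- s) (x == a)%:Z.
Proof.
elim: s => [|x s IH]; first by rewrite big_nil.
by rewrite big_cons /= PoszD IH; case: eqP.
Qed.

Lemma sum_ge0_eq0 (R : numDomainType) (T : eqType) (s : seq T) (f : T -> R) :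
  (forall x, x \in s -> 0 <= f x) -> \sum_(x <- s) f x = 0 ->
  forall x, x \in s -> f x = 0.
Proof.
move=> f0; rewrite big_seq => /eqP; rewrite psumr_eq0 // => /allP h x xs.
by have /implyP/(_ xs)/eqP := h x xs.
Qed.

Section HighestRoot.
Variables (F : realFieldType) (V : zmodType) (q : V -> V -> F) (Phi : seq V).
Variable P : V -> Prop.
Hypothesis D : root_system q Phi.
Hypothesis DP : positive_system Phi P.
Implicit Types (a b c v : V) (s : seq V).

Local Notation cz := (cz q).
Let qC := rs_sym D.

Lemma nonneg_simple v : nonneg P v ->
  exists2 s, simple_list P s & v = \sum_(x <- s) x.
Proof.
move=> [s sP ->]; elim: s sP => [|x s IH] sP.
  by exists [::]; rewrite ?big_nil.
have [|s1 h1 e1] := IH; first by move=> y ys; apply: sP; rewrite inE ys orbT.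
have [s2 h2 e2] := simple_decomposition D DP (sP _ (mem_head _ _)).
exists (s2 ++ s1); first exact: simple_list_cat.
by rewrite big_cons big_cat /= e1 -e2.
Qed.

Variable theta : V.
Hypothesis thPhi : theta \in Phi.
Hypothesis hth : forall a, a \in Phi -> nonneg P (theta - a).

Lemma theta_pos : P theta.
Proof.
have h := hth (root_neg D thPhi).
case: (ps_total DP thPhi) => // nP; apply: (nonneg_root D DP) => //.
by rewrite -[X in nonneg P X](subrK (- theta)); apply: nonnegD => //; apply: nonneg_pos.
Qed.

Lemma theta_dom a : P a -> 0 <= q theta a.
Proof.
move=> aP; rewrite leNgt; apply/negP=> h.
have r : theta + a \in Phi.
  apply: (root_add D) => //; first exact: (ps_root DP).
  apply/eqP=> e; apply: (ps_asym DP (a := a)); split=> //; rewrite -e; exact: theta_pos.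
have := hth r; rewrite opprD addrA subrr add0r; exact: (nonneg_P_false D DP aP).
Qed.

(** If [n >= 2] is the Cartan integer of [a], then [theta - a] and, from the
    reflected root, [a - (n - 1) theta] are both sums of positive roots. *)
Lemma cz_theta_le1 a : a \in Phi -> a != theta -> cz a theta <= 1.
Proof.
move=> aPhi ne; rewrite leNgt; apply/negP=> n1.
have [k kE] : exists k : nat, cz a theta = k.+2 by exists (`|cz a theta|%N - 2)%N; lia.
have r := cz_refl D thPhi aPhi; rewrite kE in r.
have h1 := hth (root_neg D r); have h2 := hth aPhi.
case/eqP: ne; apply/eqP; rewrite eq_sym -subr_eq0; apply/eqP.
apply: (nonneg_anti D DP h2).
have -> : - (theta - a) = (theta - - (a - theta *~ k.+2)) + theta *+ k.
  rewrite opprB opprK -[theta *~ _]/(theta *+ k.+2) !mulrS !opprD !addrA subrK.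
  by rewrite [theta + a]addrC addrK.
by apply: nonnegD h1 _; apply/nonneg_Mn/nonneg_pos/theta_pos.
Qed.

(** If [theta] is in the part [A] and a positive [b] in the part [B], the
    decomposition of [theta - b] into positive roots separates into one along [A]
    and one along [B]; the latter would give [b] plus positive roots equal to
    [0]. *)
Lemma roots_irreducible : q_irreducible q (fun a => a \in Phi).
Proof.
have main A B : (forall a, a \in Phi <-> A a \/ B a) ->
    (forall a b, A a -> B b -> q a b = 0) -> A theta -> forall a, ~ B a.
  move=> AB o Ath.
  have BPhi b : B b -> b \in Phi by move=> bB; apply/AB; right.
  have nB b : B b -> ~ P b.
    move=> bB bP; have [s sP e] := hth (BPhi _ bB).
    have sR := pos_list_sub DP sP.
    pose v := theta - \sum_(x <- s | `[< A x >]) x.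
    have vE : v = b + \sum_(x <- s | ~~ `[< A x >]) x.
      apply/eqP; rewrite subr_eq -addrA; apply/eqP.
      rewrite [X in b + X]addrC -(bigID (fun x => `[< A x >]) xpredT id) /= -e.
      by rewrite addrC subrK.
    have vL : in_lattice Phi v.
      apply: (latticeB D); first exact: lattice_root.
      by rewrite -big_filter; apply: lattice_sum => x; rewrite mem_filter => /andP[_ /sR].
    have cB x : x \in s -> ~~ `[< A x >] -> B x.
      by move=> xs /asboolP nA; have [/(_ (sR _ xs))[]//] := AB x.
    have oB x : B x -> q v x = 0.
      move=> xB; rewrite (qBl D) o // (q_suml D) big1 ?subrr // => y /asboolP yA.
      exact: o.
    have v0 : v = 0.
      apply: (lattice_eq0 D) => //; rewrite {2}vE (qDr D) oB // add0r (q_sumr D).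
      by rewrite big_seq_cond big1 // => x /andP[xs xA]; apply/oB/cB.
    have := @pos_sum_eq0 _ _ _ _ D _ DP (b :: [seq x <- s | ~~ `[< A x >]]).
    rewrite big_cons big_filter -vE v0 => h.
    suff : (b :: [seq x <- s | ~~ `[< A x >]]) = [::] by [].
    apply: h => //; apply: pos_list_cons => // x; rewrite mem_filter => /andP[_]; exact: sP.
  move=> a aB; case: (ps_total DP (BPhi _ aB)); first exact: nB.
  apply: nB; have [/(_ (root_neg D (BPhi _ aB)))[h|//] _] := AB (- a).
  have := o _ _ h aB; rewrite (qNl D) => /eqP; rewrite oppr_eq0 => /eqP aa.
  by have := rs_pos D (BPhi _ aB); rewrite aa ltxx.
move=> A B AB o; have [/(_ thPhi)[thA|thB] _] := AB theta.
  by right; apply: (main A B).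
left; apply: (main B A) => // [a|a b aB bA]; last by rewrite qC o.
by rewrite AB; tauto.
Qed.

Lemma cz_theta_ge0 a : P a -> 0 <= cz a theta.
Proof.
move=> aP; rewrite leNgt (cz_lt0 D thPhi (ps_root DP aP)).
by rewrite qC -leNgt theta_dom.
Qed.

(** With [theta] itself, these roots span the Heisenberg algebra attached to
    the highest root. *)
Definition heis a := a \in Phi /\ cz a theta = 1.

Lemma heis_gt0 a : heis a -> 0 < q a theta.
Proof. by move=> [aPhi e]; rewrite -(cz_gt0 D) // e. Qed.

Lemma heis_pos a : heis a -> P a.
Proof.
move=> h; have aq := heis_gt0 h; case: (ps_total DP h.1) => // /theta_dom.
rewrite (qNr D) oppr_ge0 qC => aq'; by have := lt_le_trans aq aq'; rewrite ltxx.
Qed.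

Lemma heis_dual a : heis a -> heis (theta - a).
Proof.
move=> [aPhi e]; have r : theta - a \in Phi.
  by rewrite -opprB; apply: (root_neg D); rewrite -[theta]mulr1z -e; apply: (cz_refl D).
by split=> //; rewrite (czB D) // e (czxx D).
Qed.

Lemma pos_nonorth_heis a : P a -> a != theta -> 0 < q a theta -> heis a.
Proof.
move=> aP ne h; have aPhi := ps_root DP aP; split=> //.
have := cz_theta_le1 aPhi ne; have : 0 < cz a theta by rewrite (cz_gt0 D).
by lia.
Qed.

Definition fundamental_root := exists2 a, simple P a &
  forall b, simple P b -> cz theta b = (b == a)%:Z.

Lemma simple_nonorth : exists2 a, simple P a & 0 < q theta a.
Proof.
have [s sS e] := simple_decomposition D DP theta_pos.
apply: contrapT => no; have := rs_pos D thPhi; rewrite {2}e (q_sumr D) ltNge.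
rewrite big_seq sumr_le0 // => x xs; rewrite leNgt; apply/negP => h.
by apply: no; exists x => //; apply: sS.
Qed.

Lemma simple_cz_ge0 s x : simple_list P s -> x \in s -> 0 <= cz x theta.
Proof. by move=> sS /sS [xP _]; apply: cz_theta_ge0. Qed.

Lemma orth_coef0 a v : 0 < q theta a -> v \in Phi -> q v theta = 0 -> coef P a v 0.
Proof.
move=> ath; have pos w : P w -> q w theta = 0 -> coef P a w 0.
  move=> wP w0; have [s sS e] := simple_decomposition D DP wP.
  have := coef_list a sS; rewrite -e; suff -> : count_mem a s = 0%N by [].
  apply/count_memPn/negP=> as_.
  have := sum_ge0_eq0 (s := s) (f := fun x => q x theta) _ _ as_.
  rewrite -(q_suml D) -e w0 qC => h.
  by move: ath; rewrite h ?ltxx // => x /sS[xP _]; rewrite qC theta_dom.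
move=> vPhi v0; case: (ps_total DP vPhi) => [vP|nvP]; first exact: pos.
rewrite -[v]opprK -[0]oppr0; apply: coefN; apply: pos => //.
by rewrite (qNl D) v0 oppr0.
Qed.

Section Orth.
Variable S : seq V.
Hypothesis SPhi : {subset S <= Phi}.
Hypothesis oS : orthogonal_seq q (theta :: S).
Hypothesis strong : forall b c, b \in S -> c \in S -> b != c -> b + c \notin Phi.

Let oS' := orthogonal_seq_cons oS.
Let thS := orthogonal_seq_head oS.
Let SthPhi : {subset theta :: S <= Phi}.
Proof. by move=> x /[!inE] /predU1P[->|/SPhi]. Qed.

(** The degree of the root space of [a] for the grading defined by the sum of
    the coroots of [theta] and of the elements of [S]. *)
Definition thdeg a : int := cz a theta + \sum_(b <- S) cz a b.

Lemma thdegD a b : a \in Phi -> b \in Phi -> a + b \in Phi -> thdeg (a + b) = thdeg a + thdeg b.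
Proof.
move=> aP bP abP; rewrite /thdeg (czD D) // addrACA; congr (_ + _).
by rewrite -big_split; apply: eq_big_seq => c cS; rewrite (czD D (SPhi cS)).
Qed.

Lemma thdegN a : a \in Phi -> thdeg (- a) = - thdeg a.
Proof.
move=> aP; rewrite /thdeg (czN D) // opprD -sumrN; congr (_ + _).
by apply: eq_big_seq => c cS; rewrite (czN D (SPhi cS)).
Qed.

Lemma thdegB a b : a \in Phi -> b \in Phi -> a - b \in Phi -> thdeg (a - b) = thdeg a - thdeg b.
Proof. by move=> aP bP abP; rewrite thdegD ?thdegN ?(root_neg D). Qed.

Lemma thdeg_theta : thdeg theta = 2.
Proof.
rewrite /thdeg (czxx D) // big_seq big1 ?addr0 // => b bS.
by apply/eqP; rewrite (cz_eq0 D (SPhi bS) thPhi) thS.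
Qed.

Lemma thdeg_le4 a : a \in Phi -> thdeg a <= 4.
Proof.
move=> aP; have := bessel_sum_le4 D SthPhi oS aP.
by rewrite big_cons.
Qed.

Let w := refl q S.

Lemma w_root a : a \in Phi -> w a \in Phi.
Proof. exact: (refl_root D). Qed.

Lemma w_theta a : a \in Phi -> cz (w a) theta = cz a theta.
Proof.
move=> aP; apply: (cz_unique D) => //; first exact: w_root.
by rewrite /w (q_refl_out D) ?(czE D) // => b bS; rewrite qC thS.
Qed.

Section Core.
Variable gam : V.
Hypothesis gH : heis gam.
Hypothesis g2 : 2 <= \sum_(b <- S) cz gam b.

(** [2 (gam, w gam)] is [(gam, gam)] times [2] minus the Bessel sum of [gam]
    over [S]. *)
Lemma core_obtuse : q gam (w gam) <= 0.
Proof.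
have gPhi := gH.1; rewrite /w /refl (qBr D) (q_sumr D).
have e : 2 * \sum_(b <- S) q gam (b *~ cz gam b) =
    (\sum_(b <- S) cz gam b * cz b gam)%:~R * q gam gam.
  rewrite mulr_sumr rmorph_sum mulr_suml; apply: eq_big_seq => b bS.
  rewrite (qMzr D) /= intrM -mulrA -(czE D gPhi (SPhi bS)) (qC b); ring.
have : 2 <= \sum_(b <- S) cz gam b * cz b gam.
  apply: le_trans g2 _; rewrite big_seq [leRHS]big_seq; apply: ler_sum => b bS.
  by apply: (cz_le_mul D) => //; apply: SPhi.
rewrite -(ler_int F) -(ler_pM2r (rs_pos D gPhi)) -e => h.
by move: h; rewrite subr_le0 ler_pM2l.
Qed.

(** [theta - w gam] is a root at an acute angle with [gam]. *)
Lemma core_sum : gam + w gam - theta = 0 \/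
  gam + w gam - theta \in Phi /\ q (gam + w gam - theta) theta = 0.
Proof.
have wH : heis (w gam) by split; rewrite ?w_root ?w_theta //; case: gH.
have [dPhi _] := heis_dual wH.
have e : gam + w gam - theta = gam - (theta - w gam).
  by rewrite (opprB theta (w gam)) [RHS]addrA.
have [gd|gd] := eqVneq gam (theta - w gam); first by left; rewrite e -gd subrr.
right; split.
  rewrite e; apply: (root_sub D) => //; first exact: gH.1.
  rewrite (qBr D); have := core_obtuse; have := heis_gt0 gH; lra.
rewrite (qBl D) (rs_add D); have h1 := czE D thPhi gH.1; have h2 := czE D thPhi wH.1.
rewrite gH.2 wH.2 in h1 h2; lra.
Qed.

(** The simple root [a1] has coefficient [1] in [theta], and the same coefficient
    [z] in [gam] and [w gam]; so it has coefficient [2 z - 1 <> 0] in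
    [gam + w gam - theta], which is orthogonal to [theta]. *)
Lemma two_neighbours_absurd a1 a2 : simple P a1 -> simple P a2 -> a1 != a2 ->
  0 < q theta a1 -> 0 < q theta a2 -> False.
Proof.
move=> s1 s2 ne p1 p2.
have ge1 a : simple P a -> 0 < q theta a -> 1 <= cz a theta.
  move=> sa pa; suff : 0 < cz a theta by lia.
  by rewrite (cz_gt0 D) ?(ps_root DP sa.1) // qC.
have [s sS e] := simple_decomposition D DP theta_pos.
have inS a : simple P a -> a \in s.
  move=> sa; have [s' sS' e'] := nonneg_simple (hth (ps_root DP sa.1)).
  have /perm_mem -> : perm_eq s (a :: s').
    apply: (simple_sum_inj D DP) => //.
      by move=> x /[!inE] /predU1P[->|/sS'].
    by rewrite big_cons -e' -e addrC subrK.
  by rewrite mem_head.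
have c1 : coef P a1 theta 1.
  have := coef_list a1 sS; rewrite -e; suff -> : count_mem a1 s = 1%N by [].
  have : (count_mem a1 s)%:Z + (count_mem a2 s)%:Z <= 2.
    rewrite !count_mem_sum -big_split -(czxx D thPhi).
    rewrite (cz_sum D thPhi thPhi (simple_list_root DP sS) e).
    rewrite big_seq [leRHS]big_seq; apply: ler_sum => x xs /=.
    have [->|x1] := eqVneq x a1; first by rewrite (negPf ne); have := ge1 _ s1 p1; lia.
    have [->|x2] := eqVneq x a2; first by have := ge1 _ s2 p2; lia.
    by rewrite addr0 (simple_cz_ge0 sS).
  have h1 : (0 < count_mem a1 s)%N by rewrite -has_count has_pred1 inS.
  have h2 : (0 < count_mem a2 s)%N by rewrite -has_count has_pred1 inS.
  by lia.
have [z zc] : exists z, coef P a1 gam z.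
  have [t tS te] := simple_decomposition D DP (heis_pos gH).
  by exists (count_mem a1 t); rewrite te; apply: coef_list.
have zw : coef P a1 (w gam) z.
  rewrite /w /refl -[z]subr0; apply: coefD => //; apply: coefN.
  rewrite big_seq; elim/big_rec: _ => [|b v bS IH]; first exact: coef0.
  rewrite -[0](addr0 0); apply: coefD => //; apply/coefMz/orth_coef0 => //.
    exact: SPhi.
  by rewrite qC thS.
have : coef P a1 (gam + w gam - theta) (z + z - 1).
  by apply: coefD; [apply: coefD | apply: coefN].
have c0 : coef P a1 (gam + w gam - theta) 0.
  by case: core_sum => [->|[r r0]]; [apply: coef0 | apply: orth_coef0].
by move/(coef_fun D DP c0); lia.
Qed.

End Core.

(** Among the roots of [heis] the simple one is longest: a reflection in another
    simple root lowers [gam] without changing its length, unless [gam] is at an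
    obtuse angle with all of these, and then [(gam, gam) <= (gam, a)]. *)
Lemma heis_short a : simple P a -> (forall b, simple P b -> b != a -> q theta b = 0) ->
  0 < q theta a -> forall gam, heis gam -> 2 <= cz theta a -> 2 <= cz theta gam.
Proof.
move=> sa uniq_a pa gam gH a2.
have aPhi := ps_root DP sa.1.
have cnt s v : heis v -> simple_list P s -> v = \sum_(x <- s) x ->
    (count_mem a s)%:Z * cz a theta = 1.
  move=> vH sS e; rewrite -vH.2 (cz_sum D thPhi vH.1 (simple_list_root DP sS) e).
  rewrite count_mem_sum mulr_suml; apply: eq_big_seq => x xs.
  have [->|xa] := eqVneq x a; first by rewrite mul1r.
  rewrite mul0r; apply/esym/eqP; rewrite (cz_eq0 D thPhi (simple_list_root DP sS xs)).
  by rewrite qC uniq_a //; apply: sS.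
have [s0 sS0 e0] := simple_decomposition D DP (heis_pos gH).
have aH : cz a theta = 1.
  have : 0 < cz a theta by rewrite (cz_gt0 D) // qC.
  have := cnt _ _ gH sS0 e0; move: (cz a theta) (count_mem a s0) => c [|k] h c0; first by rewrite mul0r in h.
  have : 0 <= k%:Z * c by rewrite mulr_ge0 // ltW.
  by rewrite -addn1 PoszD mulrDl mul1r in h; lia.
have key n : forall s v, (size s <= n)%N -> heis v -> simple_list P s ->
    v = \sum_(x <- s) x -> q v v <= q a a.
  elim: n => [|n IH] s v sn vH sS e.
    move: sn e; rewrite leqn0 size_eq0 => /eqP ->; rewrite big_nil => e.
    by move: (rs_neq0 D); rewrite -e vH.1.
  have vPhi := vH.1.
  have [[b [bs ba vb]]|no] := pselect (exists b, [/\ b \in s, b != a & 0 < q v b]).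
    have bPhi := simple_list_root DP sS bs.
    have bth : cz b theta = 0.
      by apply/eqP; rewrite (cz_eq0 D) // qC uniq_a //; apply: sS.
    pose v' := v - b *~ cz v b.
    have v'Phi : v' \in Phi by apply: (cz_refl D).
    have v'H : heis v'.
      split=> //; rewrite -vH.2; apply: (cz_unique D) => //.
      rewrite /v' (qBl D) (qMzl D) -(czE D thPhi vPhi).
      by have := czE D thPhi bPhi; rewrite bth mul0r => h; nra.
    have v'n : q v' v' = q v v.
      rewrite /v' (qBl D) !(qBr D) !(qMzl D) !(qMzr D) (qC b v).
      by have h := czE D bPhi vPhi; have := rs_pos D bPhi; nra.
    have [s' sS' e'] := simple_decomposition D DP (heis_pos v'H).
    rewrite -v'n; apply: (IH s') => //.
    have vb0 : 0 < cz v b by rewrite (cz_gt0 D).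
    have [k kE] : exists k : nat, cz v b = k.+1 by exists (`|cz v b| - 1)%N; lia.
    have /perm_size : perm_eq s (s' ++ nseq k.+1 b).
      apply: (simple_sum_inj D DP) => //.
        apply: simple_list_cat => // x; rewrite mem_nseq => /andP[_ /eqP ->]; exact: sS.
      rewrite big_cat /= -e -e' /v' kE -[b *~ _]/(b *+ k.+1).
      have ns m : \sum_(x <- nseq m b) x = b *+ m.
        by elim: m => [|m IHm]; rewrite ?big_nil //= big_cons IHm mulrS.
      by rewrite -[b :: _]/(nseq k.+1 b) ns subrK.
    move=> sz; move: sn; rewrite sz size_cat size_nseq addnS ltnS.
    exact/leq_trans/leq_addr.
  have le : q v v <= (count_mem a s)%:R * q v a.
    rewrite {2}e (q_sumr D) [(_)%:R]pmulrn count_mem_sum rmorph_sum mulr_suml.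
    rewrite big_seq [leRHS]big_seq; apply: ler_sum => x xs.
    case: eqVneq => [->|xa]; first by rewrite mul1r.
    by rewrite mul0r leNgt; apply/negP => h; apply: no; exists x.
  have c1 : count_mem a s = 1%N by have := cnt _ _ vH sS e; rewrite aH; lia.
  rewrite c1 mul1r in le.
  have : in_lattice Phi (v - a) by apply: (latticeB D); apply: lattice_root.
  move/(lattice_ge0 D); rewrite (qBl D) !(qBr D) (qC a v); lra.
have le := key _ _ _ (leqnn _) gH sS0 e0.
have h1 := czE D gH.1 thPhi; have h2 := czE D aPhi thPhi.
have h3 := czE D thPhi gH.1; have h4 := czE D thPhi aPhi.
rewrite gH.2 in h3; rewrite aH in h4; rewrite (qC gam) in h3; rewrite (qC a) in h4.
have pg := rs_pos D gH.1; have pA := rs_pos D aPhi.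
have : (cz theta a)%:~R * q a a <= (cz theta gam)%:~R * q a a :> F.
  rewrite -h2 h4 -h3 h1; apply: ler_wpM2l => //.
  rewrite ler0z leNgt (cz_lt0 D) ?gH.1 // -leNgt; have := heis_gt0 gH.
  by rewrite qC; apply: ltW.
by rewrite ler_pM2r // ler_int; lia.
Qed.

Lemma sum_two (n : V -> int) (s : seq V) : uniq s -> (forall b, b \in s -> 0 <= n b) ->
  \sum_(b <- s) n b = 2 ->
  (exists2 b, b \in s & \sum_(b <- s) b *~ n b = b *+ 2) \/
  (exists b c, [/\ b \in s, c \in s, b != c & \sum_(b <- s) b *~ n b = b + c]).
Proof.
move=> us n0 e.
have zero r : (forall b, b \in r -> 0 <= n b) -> \sum_(b <- r) n b = 0 ->
    \sum_(b <- r) b *~ n b = 0.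
  move=> r0 re; rewrite big_seq big1 // => b br.
  by rewrite (sum_ge0_eq0 r0 re br) mulr0z.
have ex r : (forall b, b \in r -> 0 <= n b) -> 0 < \sum_(b <- r) n b ->
    exists2 b, b \in r & 0 < n b.
  move=> r0; apply: contraPP => no; apply/negP; rewrite -leNgt big_seq sumr_le0 //.
  by move=> b br; rewrite leNgt; apply/negP => h; apply: no; exists b.
have [|b bs nb] := ex s n0; first by rewrite e.
have rb0 c : c \in rem b s -> 0 <= n c by move=> /mem_rem /n0.
have eb : n b + \sum_(c <- rem b s) n c = 2 by rewrite -e (big_rem b bs).
have [R RE] : exists R, R = \sum_(c <- rem b s) n c by eexists.
rewrite -RE in eb.
have [n2|n2] := eqVneq (n b) 2.
  have r0 : \sum_(c <- rem b s) n c = 0 by rewrite -RE; lia.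
  by left; exists b => //; rewrite (big_rem b bs) /= n2 (zero _ rb0 r0) addr0.
have rge : 0 <= R by rewrite RE big_seq; apply: sumr_ge0.
have n1 : n b = 1 by lia.
have r1 : \sum_(c <- rem b s) n c = 1 by rewrite -RE; lia.
have [|c cs nc] := ex _ rb0; first by rewrite r1.
have [R' R'E] : exists R, R = \sum_(d <- rem c (rem b s)) n d by eexists.
rewrite (big_rem c cs) /= -R'E in r1.
have rge' : 0 <= R'.
  by rewrite R'E big_seq; apply: sumr_ge0 => d /mem_rem; apply: rb0.
right; exists b, c; split=> //; first exact: mem_rem cs.
  by apply: contraTneq cs => <-; rewrite mem_rem_uniq // inE eqxx.
have n1' : n c = 1 by lia.
have r0 : \sum_(d <- rem c (rem b s)) n d = 0 by rewrite -R'E; lia.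
rewrite (big_rem b bs) /= n1 (big_rem c cs) /= n1' zero ?addr0 //.
by move=> d /mem_rem; apply: rb0.
Qed.

(** Two simple roots not orthogonal to [theta] are excluded by the coefficients
    in [gam + w gam - theta]. If [a] is the only one and [(theta, a^vee) >= 2],
    Bessel's inequality for [gam] is an equality, and the image of [theta] under
    the reflection in [gam] shows that [\sum_S b (gam, b^vee)] is a root; it is
    twice an element of [S] or the sum of two of them. *)
Lemma core_fundamental gam : heis gam -> 2 <= \sum_(b <- S) cz gam b ->
  fundamental_root.
Proof.
move=> gH g2; have gPhi := gH.1.
have [a sa pa] := simple_nonorth; have aPhi := ps_root DP sa.1.
have [[b [sb ba pb]]|no] := pselect (exists b, [/\ simple P b, a != b & 0 < q theta b]).
  by case: (two_neighbours_absurd gH g2 sa sb ba pa pb).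
have uniq_a b : simple P b -> b != a -> q theta b = 0.
  move=> sb ba; apply: le_anti; rewrite (theta_dom sb.1) andbT leNgt.
  by apply/negP=> h; apply: no; exists b; rewrite eq_sym.
have a0 : 0 < cz theta a by rewrite (cz_gt0 D).
have [a1|a1] := eqVneq (cz theta a) 1.
  exists a => // b sb; have [->|ba] := eqVneq b a; first by [].
  by apply/eqP; rewrite (cz_eq0 D) ?uniq_a // (ps_root DP sb.1).
have a2 : 2 <= cz theta a by lia.
exfalso; have gs := heis_short sa uniq_a pa gH a2.
have [le eqB] := bessel D SthPhi oS gPhi.
rewrite !big_cons gH.2 mul1r mulr1z in le eqB.
have nm b : b \in S -> cz gam b <= cz gam b * cz b gam.
  by move=> bS; apply: (cz_le_mul D) => //; apply: SPhi.
have sle : \sum_(b <- S) cz gam b <= \sum_(b <- S) cz gam b * cz b gam.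
  by rewrite big_seq [leRHS]big_seq; apply: ler_sum.
have squeeze (x y z : int) :
  2 <= x -> 2 <= y -> y <= z -> x + z <= 4 -> [/\ x = 2, y = 2 & z = 2] by split; lia.
have [e2 s2 sp] := squeeze _ _ _ gs g2 sle le.
have {}eqB := eqB (eq_trans (congr2 +%R e2 sp) erefl).
have rPhi : \sum_(b <- S) b *~ cz gam b \in Phi.
  have := root_neg D (cz_refl D gPhi thPhi); rewrite e2 -[gam *~ 2]/(gam *+ 2) eqB.
  by rewrite opprB addrC addKr.
have n0 b : b \in S -> 0 <= cz gam b.
  move=> bS; have e : cz gam b * cz b gam - cz gam b = 0.
    have := sum_ge0_eq0 (s := S) (f := fun b => cz gam b * cz b gam - cz gam b).
    move=> /(_ _ _ _ bS); apply; last by rewrite sumrB sp s2.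
    by move=> c cS; rewrite subr_ge0 nm.
  rewrite leNgt; apply/negP => h; have h' := h.
  rewrite (cz_lt0 D (SPhi bS) gPhi) (qC gam) -(cz_lt0 D gPhi (SPhi bS)) in h'; nia.
case: (sum_two oS'.1 n0 s2) => [[b bS e]|[b [c [bS cS bc e]]]]; rewrite e in rPhi.
  by have := rs_double D (SPhi bS); rewrite rPhi.
by have := strong bS cS bc; rewrite rPhi.
Qed.

(** The roots of [heis] have degree in [[0, 2]], by [core_fundamental] and the
    symmetry [gam -> theta - gam]; a root orthogonal to [theta] has a neighbour
    in [heis], hence is a difference of two members of [heis]. *)
Lemma thdeg_le2 : ~ fundamental_root -> forall a, a \in Phi -> thdeg a <= 2.
Proof.
move=> nf.
have up g : heis g -> thdeg g <= 2.
  move=> gH; rewrite /thdeg gH.2 leNgt; apply/negP=> h; apply: nf.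
  by apply: (core_fundamental gH); lia.
have lo g : heis g -> 0 <= thdeg g.
  move=> gH; have := up _ (heis_dual gH).
  by rewrite thdegB ?gH.1 ?(heis_dual gH).1 // thdeg_theta; lia.
have nheis g : g \in Phi -> q g theta != 0 -> g != theta -> g != - theta ->
    heis g \/ heis (- g).
  move=> gPhi g0 g1 g2; case: (ps_total DP gPhi) => gP; [left|right]; apply: pos_nonorth_heis => //.
  - by rewrite lt_def g0 qC theta_dom.
  - by rewrite eqr_oppLR.
  by rewrite lt_def (qNl D) oppr_eq0 g0 qC -(qNr D) theta_dom.
move=> a aPhi.
have [at0|at0] := eqVneq (q a theta) 0; last first.
  have [->|a1] := eqVneq a theta; first by rewrite thdeg_theta.
  have [->|a2] := eqVneq a (- theta); first by rewrite thdegN // thdeg_theta.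
  case: (nheis _ aPhi at0 a1 a2) => [/up //|/lo].
  by rewrite thdegN //; lia.
have [m [mPhi mt ma]] := common_neighbour D (subsystem_roots Phi) roots_irreducible thPhi aPhi at0.
have [m' [m'H m'a]] : exists m, heis m /\ q m a != 0.
  have m1 : m != theta by apply: contraNneq ma => ->; rewrite qC at0.
  have m2 : m != - theta by apply: contraNneq ma => ->; rewrite (qNl D) qC at0 oppr0.
  case: (nheis _ mPhi mt m1 m2) => h; first by exists m.
  by exists (- m); rewrite (qNl D) oppr_eq0.
have am : a != m' by apply: contra_eq_neq at0 => ->; rewrite gt_eqF // heis_gt0.
have amN : a != - m'.
  by apply: contra_eq_neq at0 => ->; rewrite (qNl D) oppr_eq0 gt_eqF // heis_gt0.
have [m'Phi m'c] := m'H.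
case: (ltgtP (q m' a) 0) m'a => // h _.
  have r : m' + a \in Phi by apply: (root_add D) => //; rewrite -eqr_oppLR eq_sym.
  have rH : heis (m' + a).
    split=> //; rewrite (czD D) // m'c; have /eqP -> : cz a theta == 0 by rewrite (cz_eq0 D) // at0.
    by rewrite addr0.
  by have := up _ rH; have := lo _ m'H; rewrite thdegD //; lia.
have r : m' - a \in Phi by apply: (root_sub D) => //; rewrite eq_sym.
have rH : heis (m' - a).
  split=> //; rewrite (czB D) // m'c; have /eqP -> : cz a theta == 0 by rewrite (cz_eq0 D) // at0.
  by rewrite subr0.
by have := lo _ rH; have := up _ m'H; rewrite thdegB //; lia.
Qed.
End Orth.
End HighestRoot.

(** * The case of a fundamental highest root *)

Section FundamentalHighestRoot.
Variables (F : realFieldType) (V : zmodType) (q : V -> V -> F) (Phi : seq V).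
Variable P : V -> Prop.
Hypothesis D : root_system q Phi.
Hypothesis DP : positive_system Phi P.
Variable theta : V.
Hypothesis thPhi : theta \in Phi.
Hypothesis hth : forall a, a \in Phi -> nonneg P (theta - a).
Variable S : seq V.
Hypothesis SP : forall b, b \in S -> P b.
Hypothesis oS : orthogonal_seq q (theta :: S).
Hypothesis neg : forall a, P a -> P (- refl q (theta :: S) a).
Variable al : V.
Hypothesis sal : simple P al.
Hypothesis fal : forall b, simple P b -> cz q theta b = (b == al)%:Z.

Local Notation cz := (cz q).
Let qC := rs_sym D.
Let SPhi : {subset S <= Phi}.
Proof. by move=> b /SP /(ps_root DP). Qed.
Let alPhi := ps_root DP sal.1.
Let thS := orthogonal_seq_head oS.
Let w := refl q S.

Lemma fund_cz : cz theta al = 1.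
Proof. by rewrite fal // eqxx. Qed.

Lemma fund_neq : al != theta.
Proof. by apply/eqP=> e; have := fund_cz; rewrite e (czxx D). Qed.

Lemma fund_heis : heis q Phi theta al.
Proof.
apply: (pos_nonorth_heis D DP thPhi hth) => //; first exact: sal.1.
  exact: fund_neq.
by rewrite qC -(cz_gt0 D) // fund_cz.
Qed.

Lemma fund_simple_orth b : simple P b -> b != al -> q theta b = 0.
Proof.
move=> sb ba; apply/eqP; rewrite -(cz_eq0 D) ?(ps_root DP sb.1) //.
by rewrite fal // (negPf ba).
Qed.

Lemma fund_norm : q al al = q theta theta.
Proof.
have h1 := czE D alPhi thPhi; have h2 := czE D thPhi alPhi.
by rewrite fund_cz in h1; rewrite fund_heis.2 (qC al) h1 !mul1r in h2.
Qed.

(** [al] has Cartan integer [1] at [theta], all other simple roots [0]. *)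
Lemma fund_count v s : v \in Phi -> simple_list P s -> v = \sum_(x <- s) x ->
  cz v theta = count_mem al s.
Proof.
move=> vPhi sS e; rewrite (cz_sum D thPhi vPhi (simple_list_root DP sS) e).
rewrite count_mem_sum; apply: eq_big_seq => x xs.
have [->|xa] := eqVneq x al; first by rewrite fund_heis.2.
apply/eqP; rewrite (cz_eq0 D thPhi (simple_list_root DP sS xs)) qC.
by rewrite fund_simple_orth //; apply: sS.
Qed.

Lemma neg_orth x : P x -> q x theta = 0 -> P (- w x).
Proof.
move=> xP x0; have := neg xP; rewrite /refl big_cons.
have /eqP -> : cz x theta == 0 by rewrite (cz_eq0 D) ?x0 // (ps_root DP).
by rewrite mulr0z add0r.
Qed.

(** The product of the reflections in [S] is the longest element of the Weyl
    group of the roots orthogonal to [theta]; it therefore exchanges the lowest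
    and the highest root among those with Cartan integer [1] at [theta]. *)
Lemma longest_on_simple : theta - w al = al.
Proof.
have oS' := orthogonal_seq_cons oS.
have wPhi : w al \in Phi by apply: (refl_root D).
have wth : cz (w al) theta = 1.
  rewrite -fund_heis.2; apply: (cz_unique D) => //.
  by rewrite /w (q_refl_out D) ?(czE D) // => b bS; rewrite qC thS.
have [dPhi d1] := heis_dual D thPhi (conj wPhi wth).
have [s sS e] := simple_decomposition D DP (heis_pos D DP thPhi hth (conj dPhi d1)).
have c1 : count_mem al s = 1%N.
  by have := fund_count dPhi sS e; rewrite d1 => -[].
have als : al \in s by rewrite -has_pred1 has_count c1.
set s' := rem al s.
have {}e : theta - w al = al + \sum_(x <- s') x by rewrite e (big_rem al als).
have sS' : simple_list P s' by move=> x /mem_rem; apply: sS.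
have s'al x : x \in s' -> x != al.
  move=> xs; apply/eqP=> xa; have : (0 < count_mem al s')%N.
    by rewrite -has_count has_pred1 -xa.
  by have /permP/(_ (pred1 al)) := perm_to_rem als; rewrite /= eqxx c1 -/s'; lia.
have orth x : x \in s' -> q x theta = 0.
  by move=> xs; rewrite qC fund_simple_orth ?s'al //; apply: sS'.
have dS b : b \in S -> \sum_(x <- s') cz x b = 0.
  move=> bS; have bPhi := SPhi bS.
  have : cz (theta - w al) b = cz al b.
    apply: (cz_unique D) => //.
    rewrite (qBl D) thS // (q_refl_in D SPhi oS' alPhi bS) sub0r opprK.
    by rewrite (czE D).
  rewrite (cz_sum (s := al :: s') D bPhi dPhi); last first.
  - by rewrite big_cons.
  - by move=> x /[!inE] /predU1P[->//|/(simple_list_root DP sS')].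
  by rewrite big_cons => h; apply: (addrI (cz al b)); rewrite h addr0.
have ws : \sum_(x <- s') w x = \sum_(x <- s') x.
  rewrite /w /refl sumrB exchange_big /= [X in _ - X]big_seq [X in _ - X]big1 ?subr0 //.
  by move=> b bS; rewrite -mulrz_sumr dS // mulr0z.
have : s' ++ [seq - w x | x <- s'] = [::].
  apply: (pos_sum_eq0 D DP); last by rewrite big_cat big_map /= sumrN ws subrr.
  apply: pos_list_cat; first exact: simple_list_pos sS'.
  by move=> _ /mapP[x xs ->]; apply: neg_orth (orth _ xs); case: (sS' _ xs).
by move: e; case: (s') => // -> _; rewrite big_nil addr0.
Qed.

(** By [longest_on_simple], [al] is half of [theta + \sum_S b (al, b^vee)], so
    the Bessel sum of [al] over [S] is [3]. Since [al] is as long as [theta], the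
    Cartan integers [(b, al^vee)] are [0] or [-1]. *)
Lemma fund_thdeg : thdeg q theta S al = -2.
Proof.
have e2 : al *+ 2 = theta + \sum_(b <- S) b *~ cz al b.
  have := longest_on_simple; rewrite /w /refl opprB addrCA addrC => h.
  by rewrite mulr2n -{1}h addrAC subrK.
have np b : b \in S -> q al b <= 0.
  move=> bS; have [s sS bE] := simple_decomposition D DP (SP bS).
  have bth : cz b theta = 0.
    by apply/eqP; rewrite (cz_eq0 D thPhi (SPhi bS)) qC thS.
  have als : al \notin s.
    apply/count_memPn; have := fund_count (SPhi bS) sS bE.
    by rewrite bth => -[].
  rewrite bE (q_sumr D) big_seq; apply: sumr_le0 => x xs.
  apply: (simple_obtuse D DP sal (sS _ xs)); apply: contraNneq als => -> //.
have pa := rs_pos D alPhi.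
have s3 : \sum_(b <- S) cz al b * cz b al = 3.
  have : q (al *+ 2) al = q (theta + \sum_(b <- S) b *~ cz al b) al by rewrite e2.
  rewrite (qMnl D) (rs_add D) (q_suml D) => E.
  have : (\sum_(b <- S) cz al b * cz b al)%:~R * q al al =
      2 * \sum_(b <- S) q (b *~ cz al b) al.
    rewrite rmorph_sum mulr_suml mulr_sumr; apply: eq_big_seq => b bS.
    by rewrite /= intrM (qMzl D) -mulrA -(czE D alPhi (SPhi bS)); ring.
  have h1 := czE D alPhi thPhi; rewrite fund_cz in h1.
  have -> : 2 * (\sum_(b <- S) q (b *~ cz al b) al) = 3%:~R * q al al by lra.
  by move/(mulIf (lt0r_neq0 pa))/eqP; rewrite eqr_int => /eqP.
have nm b : b \in S -> cz al b * cz b al = - cz al b.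
  move=> bS; have bPhi := SPhi bS.
  have nle : cz al b <= 0 by rewrite leNgt (cz_gt0 D) // -leNgt np.
  have mle : cz b al <= 0 by rewrite leNgt (cz_gt0 D) // qC -leNgt np.
  have le3 : cz al b * cz b al <= 3.
    rewrite -s3 (big_rem b bS) /= lerDl big_seq; apply: sumr_ge0 => c /mem_rem cS.
    have cPhi := SPhi cS; apply: mulr_le0.
      by rewrite leNgt (cz_gt0 D) // -leNgt np.
    by rewrite leNgt (cz_gt0 D) // qC -leNgt np.
  have n0 : (cz al b == 0) = (cz b al == 0) by rewrite !(cz_eq0 D) // qC.
  have [m0|m0] := eqVneq (cz b al) 0.
    by move: n0; rewrite m0 eqxx => /eqP ->; rewrite mul0r oppr0.
  rewrite (negPf m0) in n0.
  have [m1|m1] := eqVneq (cz b al) (-1); first by rewrite m1 mulrN1.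
  exfalso.
  have m2 : cz b al <= -2 by lia.
  have nlt : cz al b < 0 by rewrite lt_def eq_sym n0 nle.
  have n1 : cz al b = -1 by nia.
  have r := cz_refl D alPhi bPhi.
  have bth : cz b theta = 0 by apply/eqP; rewrite (cz_eq0 D) // qC thS.
  have rE : b - al *~ cz b al = theta.
    apply/eqP; apply: contraT => ne.
    have := cz_theta_le1 D DP thPhi hth r ne; have : cz (b - al *~ cz b al) theta = - cz b al.
      apply: (cz_unique D) => //; rewrite (qBl D) (qMzl D) mulrNz.
      have h1 := czE D thPhi bPhi; have h2 := czE D thPhi alPhi.
      by rewrite bth fund_heis.2 in h1 h2; nra.
    by lia.
  have h1 := czE D bPhi alPhi; have h2 := czE D alPhi bPhi; rewrite n1 (qC b) in h1 h2.
  have h3 : q theta theta = q b b.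
    rewrite -rE (qBl D) !(qBr D) !(qMzl D) !(qMzr D) (qC b al); nra.
  rewrite -fund_norm in h3.
  have : (cz b al)%:~R <= (-2)%:~R :> F by rewrite ler_int.
  nra.
have sn : \sum_(b <- S) cz al b = -3.
  apply/eqP; rewrite -eqr_oppLR -sumrN -s3; apply/eqP; apply: eq_big_seq => b bS.
  by rewrite nm.
by rewrite /thdeg sn fund_heis.2.
Qed.

Lemma fund_lowest : - theta + al \in Phi /\ thdeg q theta S (- theta + al) = -4.
Proof.
have [r _] := heis_dual D thPhi fund_heis.
have e : - theta + al = - (theta - al) by rewrite opprB addrC.
split; rewrite e; first exact: (root_neg D r).
rewrite (thdegN D thPhi SPhi r) (thdegB D thPhi SPhi thPhi alPhi r) fund_thdeg.
by rewrite (thdeg_theta D thPhi SPhi oS).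
Qed.

End FundamentalHighestRoot.

(** * Highest roots and components *)

Section MaximalRoot.
Variables (F : realFieldType) (V : zmodType) (q : V -> V -> F) (Phi : seq V).
Variable P : V -> Prop.
Hypothesis D : root_system q Phi.
Hypothesis DP : positive_system Phi P.
Variable C : V -> Prop.
Hypothesis sC : subsystem Phi C.
Implicit Types (a b c v : V) (s : seq V).

Let qC := rs_sym D.
Let CPhi := sC.1.

Definition nonneg_in v := exists2 s, forall x, x \in s -> C x /\ P x
  & v = \sum_(x <- s) x.

Lemma nonneg_in_nonneg v : nonneg_in v -> nonneg P v.
Proof. by move=> [s h e]; exists s => // x /h []. Qed.

Lemma nonneg_in0 : nonneg_in 0.
Proof. by exists [::]; rewrite ?big_nil. Qed.

Lemma nonneg_in1 a : C a -> P a -> nonneg_in a.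
Proof. by move=> h1 h2; exists [:: a]; rewrite ?big_seq1 // => x /[!inE] /eqP ->. Qed.

Lemma nonneg_inD u v : nonneg_in u -> nonneg_in v -> nonneg_in (u + v).
Proof.
move=> [s h ->] [s' h' ->]; exists (s ++ s'); last by rewrite big_cat.
by move=> x; rewrite mem_cat => /orP[/h|/h'].
Qed.

Lemma sub_closed a b : C a -> C b -> a - b \in Phi -> C (a - b).
Proof. by move=> aC bC; have := sC.2 b a (-1) bC aC; rewrite mulrN1z. Qed.

Lemma add_closed a b : C a -> C b -> a + b \in Phi -> C (a + b).
Proof. by move=> aC bC; have := sC.2 b a 1 bC aC; rewrite mulr1z. Qed.

Definition highest b := C b /\ forall c, C c -> nonneg_in (b - c).

Lemma highest_pos b : highest b -> P b.
Proof.
move=> [bC h]; have nb := h _ (subsystem_neg D sC bC).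
case: (ps_total DP (CPhi bC)) => // nP; apply: (nonneg_root D DP); first exact: CPhi.
rewrite -[X in nonneg P X](subrK (- b)).
by apply: nonnegD; [apply: nonneg_in_nonneg | apply: nonneg_pos].
Qed.

Lemma highest_unique b c : highest b -> highest c -> b = c.
Proof.
move=> [bC hb] [cC hc]; apply/eqP; rewrite -subr_eq0; apply/eqP.
apply: (nonneg_anti D DP); first exact/nonneg_in_nonneg/hb.
by rewrite opprB; apply/nonneg_in_nonneg/hc.
Qed.

Lemma highest_dom b a : highest b -> C a -> P a -> 0 <= q b a.
Proof.
move=> hb aC aP; have [bC h] := hb; rewrite leNgt; apply/negP=> ba.
have r : b + a \in Phi.
  apply: (root_add D) => //; try exact: CPhi.
  apply/eqP=> e; apply: (ps_asym DP (a := a)); split=> //; rewrite -e.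
  exact: highest_pos.
have := nonneg_in_nonneg (h _ (add_closed bC aC r)).
by rewrite opprD addrA subrr add0r; apply: (nonneg_P_false D DP).
Qed.

Definition maximal b := [/\ C b, P b & forall a, C a -> P a -> b + a \notin Phi].

Lemma maximal_above c : C c -> exists2 b, maximal b & nonneg_in (b - c).
Proof.
have pos : forall a, C a -> P a -> exists2 b, maximal b & nonneg_in (b - a).
  pose rk a := count (fun d => `[< nonneg_in (d - a) >]) Phi.
  move=> a; move: {2}(rk a) (leqnn (rk a)) => n; elim: n a => [|n IH] a an aC aP.
    move: an; rewrite leqNgt -has_count => /hasPn/(_ _ (CPhi aC))/asboolP[].
    by rewrite subrr; apply: nonneg_in0.
  have [[x [xC xP r]]|no] := pselect (exists x, [/\ C x, P x & a + x \in Phi]).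
    have axC := add_closed aC xC r.
    have step u : u - a = u - (a + x) + x by rewrite opprD addrA subrK.
    have [||b bm bn] := IH (a + x) _ axC.
    - rewrite -ltnS; apply: leq_trans an; apply: (@count_lt _ _ _ _ a).
      + move=> d /asboolP dn; apply/asboolP; rewrite step.
        by apply: nonneg_inD => //; apply: nonneg_in1.
      + exact: CPhi.
      + by apply/asboolP; rewrite subrr; apply: nonneg_in0.
      apply/asboolP; rewrite opprD addrA subrr add0r => /nonneg_in_nonneg.
      exact: (nonneg_P_false D DP).
    - by apply: (ps_closed DP).
    by exists b => //; rewrite step; apply: nonneg_inD => //; apply: nonneg_in1.
  exists a; last by rewrite subrr; apply: nonneg_in0.
  by split=> // x xC xP; apply/negP=> r; apply: no; exists x.
move=> cC; case: (ps_total DP (CPhi cC)) => cP; first exact: pos.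
have ncC := subsystem_neg D sC cC; have [b bm bn] := pos _ ncC cP.
exists b => //; rewrite opprK in bn.
have -> : b - c = (b + c) + (- c + - c) by rewrite addrA addrK.
by apply: nonneg_inD bn _; apply: nonneg_inD; apply: nonneg_in1.
Qed.

Lemma maximal_dom b a : maximal b -> C a -> P a -> 0 <= q b a.
Proof.
move=> [bC bP h] aC aP; rewrite leNgt; apply/negP=> ba.
have /negP[] := h _ aC aP; apply: (root_add D) => //; try exact: CPhi.
by apply/eqP=> e; apply: (ps_asym DP (a := a)); split=> //; rewrite -e.
Qed.

Hypothesis irr : q_irreducible q C.

(** Two maximal roots would be dominant and orthogonal, but a common neighbour
    [c > 0] of them gives [(b', b - c) < 0] with [b - c] positive. *)
Lemma maximal_unique b b' : maximal b -> maximal b' -> b = b'.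
Proof.
move=> mb mb'; have [bC bP hb] := mb; have [bC' bP' hb'] := mb'.
apply/eqP; apply: contraT => ne.
have o : q b' b = 0.
  apply: le_anti; rewrite (maximal_dom mb') // andbT leNgt; apply/negP=> h.
  have r : b' - b \in Phi by apply: (root_sub D); rewrite ?CPhi // eq_sym.
  have rC := sub_closed bC' bC r.
  case: (ps_total DP r) => rP; first by have := hb _ rC rP; rewrite addrC subrK CPhi.
  have := hb' _ (subsystem_neg D sC rC) rP.
  by rewrite opprB addrC subrK CPhi.
have [c [cC cb cb']] := common_neighbour D sC irr bC bC' o.
have [c' [c'C c'P c'b c'b']] : exists c, [/\ C c, P c, q b c != 0 & q b' c != 0].
  case: (ps_total DP (CPhi cC)) => cP.
    by exists c; rewrite (qC b) (qC b').
  exists (- c); split=> //; first exact: (subsystem_neg D sC cC).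
    by rewrite (qNr D) oppr_eq0 qC.
  by rewrite (qNr D) oppr_eq0 qC.
have p : 0 < q b c' by rewrite lt_def c'b maximal_dom.
have p' : 0 < q b' c' by rewrite lt_def c'b' maximal_dom.
have bc : b != c' by apply: contraNneq c'b' => <-; rewrite o.
have r : b - c' \in Phi by apply: (root_sub D) => //; exact: CPhi.
have rC := sub_closed bC c'C r.
case: (ps_total DP r) => rP.
  have := maximal_dom mb' rC rP.
  by rewrite (qBr D) o sub0r oppr_ge0 => h; have := lt_le_trans p' h; rewrite ltxx.
have := hb _ (subsystem_neg D sC rC) rP.
by rewrite opprB addrC subrK CPhi.
Qed.

Lemma highest_exists c : C c -> exists b, highest b.
Proof.
move=> cC; have [b bm _] := maximal_above cC; exists b; split; first by case: bm.
by move=> x /maximal_above[b' b'm]; rewrite (maximal_unique bm b'm).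
Qed.

End MaximalRoot.

Section Component.
Variables (F : realFieldType) (V : zmodType) (q : V -> V -> F) (Phi : seq V).
Hypothesis D : root_system q Phi.
Variable Psi : V -> Prop.
Hypothesis sPsi : subsystem Phi Psi.
Let qC := rs_sym D.

Definition q_component (C : V -> Prop) :=
  [/\ forall a, C a -> Psi a, exists a, C a, q_irreducible q C
    & forall a b, C a -> Psi b -> ~ C b -> q a b = 0].

Lemma component_subsystem C : q_component C -> subsystem Phi C.
Proof.
move=> [CPsi _ _ oC]; split=> [a /CPsi /sPsi.1 //|a b k aC bC r].
apply: contrapT => nC; have rPsi : Psi (b + a *~ k).
  by apply: sPsi.2 => //; apply: CPsi.
have : q (b + a *~ k) (b + a *~ k) = 0.
  rewrite {1}(rs_add D) (qMzl D) (oC _ _ aC rPsi nC) (oC _ _ bC rPsi nC).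
  by rewrite mulr0 addr0.
by move=> h; have := rs_pos D r; rewrite h ltxx.
Qed.

Lemma component_exists c : Psi c -> exists2 C, q_component C & C c.
Proof.
move=> cPsi; pose closed X := forall a b : V, X a -> Psi b -> q a b != 0 -> X b.
pose C b := Psi b /\ forall X : V -> Prop, X c -> closed X -> X b.
have cC : C c by [].
have stepC a b : C a -> Psi b -> q a b != 0 -> C b.
  by move=> [_ h] bPsi ab; split=> // X Xc Xcl; apply: (Xcl a) => //; apply: h.
exists C => //; split.
- by move=> a [].
- by exists c.
- move=> A B AB o.
  have main A' B' : (forall a, C a <-> A' a \/ B' a) ->
      (forall a b, A' a -> B' b -> q a b = 0) -> A' c -> forall b, ~ B' b.
    move=> AB' o' Ac b bB.
    have bC : C b by apply/AB'; right.
    have bA : A' b.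
      have [_ /(_ (fun x => C x /\ A' x))[||//]] := bC; first by split.
      move=> x y [xC xA] yPsi xy; have yC := stepC _ _ xC yPsi xy; split=> //.
      by case/AB': (yC) => // yB; case/eqP: xy; apply: o'.
    have := o' _ _ bA bB => bb.
    by have := rs_pos D (sPsi.1 _ bC.1); rewrite bb ltxx.
  have [/(_ cC)[cA|cB] _] := AB c; first by right; apply: (main A B).
  left; apply: (main B A) => // [a|a b aB bA]; last by rewrite qC o.
  by rewrite AB; tauto.
move=> a b aC bPsi nC; apply/eqP; apply: contrapT => /negP ab.
by apply: nC; apply: (stepC a).
Qed.

(** The parts of [X] inside and outside of the component are orthogonal. *)
Lemma irreducible_component_cases C X : q_component C ->
  (forall a, X a -> Psi a) -> q_irreducible q X ->
  (forall a, X a -> C a) \/ (forall a, X a -> ~ C a).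
Proof.
move=> [_ _ _ oC] XPsi irr.
have [a|a b [_ aC] [bX nC]|h|h] := irr (fun a => X a /\ C a) (fun a => X a /\ ~ C a).
- by split=> [aX|[[]|[]] //]; case: (pselect (C a)); [left|right].
- by apply: oC => //; apply: XPsi.
- by right=> a aX aC; apply: (h a).
by left=> a aX; apply: contrapT => nC; apply: (h a).
Qed.

(** Such a sum would lie in the component or be orthogonal to it; in either case
    one of the summands would be orthogonal to itself. *)
Lemma component_separated C a b : q_component C -> C a -> Psi b -> ~ C b ->
  a + b \notin Phi.
Proof.
move=> cC aC bPsi nb; have [CPsi _ _ oC] := cC; apply/negP=> r.
have ab := oC _ _ aC bPsi nb.
have rPsi : Psi (a + b).
  by have := sPsi.2 b a 1 bPsi (CPsi _ aC); rewrite mulr1z; apply.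
have [rC|rC] := pselect (C (a + b)).
  have := oC _ _ rC bPsi nb; rewrite (rs_add D) ab add0r => bb.
  by have := rs_pos D (sPsi.1 _ bPsi); rewrite bb ltxx.
have := oC _ _ aC rPsi rC; rewrite (qDr D) ab addr0 => aa.
by have := rs_pos D (sPsi.1 _ (CPsi _ aC)); rewrite aa ltxx.
Qed.

End Component.

(** * The Kostant cascade *)

Section Cascade.
Variables (F : realFieldType) (V : zmodType) (q : V -> V -> F) (Phi : seq V).
Variable P : V -> Prop.
Hypothesis D : root_system q Phi.
Hypothesis DP : positive_system Phi P.
Implicit Types (a b c : V) (C X : V -> Prop).

Let qC := rs_sym D.
Local Notation highest := (highest P).

Inductive q_cascade : (V -> Prop) -> Prop :=
| q_cascade_start : q_cascade (fun a => a \in Phi)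
| q_cascade_step C b C' : q_cascade C -> highest C b ->
    q_component q (fun c => C c /\ q c b = 0) C' -> q_cascade C'.

Definition cascade_root b := exists2 C, q_cascade C & highest C b.

Variable theta : V.
Hypothesis thPhi : theta \in Phi.
Hypothesis hth : forall a, a \in Phi -> nonneg P (theta - a).

Lemma highest_theta : highest (fun a => a \in Phi) theta.
Proof.
split=> // c /hth[s sP e]; exists s => // x xs; split; last exact: sP.
exact: (ps_root DP (sP _ xs)).
Qed.

Lemma orth_subsystem C b : subsystem Phi C -> subsystem Phi (fun c => C c /\ q c b = 0).
Proof.
move=> [CPhi Cs]; split=> [c [/CPhi //]|c d k [cC cb] [dC db] r]; split; first exact: Cs.
by rewrite (rs_add D) (qMzl D) cb db mulr0 addr0.
Qed.

Lemma q_cascade_inv C : q_cascade C ->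
  [/\ subsystem Phi C, q_irreducible q C & exists a, C a].
Proof.
elim=> [|{}C b C' _ [sC _ _] _ comp].
  split; [exact: subsystem_roots | exact: (roots_irreducible D DP thPhi hth) | by exists theta].
have [_ ne irr _] := comp; split=> //.
exact: (component_subsystem D (orth_subsystem b sC) comp).
Qed.

Lemma q_cascade_highest C : q_cascade C -> exists b, highest C b.
Proof.
by move=> /q_cascade_inv[sC irr [a aC]]; apply: (highest_exists D DP sC irr aC).
Qed.

Lemma highest_ext C C' b : (forall a, C a <-> C' a) -> highest C b -> highest C' b.
Proof.
move=> CC' [bC h]; split; first exact/CC'.
by move=> c /CC' /h[s sP e]; exists s => // x /sP[/CC']; split.
Qed.

(** The mutual position of two systems of the cascade: equal, one inside the
    part of the other orthogonal to its highest root, or strongly orthogonal. *)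
Definition cascade_position C1 C2 :=
  [\/ forall a, C1 a <-> C2 a,
      forall b, highest C1 b -> forall a, C2 a -> C1 a /\ q a b = 0,
      forall b, highest C2 b -> forall a, C1 a -> C2 a /\ q a b = 0
    | forall a b, C1 a -> C2 b -> q a b = 0 /\ a + b \notin Phi].

Lemma cascade_position_sym C1 C2 : cascade_position C1 C2 -> cascade_position C2 C1.
Proof.
case=> h; [constructor 1|constructor 3|constructor 2|constructor 4] => //.
  by move=> a; rewrite h.
by move=> a b aC bC; rewrite qC addrC; apply: h.
Qed.

Lemma norm_neq0 a : a \in Phi -> q a a <> 0.
Proof. by move=> /(rs_pos D) p e; rewrite e ltxx in p. Qed.

Lemma cascade_position_start C : q_cascade C ->
  cascade_position C (fun a => a \in Phi).
Proof.
elim=> [|{}C e C' cC IH he comp]; first by constructor 1.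
have [sC _ [c cC0]] := q_cascade_inv cC; have [C'sub _ _ _] := comp.
have ePhi := sC.1 _ he.1.
case: IH => h.
- constructor 3 => b hb a /C'sub[aC ae]; split; first exact: sC.1.
  have hb' := highest_ext (fun a => iff_sym (h a)) hb.
  by rewrite (highest_unique D DP hb' he).
- by case: (norm_neq0 ePhi); apply: (h _ he _ ePhi).2.
- by constructor 3 => b hb a /C'sub[aC _]; apply: h.
by case: (norm_neq0 (sC.1 _ cC0)); apply: (h _ _ cC0 (sC.1 _ cC0)).1.
Qed.

Lemma cascade_position_total C1 C2 : q_cascade C1 -> q_cascade C2 ->
  cascade_position C1 C2.
Proof.
move=> c1 c2; elim: c2 C1 c1 => [|E d {}C2 cE IHE hd comp2] C1 c1.
  exact: cascade_position_start.
have c2 : q_cascade C2 := q_cascade_step cE hd comp2.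
have [sE _ _] := q_cascade_inv cE.
have [C2sub _ irr2 oC2] := comp2.
have sPsi := orth_subsystem d sE.
elim: c1 => [|G e {}C1 cG IHG he comp1].
  exact/cascade_position_sym/cascade_position_start.
have c1 : q_cascade C1 := q_cascade_step cG he comp1.
have [sC1 irr1 [a0 a0C1]] := q_cascade_inv c1.
have [C1sub _ _ _] := comp1.
case: (IHE _ c1) => h.
- constructor 2 => b hb a /C2sub[aE ad]; split; first exact/h.
  by rewrite (highest_unique D DP (highest_ext h hb) hd).
- by constructor 2 => b hb a /C2sub[aE _]; apply: h.
- have C1Psi : forall a, C1 a -> E a /\ q a d = 0 by apply: h.
  case: (irreducible_component_cases comp2 C1Psi irr1) => sub; last first.
    constructor 4 => a b aC bC; rewrite qC addrC; split.
      by apply: oC2 => //; [apply: C1Psi | apply: sub].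
    by apply: (component_separated D sPsi comp2) => //; [apply: C1Psi | apply: sub].
  case: IHG => h'.
  + constructor 3 => b hb a aC1; split; first exact: sub.
    rewrite (highest_unique D DP (highest_ext (fun a => iff_sym (h' a)) hb) he).
    by have [] := C1sub _ aC1.
  + have C2Psi : forall a, C2 a -> G a /\ q a e = 0 by apply: h'.
    case: (irreducible_component_cases comp1 C2Psi irr2) => sub'.
      by constructor 1 => a; split; [apply: sub | apply: sub'].
    by case: (sub' _ (sub _ a0C1)).
  + by constructor 3 => b hb a /C1sub[aG _]; apply: h'.
  have [a0G _] := C1sub _ a0C1.
  by case: (norm_neq0 (sC1.1 _ a0C1)); apply: (h' _ _ a0G (sub _ a0C1)).1.
by constructor 4 => a b aC /C2sub[bE _]; apply: h.
Qed.

Lemma cascade_root_pos b : cascade_root b -> P b.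
Proof. by move=> [C /q_cascade_inv[sC _ _] h]; apply: (highest_pos D DP sC h). Qed.

Lemma cascade_strongly_orthogonal b c : cascade_root b -> cascade_root c ->
  b <> c -> q b c = 0 /\ b + c \notin Phi.
Proof.
move=> kb kc bc; have bP := cascade_root_pos kb; have cP := cascade_root_pos kc.
have main C1 C2 x y : q_cascade C1 -> highest C1 x -> highest C2 y -> P y ->
    C1 y /\ q y x = 0 -> q x y = 0 /\ x + y \notin Phi.
  move=> c1 h1 h2 yP [yC1 yx]; split; first by rewrite qC.
  apply/negP=> r; have [sC1 _ _] := q_cascade_inv c1.
  have [s sP e] := h1.2 _ (add_closed sC1 h1.1 yC1 r).
  apply: (nonneg_P_false D DP yP); exists s; first by move=> z /sP[].
  by rewrite -e opprD addrA subrr add0r.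
move: kb kc => [C1 c1 h1] [C2 c2 h2].
case: (cascade_position_total c1 c2) => h.
- by case: bc; apply: (highest_unique D DP (highest_ext h h1) h2).
- by apply: (main C1 C2 b c) => //; apply: h => //; case: h2.
- rewrite qC addrC; apply: (main C2 C1 c b) => //; apply: h => //; by case: h1.
by apply: h; [case: h1 | case: h2].
Qed.

(** Descend in the cascade along the components that contain [a], until [a] is
    not orthogonal to the highest root. *)
Lemma cascade_reaches a : a \in Phi ->
  exists C b, [/\ q_cascade C, highest C b, C a & q a b != 0].
Proof.
move=> aPhi.
have key n C : q_cascade C -> (count (fun c => `[< C c >]) Phi <= n)%N -> C a ->
    exists C b, [/\ q_cascade C, highest C b, C a & q a b != 0].
  elim: n C => [|n IH] C cC Cn aC.
    move: Cn; rewrite leqNgt -has_count => /hasPn/(_ _ aPhi)/asboolP[] //.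
  have [b hb] := q_cascade_highest cC; have [sC _ _] := q_cascade_inv cC.
  have [ab|ab] := eqVneq (q a b) 0; last by exists C, b.
  have sPsi := orth_subsystem b sC.
  have [C' comp aC'] := component_exists D sPsi (conj aC ab).
  have [C'sub _ _ _] := comp.
  apply: (IH C') => //; first exact: (q_cascade_step cC hb comp).
  rewrite -ltnS; apply: leq_trans Cn; apply: (@count_lt _ _ _ _ b).
  - by move=> c /asboolP /C'sub[cC' _]; apply/asboolP.
  - exact: sC.1 _ hb.1.
  - by apply/asboolP; case: hb.
  apply/asboolP=> /C'sub[_]; exact: norm_neq0 (sC.1 _ hb.1).
exact: (key _ _ q_cascade_start (leqnn _)).
Qed.

Section CascadeSeq.
Variable K : seq V.
Hypothesis uK : uniq K.
Hypothesis KP : forall b, b \in K <-> cascade_root b.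

Lemma cascade_orthogonal_seq : orthogonal_seq q K.
Proof.
split=> // b c /KP kb /KP kc /eqP bc.
by have [] := cascade_strongly_orthogonal kb kc bc.
Qed.

(** The product of the reflections in the cascade is the longest element of the
    Weyl group. If [b] is the highest root of a system of the cascade containing
    [a] and [(a, b) > 0], the other reflections keep [a] in that system, with the
    same product with [b], and the reflection in [b] then makes it negative. *)
Lemma cascade_refl_neg a : P a -> P (- refl q K a).
Proof.
move=> aP; have aPhi := ps_root DP aP.
have [C [b [cC hb aC ab]]] := cascade_reaches aPhi.
have [sC _ _] := q_cascade_inv cC.
have bK : b \in K by apply/KP; exists C.
have KPhi : {subset K <= Phi}.
  by move=> x /KP /cascade_root_pos; apply: (ps_root DP).
have oK := cascade_orthogonal_seq.
pose T := rem b K.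
have TK x : x \in T -> x \in K by apply: mem_rem.
have oT : orthogonal_seq q T.
  split; first exact: rem_uniq.
  by move=> x y xT yT; apply: oK.2; apply: TK.
have g1C : C (refl q T a).
  apply: (refl_in_subsystem D sC) => // [x /TK/KPhi //|c cT].
  have /KP[C' cC' hc] := TK _ cT.
  case: (cascade_position_total cC cC') => h.
  - have bc := highest_unique D DP (highest_ext h hb) hc.
    by move: cT; rewrite /T mem_rem_uniq // inE -bc eqxx.
  - by left; have [] := h _ hb _ hc.1.
  - by right; have [] := h _ hc _ aC.
  by right; have [] := h _ _ aC hc.1.
have n0 : 0 < cz q a b.
  rewrite (cz_gt0 D (KPhi _ bK) aPhi) lt_def ab qC.
  exact: (highest_dom D DP sC hb aC aP).
have [k kE] : exists k : nat, cz q a b = k.+1 by exists (`|cz q a b| - 1)%N; lia.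
apply: (nonneg_root D DP); first exact/(root_neg D)/(refl_root D).
have -> : - refl q K a = (b - refl q T a) + b *+ k.
  rewrite /refl (big_rem b bK) /= kE -[b *~ _]/(b *+ k.+1) mulrS !opprB.
  by rewrite -!addrA; congr (_ + _); rewrite addrC -addrA; congr (_ + _); rewrite addrC.
apply: nonnegD; first by apply: nonneg_in_nonneg (hb.2 _ g1C).
by apply/nonneg_Mn/nonneg_pos/cascade_root_pos/KP.
Qed.

End CascadeSeq.
End Cascade.

(** * The root system of a complex simple Lie algebra *)

Section Transfer.
Variables (R : realType) (g : lieAlgType R[i]) (t : {vspace g}).
Variable Phi : seq (dual t).
Hypothesis RD : root_data Phi.
Implicit Types (a b c : dual t).

(** On roots the form is real; its real part lives in an ordered field. *)
Definition kre a b : R := complex.Re (kform a b).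

Lemma kform_kre a b : a \in Phi -> b \in Phi -> kform a b = (kre a b)%:C%C.
Proof.
move=> aP bP; have := rd_real RD aP bP; rewrite /kre realE !lecE /=.
by case: (kform a b) => x y /= /orP[]/andP[/eqP h _]; [rewrite h | rewrite -h].
Qed.

Lemma kform_eq0 a b : a \in Phi -> b \in Phi -> kform a b = 0 <-> kre a b = 0.
Proof.
move=> aP bP; rewrite kform_kre //; split=> [|->] //.
by move=> h; apply: (complexI h).
Qed.

Lemma ReD (x y : R[i]) : complex.Re (x + y) = complex.Re x + complex.Re y.
Proof. by case: x y => [? ?] []. Qed.

Lemma intr_complex (z : int) : z%:~R = (z%:~R : R)%:C%C :> R[i].
Proof. by rewrite rmorph_int. Qed.

Lemma kre_root_system : root_system kre Phi.
Proof.
split.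
- by move=> a b; rewrite /kre kformC.
- by move=> a b c; rewrite /kre (rd_kformD RD) ReD.
- exact: (rd_neq0 RD).
- exact: (rd_double RD).
- by move=> a aP; have := rd_pos RD aP; rewrite ltcE => /andP[].
- move=> a b aP bP; have [z e zP] := rd_int RD aP bP; exists z => //.
  move: e; rewrite !kform_kre // intr_complex -(rmorph_nat (real_complex R) 2) -!rmorphM.
  by move/complexI; apply.
move=> s sP; have [ge0 eq0] := rd_posdef RD sP; split.
  by move: ge0; rewrite lecE => /andP[].
move=> e; apply: eq0; move: ge0; rewrite lecE => /andP[/eqP im _].
by move: e im; rewrite /kre; case: (kform _ _) => x y /= -> ->.
Qed.

Variable P : set (dual t).
Hypothesis hP : positive_roots P.

Lemma lie_roots_seq : lie_roots t = (fun a => a \in Phi) :> set (dual t).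
Proof. by apply/funext=> a; apply/propext/(rd_mem RD). Qed.

Lemma positive_system_of : positive_system Phi P.
Proof.
case: hP => h1 h2 h3 h4; split=> //.
- by move=> a /h1 /(rd_mem RD).
- by move=> a /(rd_mem RD) /h2.
by move=> a b aP bP /(rd_mem RD); apply: h4.
Qed.

Lemma irreducible_rootsE (C : set (dual t)) : (forall a, C a -> a \in Phi) ->
  irreducible_roots C <-> (exists a, C a) /\ q_irreducible kre C.
Proof.
move=> CPhi; split=> -[ne irr]; split=> //.
  move=> A B AB o.
  have e : (A `|` B)%classic = C by apply/funext=> a; apply/propext; rewrite AB.
  have o' a b : A a -> B b -> kform a b = 0.
    move=> aA bB; apply/kform_eq0; [apply/CPhi/AB; left | apply/CPhi/AB; right |] => //.
    exact: o.
  by case: (irr A B e o') => ->; [left|right] => a [].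
move=> A B AB o.
have AB' a : C a <-> A a \/ B a by rewrite -AB.
have o' a b : A a -> B b -> kre a b = 0.
  move=> aA bB; apply/kform_eq0; [apply/CPhi/AB'; left | apply/CPhi/AB'; right |] => //.
  exact: o.
case: (irr A B AB' o') => h; [left|right]; apply/funext=> a; apply/propext;
  by split=> // /h.
Qed.

Lemma irreducible_componentE (Psi C : set (dual t)) : (forall a, Psi a -> a \in Phi) ->
  irreducible_component Psi C <-> q_component kre Psi C.
Proof.
move=> PsiPhi; split.
  move=> [sub irr o]; have CPhi a : C a -> a \in Phi by move=> /sub/PsiPhi.
  have [ne irr'] := (irreducible_rootsE CPhi).1 irr; split=> // a b aC bPsi nC.
  by apply/kform_eq0; [apply: CPhi | apply: PsiPhi | apply: o].
move=> [sub ne irr o]; have CPhi a : C a -> a \in Phi by move=> /sub/PsiPhi.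
split=> //; first by apply/(irreducible_rootsE CPhi).
move=> a b aC [bPsi nC]; apply/kform_eq0; [exact: CPhi | exact: PsiPhi | exact: o].
Qed.

Lemma orth_set_kre (C : set (dual t)) b : (forall a, C a -> a \in Phi) -> b \in Phi ->
  [set a | C a /\ kform a b = 0]%classic = (fun a => C a /\ kre a b = 0) :> set (dual t).
Proof.
move=> CPhi bPhi; apply/funext=> a; apply/propext.
by split=> -[aC h]; split=> //; apply/kform_eq0 => //; apply: CPhi.
Qed.

Lemma cascade_subsystemE (C : set (dual t)) :
  cascade_subsystem P C <-> q_cascade kre Phi P C.
Proof.
split.
  move=> cC; suff [//] : q_cascade kre Phi P C /\ forall a, C a -> a \in Phi.
  elim: cC => [|{}C b C' _ [cC CPhi] hb comp].
    by rewrite lie_roots_seq; split=> //; apply: q_cascade_start.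
  have bPhi := CPhi _ hb.1; rewrite orth_set_kre // in comp.
  have {}comp := (@irreducible_componentE (fun a => C a /\ kre a b = 0) C' (fun a h => CPhi a h.1)).1 comp.
  split; first exact: (q_cascade_step cC hb comp).
  by case: comp => sub _ _ _ a /sub[/CPhi].
move=> cC; suff [//] : cascade_subsystem P C /\ forall a, C a -> a \in Phi.
elim: cC => [|{}C b C' _ [cC CPhi] hb comp].
  by split=> //; rewrite -lie_roots_seq; apply: cascade_start.
have bPhi := CPhi _ hb.1; split.
  apply: (cascade_step cC hb); rewrite orth_set_kre //.
  exact: ((@irreducible_componentE (fun a => C a /\ kre a b = 0) C' (fun a h => CPhi a h.1)).2 comp).
by case: comp => sub _ _ _ a /sub[/CPhi].
Qed.

Lemma kostant_cascadeE b : kostant_cascade P b <-> cascade_root kre Phi P b.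
Proof.
by split=> -[C /cascade_subsystemE cC hb]; exists C.
Qed.

Lemma cartan_pairingE a b : a \in Phi -> b \in Phi ->
  cartan_pairing a b = (cz kre a b)%:~R.
Proof.
move=> aP bP; have D := kre_root_system.
rewrite /cartan_pairing !kform_kre // intr_complex -(rmorph_nat (real_complex R) 2) -!rmorphM.
rewrite (czE D bP aP) rmorphM mulfK //.
rewrite -(rmorph0 (real_complex R)) (inj_eq (@complexI R)) gt_eqF //.
exact: (rs_pos D bP).
Qed.

Lemma fundamental_weightE theta : theta \in Phi ->
  fundamental_weight P theta <-> fundamental_root kre P theta.
Proof.
move=> thP; have DP := positive_system_of.
split=> -[a sa h]; exists a => // b sb; have := h b sb; have bP := ps_root DP sb.1.
  by rewrite cartan_pairingE // pmulrn => /eqP; rewrite eqr_int => /eqP.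
by rewrite cartan_pairingE // => ->; rewrite pmulrn.
Qed.

End Transfer.

(** * The grading by the neutral element of the cascade *)

Section Sl2.
Variables (R : realType) (g : lieAlgType R[i]) (t : {vspace g}).
Variable Phi : seq (dual t).
Hypothesis RD : root_data Phi.
Variable K : seq (dual t).
Hypothesis KPhi : {subset K <= Phi}.
Hypothesis oK : orthogonal_seq (@kre R g t) K.
Variable e : dual t -> g.
Hypothesis he : root_vectors e.

Let D := kre_root_system RD.
Local Notation cz := (cz (@kre R g t)).

Let E : g := \sum_(b <- K) e b.

(** The eigenvalue of the neutral element [\sum_K coroot] on a root space. *)
Definition deg a : int := \sum_(b <- K) cz a b.

Lemma sl2_choice : exists (hh : dual t -> subvs_of t) (ff : dual t -> g),
  forall b, b \in K -> [/\ in_root_space (- b) (ff b), lie (e b) (ff b) = vsval (hh b)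
    & forall a, a \in Phi -> a (hh b) = (cz a b)%:~R].
Proof.
have /choice[s sP] : forall b, exists s : subvs_of t * g, b \in K ->
    [/\ in_root_space (- b) s.2, lie (e b) s.2 = vsval s.1
      & forall a, a \in Phi -> a s.1 = (cz a b)%:~R].
  move=> b; have [bK|_] := boolP (b \in K); last by exists (0, 0).
  have bPhi := KPhi bK; have [e0 er] := he ((rd_mem RD b).2 bPhi).
  have [h [f [fr ef hE]]] := rd_sl2 RD bPhi e0 er.
  exists (h, f) => _; split=> // a aPhi; rewrite hE.
  exact: (cartan_pairingE RD aPhi bPhi).
by exists (fun b => (s b).1), (fun b => (s b).2).
Qed.

Lemma deg_K b : b \in K -> deg b = 2.
Proof.
move=> bK; have bPhi := KPhi bK.
rewrite /deg (bigD1_seq b) ?oK.1 //= (czxx D bPhi) big_seq_cond big1 ?addr0 //.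
move=> c /andP[cK cb]; apply/eqP; rewrite (cz_eq0 D (KPhi cK) bPhi).
by rewrite oK.2 // eq_sym.
Qed.

Lemma degN a : a \in Phi -> deg (- a) = - deg a.
Proof.
move=> aPhi; rewrite /deg -sumrN; apply: eq_big_seq => b bK.
exact: (czN D (KPhi bK) aPhi).
Qed.

Section Neutral.
Variables (hh : dual t -> subvs_of t) (ff : dual t -> g).
Hypothesis hf : forall b, b \in K -> [/\ in_root_space (- b) (ff b),
  lie (e b) (ff b) = vsval (hh b) & forall a, a \in Phi -> a (hh b) = (cz a b)%:~R].

Let H := \sum_(b <- K) hh b.
Let f := \sum_(b <- K) ff b.

Lemma neutral_eig a : a \in Phi -> a H = (deg a)%:~R.
Proof.
move=> aPhi; rewrite /H linear_sum rmorph_sum; apply: eq_big_seq => b bK.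
by have [_ _ h] := hf bK; apply: h.
Qed.

Lemma lie_H_E : lie (vsval H) E = 2 *: E.
Proof.
rewrite lie_sumr scaler_sumr; apply: eq_big_seq => b bK.
have bPhi := KPhi bK; have [_ er] := he ((rd_mem RD b).2 bPhi).
by rewrite er neutral_eig // deg_K.
Qed.

Lemma lie_H_f : lie (vsval H) f = - 2 *: f.
Proof.
rewrite lie_sumr scaler_sumr; apply: eq_big_seq => b bK.
have bPhi := KPhi bK; have [fr _ _] := hf bK.
by rewrite fr opp_lfunE neutral_eig // deg_K.
Qed.

Lemma lie_H_step x y c d : lie (vsval H) x = c *: x -> lie (vsval H) y = d *: y ->
  lie (vsval H) (lie x y) = (c + d) *: lie x y.
Proof. by move=> hx hy; rewrite lie_der hx hy lieZl lieZr scalerDl. Qed.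

Lemma lie_H_iter x c n : lie (vsval H) x = c *: x ->
  lie (vsval H) (iter n (ad E) x) = (c + n%:R * 2) *: iter n (ad E) x.
Proof.
move=> hx; elim: n => [|n IH]; first by rewrite mul0r addr0.
rewrite iterS adE (lie_H_step lie_H_E IH); congr (_ *: _).
by rewrite -[n.+1]addn1 natrD; ring.
Qed.

Lemma H_bound (M : nat) x (z : int) : (forall a, a \in Phi -> deg a <= M%:Z) ->
  lie (vsval H) x = z%:~R *: x -> x != 0 -> - M%:Z <= z <= M%:Z.
Proof.
move=> dM xz x0; have [a] := rd_eig RD x0 xz.
rewrite inE => /predU1P[->|aPhi].
  by rewrite zero_lfunE => /eqP; rewrite intr_eq0 => /eqP ->; lia.
rewrite neutral_eig // => /eqP; rewrite eqr_int => /eqP ->.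
have := dM _ aPhi; have := dM _ (root_neg D aPhi); rewrite degN //; lia.
Qed.

(** [ad E] raises degrees by [2], and the degrees of the roots lie in
    [[- M, M]]. *)
Lemma ad_E_nilpotent (M : nat) : (forall a, a \in Phi -> deg a <= M%:Z) ->
  forall x, iter M.+1 (ad E) x = 0.
Proof.
move=> dM x; have [F [-> Fr]] := rd_sum RD x.
have -> : iter M.+1 (ad E) (\sum_(a <- 0 :: Phi) F a) =
    \sum_(a <- 0 :: Phi) iter M.+1 (ad E) (F a).
  elim: (0 :: Phi) => [|a s IH]; first by rewrite !big_nil iter_lfun0.
  by rewrite !big_cons iter_lfunD IH.
rewrite big_seq big1 // => a aP; have Fa := Fr _ aP H.
have [z zE zM] : exists2 z : int, a H = z%:~R & - M%:Z <= z.
  move: aP; rewrite inE => /predU1P[->|aPhi].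
    by exists 0; rewrite ?zero_lfunE //; lia.
  exists (deg a); first exact: neutral_eig.
  by have := dM _ (root_neg D aPhi); rewrite degN //; lia.
apply/eqP; apply: contraT => x0.
have := lie_H_iter M.+1 Fa; rewrite zE => xE.
have : - M%:Z <= z + M.+1%:Z * 2 <= M%:Z.
  by apply: (H_bound dM _ x0); rewrite xE intrD intrM.
lia.
Qed.

Hypothesis strong : forall b c, b \in K -> c \in K -> b != c -> b + c \notin Phi.

(** Strong orthogonality removes the mixed brackets. *)
Lemma lie_E_f : lie E f = vsval H.
Proof.
rewrite /E lie_suml /H linear_sum; apply: eq_big_seq => b bK /=.
rewrite lie_sumr (bigD1_seq b) ?oK.1 //= big_seq_cond big1 ?addr0.
  by have [_ -> _] := hf bK.
move=> c /andP[cK cb]; have bPhi := KPhi bK; have cPhi := KPhi cK.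
have [_ er] := he ((rd_mem RD b).2 bPhi); have [fr _ _] := hf cK.
apply: (rd_lie0 RD bPhi (root_neg D cPhi) er fr).
  by rewrite subr_eq0 eq_sym.
have bc : b != c by rewrite eq_sym.
apply/negP=> r; apply: (negP (strong bK cK bc)).
have := cz_refl D cPhi r.
have -> : cz (b - c) c = - 2.
  rewrite (czB D cPhi bPhi cPhi r) (czxx D cPhi).
  have /eqP -> : cz b c == 0 by rewrite (cz_eq0 D cPhi bPhi) oK.2 // eq_sym.
  by rewrite sub0r.
by rewrite mulrNz opprK -[c *~ 2]/(c *+ 2) mulr2n addrA subrK.
Qed.

(** A lowest weight vector of weight [-4] generates a five-dimensional
    [sl2]-module. *)
Lemma ad_E4_neq0 v : v != 0 -> lie (vsval H) v = - 4 *: v -> lie f v = 0 ->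
  iter 4 (ad E) v != 0.
Proof.
move=> v0 hv fv; pose u n := iter n (ad E) v.
have step n : lie f (u n.+1) = (4 - n%:R * 2) *: u n + lie E (lie f (u n)).
  rewrite /u iterS adE lie_der (lieC f E) lie_E_f lieNl (lie_H_iter n hv).
  by rewrite -scaleNr opprD opprK.
have fu n : lie f (u n.+1) = (n.+1%:R * (4 - n%:R)) *: u n.
  elim: n => [|n IH]; first by rewrite step fv lie0r addr0 mul0r subr0 mul1r.
  rewrite step IH lieZr -[lie E (u n)]adE -scalerDl; congr (_ *: _).
  by rewrite -[n.+2]addn1 -[n.+1]addn1 !natrD; ring.
have down n : (n < 4)%N -> u n.+1 = 0 -> u n = 0.
  move=> n4 un; have := fu n; rewrite un lie0r => /esym/eqP.
  rewrite scaler_eq0 mulf_eq0 pnatr_eq0 /= subr_eq0 -[4]/(4%:R) eqr_nat.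
  by rewrite gtn_eqF //= => /eqP.
apply: contra v0 => /eqP u4; apply/eqP.
exact: (down 0%N isT (down 1%N isT (down 2%N isT (down 3%N isT u4)))).
Qed.

End Neutral.
End Sl2.

Theorem theorem9p1 (R : realType) (g : lieAlgType R[i]) (t : {vspace g})
    (P : set (dual t)) (e : dual t -> g) (theta : dual t)
    (hg : simple_lie g) (ht : cartan_subalgebra t)
    (hP : positive_roots P) (he : root_vectors e)
    (htheta : highest_root P (lie_roots t) theta) :
  (fundamental_weight P theta ->
     (exists2 alpha : dual t,
        unique (fun a => simple_root P a /\ kform theta a <> 0) alpha &
        iter 4 (ad (e_cascade P e)) (e (- theta + alpha)) <> 0) /\
     (forall x : g, iter 5 (ad (e_cascade P e)) x = 0)) /\
  (~ fundamental_weight P theta ->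
     forall x : g, iter 3 (ad (e_cascade P e)) x = 0).
Proof.
have [Phi RD] := root_data_exists hg ht.
have D := kre_root_system RD; have DP := positive_system_of RD hP.
have thPhi : theta \in Phi by apply/(rd_mem RD)/htheta.1.
have hth a : a \in Phi -> nonneg P (theta - a).
  by move=> /(rd_mem RD) /htheta.2[s sP E]; exists s => // x /sP[].
(* the cascade as a duplicate-free sequence, and below without [theta] *)
pose K := [seq b <- undup Phi | `[< kostant_cascade P b >]].
have KP b : b \in K <-> cascade_root (@kre R g t) Phi P b.
  rewrite mem_filter mem_undup; split; first by case/andP=> /asboolP/(kostant_cascadeE RD).
  move=> kb; rewrite (ps_root DP (cascade_root_pos D DP thPhi hth kb)) andbT.
  by apply/asboolP/(kostant_cascadeE RD).
have uK : uniq K by rewrite filter_uniq ?undup_uniq.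
have Kpos b : b \in K -> P b by move=> /KP; apply: (cascade_root_pos D DP thPhi hth).
have KPhi : {subset K <= Phi} by move=> b /Kpos /(ps_root DP).
have thK : theta \in K.
  apply/KP; exists (fun a => a \in Phi); first exact: q_cascade_start.
  exact: (highest_theta DP thPhi hth).
have oK := cascade_orthogonal_seq D DP thPhi hth uK KP.
have strongK b c : b \in K -> c \in K -> b != c -> b + c \notin Phi.
  move=> /KP kb /KP kc /eqP bc.
  by have [] := cascade_strongly_orthogonal D DP thPhi hth kb kc bc.
have eE : e_cascade P e = \sum_(b <- K) e b.
  rewrite /e_cascade (_ : kostant_cascade P = [set` K]%classic) -?fsbig_seq //.
  apply/funext=> b; apply/propext; rewrite /= KP; exact: (kostant_cascadeE RD).
pose S := rem theta K.
have pK := perm_to_rem thK; rewrite -/S in pK.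
have oS : orthogonal_seq (@kre R g t) (theta :: S).
  split; first by rewrite -(perm_uniq pK).
  by move=> a b aS bS; apply: oK.2; rewrite (perm_mem pK).
have SK b : b \in S -> b \in K by apply: mem_rem.
have SPhi : {subset S <= Phi} by move=> b /SK/KPhi.
have degE a : deg K a = thdeg (@kre R g t) theta S a.
  by rewrite /deg (perm_big _ pK) big_cons.
have [hh [ff hf]] := sl2_choice RD KPhi he.
have strongS b c : b \in S -> c \in S -> b != c -> b + c \notin Phi.
  by move=> bS cS; apply: strongK; apply: SK.
have le4 a : a \in Phi -> deg K a <= 4%N.
  by move=> aP; rewrite degE; apply: (thdeg_le4 D thPhi SPhi oS aP).
rewrite eE; split=> [fw|nfw]; last first.
  apply: (ad_E_nilpotent RD KPhi oK he hf) => a aP; rewrite degE.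
  apply: (thdeg_le2 D DP thPhi hth SPhi oS strongS) => //.
  by move=> /(fundamental_weightE RD hP thPhi).
split; last exact: (ad_E_nilpotent RD KPhi oK he hf).
have [al sal fal] := (fundamental_weightE RD hP thPhi).1 fw.
have SP b : b \in S -> P b by move=> /SK/Kpos.
have neg a : P a -> P (- refl (@kre R g t) (theta :: S) a).
  move=> aP; have := cascade_refl_neg D DP thPhi hth uK KP aP.
  by rewrite /refl (perm_big _ pK).
have [gPhi gdeg] := fund_lowest D DP thPhi hth SP oS neg sal fal.
rewrite -degE in gdeg.
exists al.
  have alPhi := ps_root DP sal.1; split.
    split=> //; move/(kform_eq0 RD thPhi alPhi)/eqP.
    by rewrite -(cz_eq0 D alPhi thPhi) fal // eqxx.
  move=> b [sb bth]; have bPhi := ps_root DP sb.1.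
  apply/esym/eqP; apply: contraT => ba; case: bth.
  apply/(kform_eq0 RD thPhi bPhi)/eqP.
  by rewrite -(cz_eq0 D bPhi thPhi) fal // (negPf ba).
have [e0 er] := he _ ((rd_mem RD _).2 gPhi).
set gam := - theta + al in gPhi gdeg e0 er *.
have hv : lie (vsval (\sum_(b <- K) hh b)) (e gam) = - 4 *: e gam.
  by rewrite er (neutral_eig hf gPhi) gdeg.
apply/eqP/(ad_E4_neq0 RD KPhi oK he hf strongK e0 hv).
apply/eqP; apply: contraT => f0.
(* [f_K] would produce a vector of weight [-6] *)
have := lie_H_step (lie_H_f RD KPhi oK hf) hv.
rewrite (_ : - 2 + - 4 = (- 6 : int)%:~R); last by rewrite -opprD -natrD mulrNz.
by move=> h; have := H_bound RD KPhi hf le4 h f0.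
Qed.
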